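(* Let $\mathcal A$ be a set of $n\ge 3$ points in general position in $\mathbb R^2$. Then for every $k\in\{0,1,\dots,n-3\}$, the number of regular subdivisions of $\mathcal A$ of dimension $k$ (equivalently, the number of $k$-dimensional faces of the secondary polytope $\Sigma(\mathcal A)$) is at least the number of $k$-dimensional faces of the $(n-3)$-dimensional associahedron, that is, at least the number of subdivisions of a convex $n$-gon that use exactly $n-3-k$ pairwise non-crossing diagonals. Explicitly, this number is $C_{n-2}^{k}=\frac{1}{n-1}\binom{n-3}{k}\binom{2n-4-k}{n-2}$.
   Context: A point configuration in $\mathbb R^2$ is in general position if no three of its points are collinear. A (polyhedral) subdivision of a finite configuration $\mathcal A\subset\mathbb R^2$ is a collection $T$ of subsets of $\mathcal A$ (its cells) such that: each $\mathrm{conv}(\mathcal C)$, $\mathcal C\in T$, is $2$-dimensional; $\bigcup_{\mathcal C\in T}\mathrm{conv}(\mathcal C)=\mathrm{conv}(\mathcal A)$; and for any two cells $\mathcal C,\mathcal C'$ the set $F=\mathrm{conv}(\mathcal C)\cap\mathrm{conv}(\mathcal C')$ is a common face of $\mathrm{conv}(\mathcal C)$ and $\mathrm{conv}(\mathcal C')$ and $F\cap\mathcal C=F\cap\mathcal C'$. (Not all points of $\mathcal A$ need to belong to a cell.) For $\mathcal A=\{P_1,\dots,P_N\}$ and $\omega\in\mathbb R^N$, the regular subdivision induced by $\omega$ has as cells the sets $\{P_i:(P_i,\omega_i)\in F\}$, where $F$ ranges over the lower facets of $\mathrm{conv}\{(P_i,\omega_i)\}\subset\mathbb R^3$ (facets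 whose supporting plane is non-vertical and lies below the polytope); a subdivision is regular if it arises this way. The set of $\omega$ inducing a given regular subdivision $T$ is a relatively open polyhedral cone; the dimension of $T$ is $N$ minus the dimension of that cone. Equivalently, regular subdivisions of $\mathcal A$ correspond bijectively (reversing refinement) to the nonempty faces of an $(N-3)$-dimensional polytope $\Sigma(\mathcal A)$, the secondary polytope, and the dimension of $T$ is the dimension of its face. For points in convex position all subdivisions are regular and $\Sigma$ is the associahedron. *)

(* Defs.v *)
From HB Require Import structures.
From mathcomp Require Import all_boot all_order all_algebra.
From mathcomp Require Import boolp classical_sets reals.

Set Implicit Arguments.
Unset Strict Implicit.
Unset Printing Implicit Defensive.

Import Order.TTheory GRing.Theory Num.Theory.

Local Open Scope classical_set_scope.
Local Open Scope ring_scope.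

(* Dimension of the affine hull of S: the largest k such that S contains k + 1
   affinely independent points x0, x0 + X_1, ..., x0 + X_k.  The empty set gets
   dimension 0. *)
Definition affine_dim (R : fieldType) (V : vectType R) (S : set V) : nat :=
  \max_(k < (\dim {:V}).+1 |
      `[< exists (x0 : V) (X : k.-tuple V),
            [/\ S x0, free X & forall x, x \in X -> S (x0 + x)] >]) k.

Section PointConfigurations.
Variable R : realType.

Definition collinear (x y z : 'rV[R]_2) : Prop :=
  exists p v : 'rV[R]_2,
    v != 0 /\ forall q, q \in [:: x; y; z] -> exists t : R, q = p + t *: v.

(* A configuration {P_1, ..., P_n} is given by an injective labelling P, and
   its subsets by sets of labels. *)
Definition general_position (n : nat) (P : 'I_n -> 'rV[R]_2) : Prop :=
  injective P /\
  forall i j l : 'I_n, i != j -> i != l -> j != l ->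
    ~ collinear (P i) (P j) (P l).

Definition conv_hull (d n : nat) (Q : 'I_n -> 'rV[R]_d) (C : {set 'I_n}) :
    set 'rV[R]_d :=
  [set x | exists lam : 'I_n -> R,
     [/\ forall i, 0 <= lam i, \sum_(i in C) lam i = 1
       & x = \sum_(i in C) lam i *: Q i]].

(* Taking u = 0 and c = 1 or c = 0 shows that the empty set and K itself are
   faces of K. *)
Definition is_face (d : nat) (K F : set 'rV[R]_d) : Prop :=
  exists (u : 'cV[R]_d) (c : R),
    (forall x, K x -> (x *m u) 0 0 <= c) /\
    F = [set x | K x /\ (x *m u) 0 0 = c].

Definition is_subdivision (n : nat) (P : 'I_n -> 'rV[R]_2)
    (T : {set {set 'I_n}}) : Prop :=
  [/\ forall C, C \in T -> affine_dim (conv_hull P C) = 2%N,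
      [set x | exists2 C, C \in T & conv_hull P C x] =
        conv_hull P [set: 'I_n]%SET
    & forall C C', C \in T -> C' \in T ->
        let F := conv_hull P C `&` conv_hull P C' in
        [/\ is_face (conv_hull P C) F, is_face (conv_hull P C') F
          & forall i, F (P i) -> (i \in C) = (i \in C')]].

Definition lift_pt (n : nat) (P : 'I_n -> 'rV[R]_2) (w : 'rV[R]_n) (i : 'I_n) :
    'rV[R]_(2 + 1) :=
  row_mx (P i) (w 0 i)%:M.

(* The supporting plane is the graph z = a . x + c.  If K is itself contained
   in a non-vertical plane, then K is its own unique lower facet, so that
   affine height functions induce the trivial subdivision. *)
Definition is_lower_facet (K F : set 'rV[R]_(2 + 1)) : Prop :=
  exists (a : 'cV[R]_2) (c : R),
    let height (y : 'rV[R]_(2 + 1)) := (lsubmx y *m a) 0 0 + c in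
    [/\ forall y, K y -> height y <= (rsubmx y) 0 0,
        F = [set y | K y /\ (rsubmx y) 0 0 = height y]
      & affine_dim F = 2%N].

Definition induced_subdivision (n : nat) (P : 'I_n -> 'rV[R]_2)
    (w : 'rV[R]_n) : {set {set 'I_n}} :=
  [set C : {set 'I_n} |
    `[< exists F : set 'rV[R]_(2 + 1),
          is_lower_facet (conv_hull (lift_pt P w) [set: 'I_n]%SET) F /\
          C = [set i | `[< F (lift_pt P w i) >]]%SET >]]%SET.

Definition is_regular_subdivision (n : nat) (P : 'I_n -> 'rV[R]_2)
    (T : {set {set 'I_n}}) : Prop :=
  is_subdivision P T /\ exists w : 'rV[R]_n, induced_subdivision P w = T.

Definition secondary_cone (n : nat) (P : 'I_n -> 'rV[R]_2)
    (T : {set {set 'I_n}}) : set 'rV[R]_n :=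
  [set w | induced_subdivision P w = T].

Definition subdivision_dim (n : nat) (P : 'I_n -> 'rV[R]_2)
    (T : {set {set 'I_n}}) : nat :=
  (n - affine_dim (secondary_cone P T))%N.

Definition num_regular_subdivisions (n : nat) (P : 'I_n -> 'rV[R]_2)
    (k : nat) : nat :=
  #|[set T : {set {set 'I_n}} |
      `[< is_regular_subdivision P T /\ subdivision_dim P T = k >]]%SET|.

End PointConfigurations.

(* The vertices of a convex n-gon are labelled cyclically by 'I_n; the diagonal
   with endpoints i < j is the pair (i, j). *)
Definition is_diagonal (n : nat) (d : 'I_n * 'I_n) : bool :=
  (d.1.+1 < d.2)%N && ~~ ((d.1 == 0 :> nat) && (d.2.+1 == n)).

Definition crossing (n : nat) (d e : 'I_n * 'I_n) : bool :=
  [&& d.1 < e.1, e.1 < d.2 & d.2 < e.2]%N ||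
  [&& e.1 < d.1, d.1 < e.2 & e.2 < d.2]%N.

(* Number of k-dimensional faces of the (n - 3)-dimensional associahedron. *)
Definition num_polygon_subdivisions (n k : nat) : nat :=
  #|[set D : {set 'I_n * 'I_n} |
      [&& [forall d in D, is_diagonal d],
          [forall d in D, forall e in D, ~~ crossing d e]
        & #|D| == (n - 3 - k)%N]]%SET|.

(* Main.v *)
(* Idea.  Let [A_g] be the polynomial in t counting the dissections of a convex
   (g + 2)-gon by dimension.  Splitting a dissection at the apex of its cell on
   a fixed side gives A_(m+1) = A_m + (1 + t) * sum_(j < m) A_j A_(m-j), and
   Lagrange inversion gives the coefficients of A_g.

   The lower bound is proved by induction on the number of points.  Let p be the
   lowest point and q_0, ..., q_(m+1) the other points, sorted by angle around p.
   After a projective transformation sending p to infinity, q_j lies above a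
   point x_j of a line, at height h_j = 1 / (Y q_j - Y p).  For v a subset of
   {1, ..., m}, let f be the piecewise linear function that agrees with h at the
   x_j with j in v and at the two ends, and has no bend elsewhere.  Let out(v)
   be the set of the j in v where f bends upwards together with the j outside v
   where f lies below h.  A summation by parts shows that v |-> out(v) is
   injective (it is the outmap of a unique sink orientation of the cube), hence
   bijective.  For v, a subset Phi of out(v), and regular subdivisions of the
   point sets into which the j in v and out(v) cut the q_j (those outside v but
   in out(v) being discarded), one builds a regular subdivision that extends the
   given ones, and in which p is joined to the q_j with j in v or Phi, those in
   Phi lying strictly inside the angle of a cell at p.  All the data can be read off
   the resulting subdivision, and the elements of Phi add to the dimension.
   Summed over the sets out(v), the number of choices dominates A_(m+1). *)

Require Import Defs.
From HB Require Import structures.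
From mathcomp Require Import boolp classical_sets reals.
From mathcomp Require Import all_boot all_order all_algebra.
From mathcomp Require Import ring lra zify.

Set Implicit Arguments.
Unset Strict Implicit.
Unset Printing Implicit Defensive.

Import Order.TTheory GRing.Theory Num.Theory.
Local Open Scope ring_scope.

(** * Dissection polynomials *)

Section DissectionPoly.
Variable R : comNzSemiRingType.

(** The obstacle is to get the cells at p and the cells in the blocks from one height function. On
    the line, the cells at p are the contact sets of affine minorants of the heights, while the
    cells avoiding p are those of the heights raised by h. Let F be convex, bending exactly at the j
    in v where f bends upwards, and there at least as much as f. Then F - f is convex too, and the
    larger of F - f and F - h is a height profile showing both: it touches F - f at the neighbours
    of p and F - h at the points of the blocks. The choice of Phi is the choice of letting the bends
    of F and f cancel, or of leaving a discarded point on F - f.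

    Nothing is prescribed between the blocks and the cells at p. A generic perturbation ensures that
    the cells appearing there do not add to the dimension, which is read off the linear span of the
    secondary cone.

    Discarded points do not cut a block, and the count only uses A_i A_j <= A_(i+j) there. For
    points in convex position h is convex, out(v) = v, and no point is discarded. *)

Fixpoint dpoly_seq n : seq {poly R} :=
  if n is m.+1 then
    let s := dpoly_seq m in
    rcons s (s`_m + (1 + 'X) * \sum_(j < m) s`_j * s`_(m - j))
  else [:: 1].

(* The generating polynomial, by dimension, of the dissections of a convex
   (g + 2)-gon; a digon counts as a single dissection of dimension 0. *)
Definition dpoly g : {poly R} := (dpoly_seq g)`_g.

Lemma size_dpoly_seq n : size (dpoly_seq n) = n.+1.
Proof. by elim: n => //= n IH; rewrite size_rcons IH. Qed.

Lemma nth_dpoly_seq n j : (j <= n)%N -> (dpoly_seq n)`_j = dpoly j.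
Proof.
elim: n => [|n IH]; first by rewrite leqn0 => /eqP->.
rewrite leq_eqVlt => /predU1P[->//|]; rewrite ltnS => jn /=.
by rewrite nth_rcons size_dpoly_seq ltnS jn IH.
Qed.

Lemma dpoly0 : dpoly 0 = 1. Proof. by []. Qed.

Lemma dpolyS m : dpoly m.+1 = dpoly m + (1 + 'X) * \sum_(j < m) dpoly j * dpoly (m - j).
Proof.
rewrite {1}/dpoly /= nth_rcons size_dpoly_seq ltnn eqxx; congr (_ + _ * _).
by apply: eq_bigr => j _; rewrite !nth_dpoly_seq ?leq_subr // ltnW.
Qed.

End DissectionPoly.

(** Cardinalities are compared with coefficients over [nat]; Lagrange inversion has to subtract and
    divide, hence [rat]. *)
Lemma dpoly_rat g k : (dpoly rat g)`_k = ((dpoly nat g)`_k)%R%:R.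
Proof.
elim/ltn_ind: g k => -[|g] IH k; first by rewrite !dpoly0 !coef1; case: eqP.
have sumE l : (\sum_(j < g) dpoly rat j * dpoly rat (g - j))`_l =
   ((\sum_(j < g) dpoly nat j * dpoly nat (g - j))`_l)%R%:R.
  rewrite !coef_sum raddf_sum; apply: eq_bigr => j _ /=.
  rewrite !coefM raddf_sum; apply: eq_bigr => i _ /=.
  by rewrite !IH ?ltnS ?leq_subr // 1?ltnW // natrM.
rewrite !dpolyS !coefD !mulrDl !mul1r !coefD !coefXM !sumE !IH //.
by case: eqP => _; rewrite ?sumE !natrD.
Qed.

Definition coef_le (p q : {poly nat}) := forall k, ((p`_k)%R <= (q`_k)%R)%N.

Lemma coef_le_trans q p r : coef_le p q -> coef_le q r -> coef_le p r.
Proof. by move=> h1 h2 k; apply: leq_trans (h1 k) (h2 k). Qed.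

Lemma coef_leD p p' q q' : coef_le p p' -> coef_le q q' -> coef_le (p + q) (p' + q').
Proof. by move=> h1 h2 k; rewrite !coefD leq_add. Qed.

Lemma coef_leM p p' q q' : coef_le p p' -> coef_le q q' -> coef_le (p * q) (p' * q').
Proof. by move=> h1 h2 k; rewrite !coefM; apply: leq_sum => i _; apply: leq_mul. Qed.

Lemma coef_le_sum (I : Type) (r : seq I) (Q : pred I) (F G : I -> {poly nat}) :
  (forall i, Q i -> coef_le (F i) (G i)) ->
  coef_le (\sum_(i <- r | Q i) F i) (\sum_(i <- r | Q i) G i).
Proof. by move=> H k; rewrite !coef_sum; apply: leq_sum => i /H. Qed.

(** * Coefficientwise bounds for products of dissection polynomials *)

Section CoefBounds.

Local Notation A := (dpoly nat).

(** Two polygons glued along a side, which is kept as a diagonal: dimensions add. In the recursion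
    for the glued polygon only the terms whose index is also present in the recursion for the first
    factor are needed. *)
Lemma dpoly_leM i j : coef_le (A i * A j) (A (i + j)).
Proof.
elim/ltn_ind: i => -[|i] IH; first by rewrite dpoly0 mul1r.
rewrite addSn !dpolyS mulrDl; apply: coef_leD; first exact: IH.
rewrite -mulrA; apply: coef_leM => //; rewrite mulr_suml.
rewrite big_split_ord /= -[X in coef_le X _]addr0; apply: coef_leD; last first.
  by move=> k; rewrite coef0.
apply: coef_le_sum => l _; rewrite -mulrA; apply: coef_leM => //.
rewrite -addnBAC; last exact: ltnW.
by apply: IH; rewrite ltnS leq_subr.
Qed.

Lemma sum_tuple_cons (V : nmodType) m (F : seq bool -> V) :
  \sum_(x : m.+1.-tuple bool) F x =
  \sum_(x : m.-tuple bool) (F (true :: x) + F (false :: x)).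
Proof.
rewrite big_split /=.
rewrite (bigID (fun x : m.+1.-tuple bool => thead x)) /=; congr (_ + _).
  rewrite (reindex (fun x : m.-tuple bool => [tuple of true :: x])) /=.
    by apply: eq_bigl => x; rewrite theadE.
  exists (fun x : m.+1.-tuple bool => [tuple of behead x] : m.-tuple bool) => x;
    first by move=> _; apply: val_inj.
  by rewrite inE; case/tupleP: x => b x; rewrite theadE => /= -> ; apply: val_inj.
rewrite (reindex (fun x : m.-tuple bool => [tuple of false :: x])) /=.
  by apply: eq_bigl => x.
exists (fun x : m.+1.-tuple bool => [tuple of behead x] : m.-tuple bool) => x;
  first by move=> _; apply: val_inj.
by rewrite inE; case/tupleP: x => b x; rewrite theadE => /= /negbTE->; apply: val_inj.
Qed.

Lemma sum_tuple0 (V : nmodType) (F : seq bool -> V) : \sum_(x : 0.-tuple bool) F x = F [::].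
Proof.
rewrite (bigD1 [tuple]) //= big1 ?addr0 // => x; by rewrite [x]tuple0.
Qed.

(** [g] is the number of entries [false] since the last [true]. *)
Fixpoint wgap g (l : seq bool) : {poly nat} :=
  if l is b :: l' then if b then (1 + 'X) * A g * wgap 0 l' else wgap g.+1 l' else A g.

(** Splitting by the position of the first [true] gives back the recursion [dpolyS]. The terms,
    indexed by all subsets of m positions, are later matched with the sets out(v). *)
Lemma sum_wgap m : \sum_(x : m.-tuple bool) wgap 0 x = A m.+1.
Proof.
pose W m g := \sum_(x : m.-tuple bool) wgap g x.
have W0 g : W 0 g = A g by rewrite /W sum_tuple0.
have WS m' g : W m'.+1 g = (1 + 'X) * A g * W m' 0 + W m' g.+1.
  by rewrite /W sum_tuple_cons big_split /= -mulr_sumr.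
have WE m' g : W m' g = A (g + m') + (1 + 'X) * \sum_(j < m') A (g + j) * W (m' - j.+1)%N 0.
  elim: m' g => [|m' IH] g; first by rewrite W0 addn0 big_ord0 mulr0 addr0.
  rewrite WS (IH g.+1) addSnnS big_ord_recl /= addn0 subSS subn0 mulrDr mulrA.
  rewrite addrCA; congr (_ + (_ + _ * _)); apply: eq_bigr => j _.
  by rewrite /bump /= add1n addSnnS subSS.
rewrite -/(W m 0); elim/ltn_ind: m => m IH.
rewrite WE dpolyS add0n; congr (_ + _ * _); apply: eq_bigr => j _.
by rewrite add0n IH ?subnSK //; lia.
Qed.

(** Reads the factors [1 + 'X] of [wgap] as the choice of a subset Phi of out(v). *)
Lemma sum_subtuples (X : seq bool) m : size X = m ->
  \sum_(x : m.-tuple bool | all2 implb x X) 'X^(count id x) = (1 + 'X) ^+ count id X :> {poly nat}.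
Proof.
elim: X m => [|b X IH] [|m] //= => [_|[sX]].
  by rewrite big_mkcond (sum_tuple0 (fun x => if all2 implb x [::] then 'X^(count id x) else 0)).
rewrite big_mkcond.
rewrite (sum_tuple_cons m (fun x => if all2 implb x (b :: X) then 'X^(count id x) else 0)) /=.
rewrite big_split /= exprD -(IH m sX) [X in _ = _ * X]big_mkcond /=.
case: b => /=; last first.
  rewrite big1 // expr0 mul1r add0r; apply: eq_bigr => x _.
  by [].
rewrite expr1 mulrDl mul1r addrC; congr (_ + _); rewrite mulr_sumr; apply: eq_bigr => x _.
by case: ifP => _; rewrite ?mulr0 // exprS.
Qed.

Section Weight.
Variables brk act : nat -> bool.

(** [g] counts the positions satisfying [act] since the last break; a break itself is not
    counted. *)
Fixpoint wblocks g i k : {poly nat} :=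
  if k is k'.+1 then
    if brk i then A g * wblocks 0 i.+1 k' else wblocks (g + act i)%N i.+1 k'
  else A g.

Lemma wblocks_merge g g' i k : coef_le (A g * wblocks g' i k) (wblocks (g + g') i k).
Proof.
elim: k g' i => [|k IH] g' i /=; first exact: dpoly_leM.
case: (brk i); last by rewrite -addnA.
by rewrite mulrA; apply: coef_leM => //; apply: dpoly_leM.
Qed.

Definition cut j := brk j || ~~ act j.

(** A cut that is not a break, that is a discarded point, splits a factor of [wgap] but not of
    [wblocks]; [wblocks_merge] absorbs the difference. Here the recursion turns into an
    inequality. *)
Lemma wgap_wblocks g i k :
  coef_le (wgap g (map cut (iota i k))) ((1 + 'X) ^+ count cut (iota i k) * wblocks g i k).
Proof.
elim: k g i => [|k IH] g i /=; first by rewrite expr0 mul1r.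
rewrite exprD; have -> : cut i = brk i || ~~ act i by []. case: (brk i) => /=.
  rewrite expr1 -!mulrA.
  apply: coef_leM => //; rewrite [X in coef_le _ X]mulrCA.
  by apply: coef_leM => //; apply: IH.
case: (act i) => /=; first by rewrite expr0 mul1r addn1; apply: IH.
rewrite expr1 addn0 -!mulrA; apply: coef_leM => //.
apply: (@coef_le_trans (A g * ((1 + 'X) ^+ count cut (iota i.+1 k) * wblocks 0 i.+1 k))).
  by apply: coef_leM => //; apply: IH.
rewrite mulrCA; apply: coef_leM => //.
by have := wblocks_merge g 0 i.+1 k; rewrite addn0.
Qed.

End Weight.

End CoefBounds.

(** * Coefficients of the dissection polynomials *)

Lemma coef_1DXn (R : comNzRingType) N i : ((1 + 'X : {poly R}) ^+ N)`_i = 'C(N, i)%:R.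
Proof.
rewrite exprDn coef_sum.
under eq_bigr => j _ do rewrite expr1n mul1r coefMn coefXn.
have [iN|iN] := leqP i N.
  rewrite (bigD1 (inord i)) //= inordK ?ltnS // eqxx big1 ?addr0 // => j.
  by rewrite -val_eqE /= inordK ?ltnS // => /negbTE; rewrite eq_sym => ->; rewrite mul0rn.
rewrite big1 ?bin_small // => j _; case: eqP => // E; last by rewrite mul0rn.
by have := ltn_ord j; rewrite -E; lia.
Qed.

Section Lagrange.

Local Notation T := ('X : {poly rat}).
Local Notation A := (dpoly rat).
Implicit Types p q : {poly {poly rat}}.

(** The recursion says that the series B with coefficients [A g], g >= 1, satisfies B = x phi(B).
    The factor psi = phi - u phi' belongs to the form [x^n] H(B) = [u^n] H phi^(n-1) psi of Lagrange
    inversion. *)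
Definition lphi : {poly {poly rat}} := (1 + 'X) * (1 + (1 + T)%:P * 'X).
Definition lpsi : {poly {poly rat}} := lphi - 'X * lphi^`().

Lemma coef_mull_eq p q q' m : (forall i, (i <= m)%N -> q`_i = q'`_i) -> (p * q)`_m = (p * q')`_m.
Proof. by move=> H; rewrite !coefM; apply: eq_bigr => i _; rewrite H // leq_subr. Qed.

Lemma lphi_coef p m : (p * lphi)`_m =
  p`_m + (2 + T) * (if m is m'.+1 then p`_m' else 0)
       + (1 + T) * (if m is m'.+2 then p`_m' else 0).
Proof.
have -> : p * lphi = p + (2 + T)%:P * (p * 'X) + (1 + T)%:P * (p * 'X * 'X).
  by rewrite /lphi !polyCD; ring.
by rewrite !coefD !coefCM !coefMX; case: m => [|[|m]].
Qed.

(** Extracts coefficients from n phi^(n-1) psi = n phi^n - u (phi^n)', which links the two forms of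
    Lagrange inversion. *)
Lemma lpsi_coef n j : (n%:R * (lphi ^+ n.-1 * lpsi)`_j : {poly rat}) =
  (n%:R - j%:R) * (lphi ^+ n)`_j.
Proof.
case: n => [|n].
  rewrite !mul0r sub0r expr0 coef1.
  by case: j => [|j]; rewrite ?oppr0 ?mul0r ?mulr0.
have E : n.+1%:R%:P * (lphi ^+ n * lpsi) = n.+1%:R%:P * lphi ^+ n.+1 - 'X * (lphi ^+ n.+1)^`().
  rewrite deriv_exp /= /lpsi exprS -mulr_natl -polyC_natr; ring.
rewrite /= -coefCM E coefB coefCM coefXM mulrBl; congr (_ - _).
by case: j => [|j]; rewrite ?mul0r //= coef_deriv mulr_natl.
Qed.

Lemma dpoly_lagrange n : (0 < n)%N -> n%:R * A n = (lphi ^+ n)`_n.-1.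
Proof.
(* B is truncated at degree N, so its functional equation is only claimed for the coefficients up to
   N. *)
pose N := n; pose B : {poly {poly rat}} := \poly_(g < N.+1) (if g is 0 then 0 else A g).
have Bc i : (i <= N)%N -> B`_i = if i is 0 then 0 else A i by move=> h; rewrite coef_poly ltnS h.
have B1c i : (i <= N)%N -> (1 + B)`_i = A i.
  by move=> h; rewrite coefD coef1 Bc //; case: i h => [|i] _; rewrite ?addr0 ?add0r ?dpoly0.
pose G := 'X * ((1 + B) * (1 + (1 + T)%:P * B)).
have BG i : (i <= N)%N -> B`_i = G`_i.
  case: i => [|g] h; rewrite Bc // coefXM //=.
  have -> : (1 + B) * (1 + (1 + T)%:P * B) = (1 + B) + (1 + T)%:P * ((1 + B) * B) by ring.
  rewrite coefD B1c ?coefCM ?dpolyS; last exact: ltnW.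
  congr (_ + _ * _); rewrite coefM big_ord_recr /= subnn (Bc 0%N) // mulr0 addr0.
  apply: eq_bigr => j _; have jg := ltn_ord j; rewrite B1c; last by lia.
  by rewrite Bc; [case: (g - j)%N (subn_gt0 j g); rewrite ?jg | lia].
have rec m r : (m < N)%N -> (B ^+ r.+1)`_m.+1 =
    (B ^+ r)`_m + (2 + T) * (B ^+ r.+1)`_m + (1 + T) * (B ^+ r.+2)`_m.
  move=> mN; rewrite [in LHS]exprSr (@coef_mull_eq _ _ G); last by move=> i ?; apply: BG; lia.
  have -> : B ^+ r * G = 'X * (B ^+ r + (2 + T)%:P * B ^+ r.+1 + (1 + T)%:P * B ^+ r.+2).
    by rewrite /G !exprS !polyCD; ring.
  by rewrite coefXM /= !coefD !coefCM.
have c0 r : (B ^+ r)`_0 = (r == 0%N)%:R.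
  by rewrite -horner_coef0 horner_exp horner_coef0 Bc //; case: r => [|r]; rewrite ?expr0n.
(* Inversion for all powers of B at once: [rec] and [lphi_coef] express the same three-term
   recurrence, as phi has degree 2 in u. *)
have main m : (m < N)%N -> forall r, (B ^+ r)`_m.+1 =
    if (r <= m.+1)%N then (lphi ^+ m * lpsi)`_(m.+1 - r) else 0.
  elim: m => [|m IH] mN r.
    have psi0 : lpsi`_0 = 1.
      have := lpsi_coef 1 0; rewrite mul1r /= expr0 mul1r => ->.
      by rewrite subr0 mul1r expr1 -[lphi]mul1r lphi_coef /= coef1 !mulr0 !addr0.
    have psi1 : lpsi`_1 = 0.
      by have := lpsi_coef 1 1; rewrite mul1r /= expr0 mul1r subrr mul0r.
    case: r => [|r]; first by rewrite expr0 coef1 expr0 mul1r psi1.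
    rewrite rec // !c0 /= !mulr0 !addr0 expr0 mul1r ltnS leqn0.
    by case: r => [|r] //=; rewrite psi0.
  case: r => [|r].
    rewrite expr0 coef1 /= subn0; have := lpsi_coef m.+2 m.+2; rewrite subrr mul0r => /eqP.
    by rewrite mulf_eq0 -polyC_natr polyC_eq0 pnatr_eq0 /= => /eqP ->.
  rewrite rec // !IH; try exact: ltnW.
  rewrite exprSr -mulrA [lphi * _]mulrC mulrA lphi_coef subSS.
  have [rm|rm] := leqP r m.+1; last first.
    by rewrite !ifF ?mulr0 ?addr0 //; lia.
  rewrite ?ltnS ?rm; congr (_ + _ * _ + _ * _).
    have [h|h] := leqP r m; last by have -> : (m.+2 - r.+1 = 0)%N by lia.
    by have -> : (m.+2 - r.+1 = (m - r).+1)%N by lia.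
  have [h|h] := leqP r.+1 m.
    by have [-> ->] : (m.+2 - r.+1 = (m - r.+1).+2)%N /\ (m.+1 - r.+2 = m - r.+1)%N by lia.
  by have [->|->] : (m.+2 - r.+1 = 0)%N \/ (m.+2 - r.+1 = 1)%N by lia.
case: n @N @B Bc B1c @G BG rec c0 main => // n N B Bc _ _ _ _ _ main _.
have := main n (ltnSn _) 1%N; rewrite expr1 Bc // subSS subn0 /= => ->.
have -> : n.+1%:R * (lphi ^+ n * lpsi)`_n = (n.+1%:R - n%:R) * (lphi ^+ n.+1)`_n.
  exact: lpsi_coef.
by rewrite -natrB // subSnn mul1r.
Qed.

(** Writing phi = (1 + u) ((1 + u) + T u) separates the powers of T in the binomial expansion. *)
Lemma lphi_exp_coef n k : (k < n)%N ->
  ((lphi ^+ n)`_n.-1)`_k = ('C(n, k) * 'C(2 * n - k, n.-1 - k))%:R.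
Proof.
move=> kn.
have -> : lphi ^+ n = \sum_(i < n.+1) ('C(n, i)%:R * T ^+ i)%:P * ((1 + 'X) ^+ (2 * n - i) * 'X^i).
  have -> : lphi = (1 + 'X) * ((1 + 'X) + T%:P * 'X) by rewrite /lphi polyCD; ring.
  rewrite exprMn [X in _ * X]exprDn mulr_sumr; apply: eq_bigr => i _.
  have iN := ltn_ord i.
  rewrite -mulr_natl exprMn polyCM polyC_natr polyC_exp.
  have -> : (2 * n - i = n + (n - i))%N by lia.
  by rewrite exprD; ring.
rewrite !coef_sum (bigD1 (inord k)) //= inordK; last by lia.
rewrite big1 ?addr0 => [|i]; last first.
  rewrite -val_eqE /= inordK; last by lia.
  move=> ik; rewrite coefCM coefMXn; case: ifP => _; first by rewrite mulr0 coef0.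
  rewrite coef_1DXn -mulrA -!polyC_natr !coefCM coefMC coefXn eq_sym (negbTE ik).
  by rewrite mul0r mulr0.
rewrite coefCM coefMXn ifF; last by lia.
rewrite coef_1DXn -mulrA -!polyC_natr !coefCM coefMC coefXn eqxx mul1r natrM.
by [].
Qed.

End Lagrange.

Lemma dpoly_coef g k : (0 < g)%N -> (k < g)%N ->
  ((dpoly nat g)`_k)%R%:R = g.+1%:R^-1 * 'C(g.-1, k)%:R * 'C(2 * g - k, g)%:R :> rat.
Proof.
move=> g0 kg; rewrite -dpoly_rat.
have g1 : g%:R != 0 :> rat by rewrite pnatr_eq0 -lt0n.
have g2 : g.+1%:R != 0 :> rat by rewrite pnatr_eq0.
apply: (mulfI g1).
have -> : g%:R * (dpoly rat g)`_k = (g%:R * dpoly rat g)`_k by rewrite -polyC_natr coefCM.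
rewrite dpoly_lagrange // lphi_exp_coef //; apply: (mulfI g2).
rewrite !mulrA [_ * g%:R]mulrC -[g%:R * _ * _]mulrA divff // mulr1 -!natrM; congr (_%:R).
have e1 : ((g - k) * 'C(g, k) = g * 'C(g.-1, k))%N.
  by rewrite mul_bin_down.
have e2 : 'C(2 * g - k, g.-1 - k) = 'C(2 * g - k, g.+1).
  have -> : (g.-1 - k = 2 * g - k - g.+1)%N by lia.
  by rewrite bin_sub //; lia.
have e3 : (g.+1 * 'C(2 * g - k, g.+1) = (g - k) * 'C(2 * g - k, g))%N.
  by rewrite mul_bin_left; congr (_ * _)%N; lia.
by rewrite e2 mulnCA e3 mulnCA mulnA e1.
Qed.

(** * Dissections of a convex polygon *)

Section Dissections.
Variable n : nat.
Implicit Types (a b j i : 'I_n) (d e : 'I_n * 'I_n) (D : {set 'I_n * 'I_n}).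

Definition within a b d := [&& a <= d.1, d.1.+1 < d.2 & d.2 <= b]%N.

Definition noncrossing D := [forall d in D, forall e in D, ~~ crossing d e].

(* Dissections of the polygon on the vertices a, ..., b, where the side ab is
   recorded as a diagonal unless it is a side of the ambient polygon. *)
Definition dissections a b : {set {set 'I_n * 'I_n}} :=
  [set D : {set 'I_n * 'I_n} | [&& [forall d in D, within a b d], noncrossing D
    & (b <= a.+1)%N || ((a, b) \in D)]].

Lemma dissectionsP a b D : reflect
  [/\ forall d, d \in D -> within a b d,
      forall d e, d \in D -> e \in D -> ~~ crossing d e
    & (b <= a.+1)%N || ((a, b) \in D)] (D \in dissections a b).
Proof.
rewrite inE; apply: (iffP and3P) => [[/forall_inP h1 /forall_inP h2 h3]|[h1 h2 h3]]; split=> //.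
- by move=> d e /h2/forall_inP; apply.
- exact/forall_inP.
- by apply/forall_inP => d dD; apply/forall_inP => e; apply: h2.
Qed.

(** The neighbour of b, other than a, in the cell on the side ab. The segment from a to it is drawn,
    or is a side, only if that cell is a triangle. *)
Definition apex a b D j := [&& (a < j < b)%N, (j.+1 == b) || ((j, b) \in D)
  & [forall i : 'I_n, (a < i < j)%N ==> ((i, b) \notin D)]].

Lemma apexP a b D j : reflect [/\ (a < j < b)%N, (j.+1 == b) || ((j, b) \in D)
   & forall i, (a < i < j)%N -> (i, b) \notin D] (apex a b D j).
Proof.
apply: (iffP and3P) => [[h1 h2 /forallP h3]|[h1 h2 h3]]; split=> //.
  by move=> i h; have := h3 i; rewrite h.
by apply/forallP => i; apply/implyP/h3.
Qed.

Lemma apex_uniq a b D j j' : apex a b D j -> apex a b D j' -> j = j'.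
Proof.
move=> /apexP[h1 h2 h3] /apexP[h1' h2' h3']; apply: val_inj => /=; apply/eqP.
case: (ltngtP j j') => // H.
  have := h3' j; case/orP: h2 => [|->]; first by lia.
  by move=> N; have : false by apply: N; lia.
have := h3 j'; case/orP: h2' => [|->]; first by lia.
by move=> N; have : false by apply: N; lia.
Qed.

Lemma apex_exists a b D : (a.+1 < b)%N -> exists j, apex a b D j.
Proof.
move=> ab; pose Q (i : nat) := [exists j : 'I_n, [&& j == i :> nat, (a < j < b)%N
   & (j.+1 == b) || ((j, b) \in D)]].
have hb : (b.-1 < n)%N by have := ltn_ord b; lia.
have exQ : exists k : nat, Q k.
  exists b.-1; apply/existsP; exists (Ordinal hb) => /=; rewrite eqxx /=; lia.
have [i /existsP[j /and3P[/eqP ji h1 h2]] imin] := ex_minnP exQ.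
exists j; apply/apexP; split=> // k hk; apply/negP => kD.
have : (i <= k)%N; last by lia.
apply: imin; apply/existsP; exists k; rewrite eqxx kD orbT /=; lia.
Qed.

Section Split.
Variables (a b j : 'I_n).
Hypothesis haj : (a < j)%N.
Hypothesis hjb : (j < b)%N.
Implicit Type x : {set 'I_n * 'I_n} * {set 'I_n * 'I_n}.

Let base := (a, b).
Let lbase := (a, j).

Definition glue x := base |: (x.1 :|: x.2).
Definition unglue D := ([set d in D | within a j d], [set d in D | within j b d]).

Lemma within_disj d : within a j d -> within j b d = false.
Proof. by rewrite /within; lia. Qed.

Lemma within_base_l : within a j base = false.
Proof. by rewrite /within /=; lia. Qed.

Lemma within_base_r : within j b base = false.
Proof. by rewrite /within /=; lia. Qed.

Lemma within_l d : within a j d -> within a b d.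
Proof. by rewrite /within; lia. Qed.

Lemma within_r d : within j b d -> within a b d.
Proof. by rewrite /within; lia. Qed.

(** A diagonal passing over j either ends at b, and then starts at a because j is the first
    neighbour of b, or crosses (j, b). *)
Lemma apex_within D d : D \in dissections a b -> apex a b D j -> d \in D ->
  [|| d == base, within a j d | within j b d].
Proof.
move=> /dissectionsP[h1 h2 _] /apexP[_ h3 h4] dD; have := h1 d dD; case: d dD => i l dD.
rewrite /within /= => hw; have [lj|jl] := leqP l j; first by apply/or3P/Or32; lia.
have [ji|ij] := leqP j i; first by apply/or3P/Or33; lia.
have [lb|lb] := eqVneq l b.
  have [->|ia] := eqVneq i a; first by rewrite lb eqxx.
  have := h4 i; rewrite -lb dD => N; have : false by apply: N; move: ia; rewrite -val_eqE /=; lia.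
  by [].
exfalso; move: lb; rewrite -val_eqE /= => lb; case/orP: h3 => [|jD]; first by lia.
have := h2 _ _ dD jD; rewrite /crossing /=; lia.
Qed.

Lemma glue_in x : x.1 \in dissections a j -> x.2 \in dissections j b ->
  glue x \in dissections a b /\ apex a b (glue x) j.
Proof.
move=> /dissectionsP[l1 l2 l3] /dissectionsP[r1 r2 r3]; split.
  apply/dissectionsP; split.
  - move=> d; rewrite !inE => /or3P[/eqP->|/l1/within_l|/r1/within_r] //.
    by rewrite /within /=; lia.
  - have lr d e : within a j d -> within j b e -> ~~ crossing d e && ~~ crossing e d.
      by rewrite /within /crossing; lia.
    have bc d : within a b d -> ~~ crossing base d && ~~ crossing d base.
      by rewrite /within /crossing /=; lia.
    have bb : ~~ crossing base base by rewrite /crossing /=; lia.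
    move=> d e; rewrite !inE => /or3P[/eqP->|dl|dr] /or3P[/eqP->|el|er] //.
    + by have /andP[] := bc _ (within_l (l1 _ el)).
    + by have /andP[] := bc _ (within_r (r1 _ er)).
    + by have /andP[] := bc _ (within_l (l1 _ dl)).
    + exact: l2.
    + by have /andP[] := lr _ _ (l1 _ dl) (r1 _ er).
    + by have /andP[] := bc _ (within_r (r1 _ dr)).
    + by have /andP[] := lr _ _ (l1 _ el) (r1 _ dr).
    + exact: r2.
  - by rewrite !inE eqxx orbT.
apply/apexP; split; first by rewrite haj.
  case/orP: r3 => [h|jD]; first by apply/orP; left; lia.
  by rewrite !inE jD !orbT.
move=> i hi; rewrite !inE !negb_or; apply/and3P; split.
- by apply/eqP => -[/(congr1 val)/=]; lia.
- by apply/negP => /l1; rewrite /within /=; lia.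
- by apply/negP => /r1; rewrite /within /=; lia.
Qed.

Lemma unglue_in D : D \in dissections a b -> apex a b D j ->
  (j <= a.+1)%N || (lbase \in D) ->
  (unglue D).1 \in dissections a j /\ (unglue D).2 \in dissections j b.
Proof.
move=> /dissectionsP[h1 h2 _] /apexP[_ h3 _] hl; split; apply/dissectionsP; split.
- by move=> d; rewrite inE => /andP[].
- by move=> d e; rewrite !inE => /andP[? _] /andP[? _]; apply: h2.
- have [//|aj] := leqP j a.+1; move: hl; rewrite leqNgt aj /= inE => -> /=.
  by rewrite /within /=; lia.
- by move=> d; rewrite inE => /andP[].
- by move=> d e; rewrite !inE => /andP[? _] /andP[? _]; apply: h2.
- have [//|jb] := leqP b j.+1; case/orP: h3 => [|jD]; first by lia.
  by rewrite inE jD /within /=; lia.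
Qed.

Lemma unglueK D : D \in dissections a b -> apex a b D j -> (a, b) \in D ->
  glue (unglue D) = D.
Proof.
move=> hD hA bD; apply/setP => d; rewrite !inE /=; have := apex_within hD hA (d := d).
case: eqP => [->|_] /=; first by rewrite bD.
by case: (d \in D) => //= /(_ isT).
Qed.

Lemma glueK x : x.1 \in dissections a j -> x.2 \in dissections j b -> unglue (glue x) = x.
Proof.
case: x => l r /dissectionsP[/= l1 _ _] /dissectionsP[/= r1 _ _].
congr (_, _); apply/setP => d; rewrite !inE /=.
  case: (boolP (d \in l)) => [/l1 ->|_]; first by rewrite orbT.
  case: (boolP (d \in r)) => [/r1 dr|_] /=; last first.
    by rewrite orbF; case: eqP => // ->; rewrite within_base_l.
  by rewrite orbT /=; apply: contraTF dr => /within_disj ->.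
case: (boolP (d \in r)) => [/r1 ->|_]; first by rewrite !orbT.
case: (boolP (d \in l)) => [/l1 dl|_] /=; last first.
  by rewrite !orbF; case: eqP => // ->; rewrite within_base_r.
by rewrite orbT (within_disj dl).
Qed.

Lemma card_glue x : x.1 \in dissections a j -> x.2 \in dissections j b ->
  #|glue x| = (#|x.1| + #|x.2|).+1.
Proof.
move=> /dissectionsP[l1 _ _] /dissectionsP[r1 _ _].
rewrite /glue cardsU1 !inE negb_or.
have -> : base \notin x.1 by apply/negP => /l1; rewrite within_base_l.
have -> : base \notin x.2 by apply/negP => /r1; rewrite within_base_r.
rewrite /= add1n cardsU (_ : _ :&: _ = set0) ?cards0 ?subn0 //.
apply/setP => d; rewrite !inE; apply/negbTE/negP => /andP[/l1 dl /r1].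
by rewrite (within_disj dl).
Qed.

(** The segment from a to j runs inside the cell on ab, so nothing crosses it. Drawing or erasing it
    at will is the source of the factor [1 + 'X]. *)
Lemma dissection_addl D : (a.+1 < j)%N -> D \in dissections a b -> apex a b D j ->
  lbase |: D \in dissections a b /\ apex a b (lbase |: D) j.
Proof.
move=> aj hD hA; have aw := fun d => apex_within hD hA (d := d).
move/dissectionsP: hD => [h1 h2 h3]; move/apexP: hA => [_ h4 h5].
have nl d : d \in D -> ~~ crossing lbase d && ~~ crossing d lbase.
  by move/aw => /or3P[/eqP->||]; rewrite /within /crossing /=; lia.
split.
  apply/dissectionsP; split; last by rewrite !inE orbCA h3 orbT.
  - by move=> d; rewrite !inE => /predU1P[->|/h1//]; rewrite /within /=; lia.
  - move=> d e; rewrite !inE => /predU1P[->|dD] /predU1P[->|eD]; last exact: h2.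
    + by rewrite /crossing /=; lia.
    + by have /andP[] := nl _ eD.
    + by have /andP[] := nl _ dD.
apply/apexP; split; first by rewrite haj.
  by rewrite inE orbCA h4 orbT.
move=> i hi; rewrite !inE negb_or h5 // andbT; apply/eqP => -[_ /(congr1 val)/=]; lia.
Qed.

Lemma dissection_dell D : D \in dissections a b -> apex a b D j ->
  D :\ lbase \in dissections a b /\ apex a b (D :\ lbase) j.
Proof.
move=> /dissectionsP[h1 h2 h3] /apexP[_ h4 h5]; split.
  apply/dissectionsP; split.
  - by move=> d; rewrite !inE => /andP[_ /h1].
  - by move=> d e; rewrite !inE => /andP[_ dD] /andP[_ eD]; apply: h2.
  - rewrite !inE; case/orP: h3 => [->//|->]; apply/orP; right; rewrite andbT.
    by apply/eqP => -[/(congr1 val)/=]; lia.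
apply/apexP; split; first by rewrite haj.
  rewrite !inE; case/orP: h4 => [->//|->]; apply/orP; right; rewrite andbT.
  by apply/eqP => -[/(congr1 val)/=]; lia.
by move=> i hi; rewrite !inE negb_and h5 ?orbT.
Qed.

End Split.

Lemma dissections1 a b : (a < b)%N -> (b <= a.+1)%N -> dissections a b = [set set0].
Proof.
move=> ab ba; apply/setP => D; rewrite [in RHS]inE; apply/dissectionsP/eqP => [[h1 _ _]|->].
  by apply/setP => d; rewrite inE; apply/negbTE/negP => /h1; rewrite /within; lia.
by split; rewrite ?ba // => d; rewrite inE.
Qed.

Lemma dissection_base a b D : D \in dissections a b -> (a.+1 < b)%N -> (a, b) \in D.
Proof. by move=> /dissectionsP[_ _]; rewrite ltnNge => /orP[->|]. Qed.

(** Makes the truncated subtraction in the exponent of [sum_dissections] an honest one. *)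
Lemma dissection_card_le a b D : (a < b)%N -> D \in dissections a b -> (#|D| <= b - a - 1)%N.
Proof.
have [m] := ubnP (b - a); elim: m a b D => // m IH a b D hm ab hD.
have [ba|ab1] := leqP b a.+1.
  by move: hD; rewrite dissections1 // inE => /eqP->; rewrite cards0.
have [j hA] := apex_exists D ab1; have [/andP[aj jb] _ _] := apexP _ _ _ _ hA.
have P E : E \in dissections a b -> apex a b E j -> (j <= a.+1)%N || ((a, j) \in E) ->
    (#|E| <= b - a - 1)%N.
  move=> hE hAE hl; have [ul ur] := unglue_in aj jb hE hAE hl.
  rewrite -(unglueK aj jb hE hAE (dissection_base hE ab1)).
  rewrite (card_glue aj jb ul ur).
  have := IH _ _ _ _ aj ul; have := IH _ _ _ _ jb ur; lia.
have [ja|ja] := leqP j a.+1; first by apply: P => //; rewrite ja.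
have [hE hAE] := dissection_addl aj jb ja hD hA.
apply: leq_trans (P _ hE hAE _); last by rewrite !inE eqxx orbT.
exact/subset_leq_card/subsetUr.
Qed.

Theorem sum_dissections a b : (a < b)%N ->
  \sum_(D in dissections a b) 'X^(b - a - 1 - #|D|) = dpoly nat (b - a - 1).
Proof.
have [m] := ubnP (b - a); elim: m a b => // m IH a b hm ab.
have [ba|ab1] := leqP b a.+1.
  have -> : (b - a - 1 = 0)%N by lia.
  by rewrite dissections1 // big_set1.
set g := (b - a - 1)%N; have gE : (g = (b - a - 2).+1)%N by lia.
pose F D : {poly nat} := 'X^(g - #|D|).
have part : \sum_(D in dissections a b) F D =
    \sum_(j : 'I_n | (a < j < b)%N) \sum_(D in dissections a b | apex a b D j) F D.
  rewrite (exchange_big_dep (fun D => D \in dissections a b)) /=; last by move=> j D _ /andP[].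
  apply: eq_bigr => D hD.
  have [j hA] := apex_exists D ab1; rewrite (bigD1 j) /=; last first.
    by rewrite hD hA !andbT; case/apexP: hA.
  rewrite big1 ?addr0 // => i /andP[/andP[_ /andP[_ hA']] /eqP]; case.
  exact: apex_uniq hA' hA.
rewrite -/(F _) part.
(* When j = a + 1 the segment from a to j is a side, which leaves no choice. *)
have inner j : (a < j < b)%N -> \sum_(D in dissections a b | apex a b D j) F D =
   (if (j <= a.+1)%N then 1 else 1 + 'X) * (dpoly nat (j - a - 1) * dpoly nat (b - j - 1)).
  move=> /andP[aj jb].
  have PE : \sum_(D in dissections a b | apex a b D j && ((j <= a.+1)%N || ((a, j) \in D))) F D =
      dpoly nat (j - a - 1) * dpoly nat (b - j - 1).
    rewrite -(IH a j) ?(leq_trans _ hm) //; try lia.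
    rewrite -(IH j b) ?(leq_trans _ hm) //; try lia.
    rewrite big_distrlr /= pair_big /=.
    rewrite (reindex_onto (glue a b) (unglue a b j)) /=; last first.
      by move=> D /and3P[hD hA _]; apply: unglueK => //; apply: dissection_base hD ab1.
    apply: eq_big => [x|x /andP[]].
      apply/idP/idP => [/andP[/and3P[hD hA hl] /eqP <-]|/andP[hl hr]].
        by have [-> ->] := unglue_in aj jb hD hA hl.
      have [-> ->] := glue_in aj jb hl hr; rewrite (glueK aj jb hl hr) eqxx andbT /=.
      by case/dissectionsP: hl => _ _ /orP[->//|h]; rewrite !inE h !orbT.
    move=> /and3P[hD hA hl] /eqP E; have [ul ur] := unglue_in aj jb hD hA hl.
    rewrite E in ul ur; rewrite /F (card_glue aj jb ul ur) -exprD; congr ('X ^+ _).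
    have := dissection_card_le aj ul; have := dissection_card_le jb ur; rewrite /g.
    move: #|x.1| #|x.2| => c1 c2; clear -aj jb; lia.
  case: leqP => ja; first by rewrite mul1r -PE; apply: eq_bigl => D; rewrite ja andbT.
  rewrite mulrDl mul1r -PE (bigID (fun D => (a, j) \in D)) /=; congr (_ + _).
    by apply: eq_bigl => D; rewrite leqNgt ja /= andbA.
  rewrite mulr_sumr.
  rewrite [RHS](reindex_onto (fun D => (a, j) |: D) (fun D => D :\ (a, j))) /=; last first.
    by move=> D /and3P[_ _]; rewrite leqNgt ja /= => h; rewrite setD1K.
  apply: eq_big => [D|D /andP[/andP[hD hA] hN]].
    apply/idP/idP => [/andP[/andP[hD hA] hN]|].
      have [-> ->] := dissection_addl aj jb ja hD hA.
      by rewrite !inE eqxx orbT /= setU1K.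
    move=> /andP[/and3P[hD hA _] /eqP E].
    have [h1 h2] := dissection_dell aj jb hD hA; rewrite E in h1 h2; rewrite h1 h2 /=.
    by rewrite -E !inE eqxx.
  have [h1 _] := dissection_addl aj jb ja hD hA.
  have := dissection_card_le ab h1; rewrite /F cardsU1 hN add1n -/g => h.
  by rewrite -exprS; congr ('X ^+ _); lia.
rewrite (eq_bigr _ inner) gE dpolyS.
pose G (j : nat) := (if (j <= a.+1)%N then 1 else 1 + 'X) *
  (dpoly nat (j - a - 1) * dpoly nat (b - j - 1)).
have -> : \sum_(j : 'I_n | (a < j < b)%N) G j = \sum_(a.+1 <= j < b) G j.
  rewrite (big_nat_widenl _ 0) // (big_nat_widen _ _ n) ?(ltnW (ltn_ord b)) //.
  by rewrite big_mkord; apply: eq_bigl => j.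
set m' := (b - a - 2)%N.
rewrite -(add0n a.+1) big_addn (_ : b - a.+1 = m'.+1)%N; last by rewrite /m'; lia.
rewrite big_mkord big_ord_recl /= {1}/G add0n leqnn mul1r; congr (_ + _).
  have -> : (a.+1 - a - 1 = 0)%N by lia.
  by rewrite dpoly0 mul1r; congr (dpoly _ _); rewrite /m'; lia.
rewrite mulr_sumr (reindex_inj rev_ord_inj) /=; apply: eq_bigr => i _.
have im := ltn_ord i; rewrite /G /bump /= ifF; last by lia.
congr (_ * _); rewrite mulrC; congr (dpoly _ _ * dpoly _ _); rewrite /m' in im *; lia.
Qed.

End Dissections.

(** Adding the side joining the first and last vertices turns a set of diagonals into a member of
    [dissections]. *)
Lemma num_polygon_subdivisionsE n k : (2 < n)%N -> (k <= n - 3)%N ->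
  num_polygon_subdivisions n k = ((dpoly nat (n - 2))`_k)%R.
Proof.
case: n => // n n3 hk; pose a : 'I_n.+1 := ord0; pose b : 'I_n.+1 := ord_max.
have ab : (a < b)%N by rewrite /=; lia.
have -> : (n.+1 - 2 = b - a - 1)%N by rewrite /=; lia.
rewrite -sum_dissections // coef_sum.
have -> : (\sum_(D in dissections a b) ('X^(b - a - 1 - #|D|) : {poly nat})`_k)%R =
    #|[set D in dissections a b | k == (b - a - 1 - #|D|)%N]|.
  rewrite -sum1dep_card big_mkcondr /=; apply: eq_bigr => D _.
  by rewrite coefXn; case: eqP.
rewrite /num_polygon_subdivisions.
set S1 := [set D : {set _} | _].
rewrite -(card_in_imset (f := fun D => (a, b) |: D) (D := mem S1)); last first.
  move=> D D' hD hD'.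
  have N E : E \in S1 -> (a, b) \notin E.
    rewrite inE => /and3P[/forall_inP h _ _]; apply/negP => /h.
    by rewrite /is_diagonal /= eqxx andbF.
  by move=> /(congr1 (fun E => E :\ (a, b))); rewrite !setU1K ?N.
apply: eq_card => D; rewrite [in RHS]inE /=; apply/imsetP/andP.
  move=> [E]; rewrite inE => /and3P[/forall_inP h1 /forall_inP h2 /eqP h3] ->.
  have w d : d \in E -> within a b d.
    by move=> /h1 /andP[h _]; rewrite /within h leq0n /= -ltnS ltn_ord.
  have N : (a, b) \notin E by apply/negP => /h1; rewrite /is_diagonal /= eqxx andbF.
  have c d : within a b d -> ~~ crossing (a, b) d && ~~ crossing d (a, b).
    by rewrite /within /crossing /=; lia.
  have hw : within a b (a, b) by rewrite /within /=; lia.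
  split; last by rewrite cardsU1 N h3 /=; lia.
  apply/dissectionsP; split; last by rewrite !inE eqxx orbT.
    by move=> d; rewrite !inE => /predU1P[->|/w].
  move=> d e; rewrite !inE => /predU1P[->|dE] /predU1P[->|eE].
  + by have /andP[] := c _ hw.
  + by have /andP[] := c _ (w _ eE).
  + by have /andP[] := c _ (w _ dE).
  + by have /forall_inP := h2 _ dE; apply.
move=> [hD /eqP hk']; have bD : (a, b) \in D by apply: dissection_base hD _; rewrite /=; lia.
have hc := dissection_card_le ab hD; rewrite (cardsD1 (a, b) D) bD add1n in hk' hc.
case/dissectionsP: hD => h1 h2 _; exists (D :\ (a, b)); last by rewrite setD1K.
rewrite inE; apply/and3P; split.
- apply/forall_inP => -[i l]; rewrite !inE => /andP[ne /h1]; rewrite /within /is_diagonal /=.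
  move=> /andP[-> _] /=; apply: contra ne => /andP[/eqP i0 /eqP ln].
  by apply/eqP; congr (_, _); apply: val_inj; rewrite /= ?i0 //; lia.
- apply/forall_inP => d; rewrite !inE => /andP[_ dD]; apply/forall_inP => e.
  by rewrite !inE => /andP[_ eD]; apply: h2.
- by move: hk' hc; rewrite /=; move: #|_| => c; lia.
Qed.

(** * Cells of regular subdivisions *)

Section SmallEps.
Variable R : realFieldType.
Implicit Types (Q : R -> Prop) (a b : R).

(** Finitely many such conditions can be met at once, which spares explicit constants in the
    perturbation arguments. *)
Definition ev_small Q := exists2 e0, 0 < e0 & forall e, 0 < e -> e < e0 -> Q e.

Lemma ev_small_ex Q : ev_small Q -> exists2 e, 0 < e & Q e.
Proof.
case=> e0 e0_gt0 He; exists (e0 / 2); first by rewrite divr_gt0.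
by apply: He; [rewrite divr_gt0 | lra].
Qed.

Lemma ev_small_imp Q Q' : (forall e, 0 < e -> Q e -> Q' e) -> ev_small Q -> ev_small Q'.
Proof. by move=> H [e0 ? He]; exists e0 => // e ? ?; apply/H/He. Qed.

Lemma ev_small_and Q Q' : ev_small Q -> ev_small Q' -> ev_small (fun e => Q e /\ Q' e).
Proof.
move=> [e1 ? H1] [e2 ? H2]; exists (Num.min e1 e2); first by rewrite lt_min; apply/andP.
by move=> e ?; rewrite lt_min => /andP[? ?]; split; [apply: H1 | apply: H2].
Qed.

Lemma ev_small_seq (I : eqType) (s : seq I) (Q : I -> R -> Prop) :
  (forall i, i \in s -> ev_small (Q i)) ->
  ev_small (fun e => forall i, i \in s -> Q i e).
Proof.
elim: s => [|i s IH] H; first by exists 1.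
have [||e0 e0_gt0 He] := @ev_small_and (Q i) (fun e => forall j, j \in s -> Q j e).
- by apply: H; rewrite mem_head.
- by apply: IH => j js; apply: H; rewrite inE js orbT.
exists e0 => // e egt elt j; rewrite inE; case: (He e egt elt) => Hi Hs.
by case/predU1P => [->|/Hs].
Qed.

Lemma ev_small_forall (I : finType) (Q : I -> R -> Prop) :
  (forall i, ev_small (Q i)) -> ev_small (fun e => forall i, Q i e).
Proof.
move=> H; apply: ev_small_imp (@ev_small_seq _ (enum I) Q (fun i _ => H i)) => e _ He i.
by apply: He; rewrite mem_enum.
Qed.

Lemma ev_small_lt a b : 0 < a -> ev_small (fun e => 0 < a + e * b).
Proof.
move=> agt; have bgt : 0 < `|b| + 1 by rewrite ltr_wpDl.
exists (a / (`|b| + 1)); first by rewrite divr_gt0.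
move=> e egt; rewrite ltr_pdivlMr // => H.
have Hb : - `|b| <= b by rewrite lerNl -normrN ler_norm.
have : e * - `|b| <= e * b by rewrite ler_pM2l.
nra.
Qed.

Lemma ev_small_neq0 a b : (a != 0) || (b != 0) -> ev_small (fun e => a + e * b != 0).
Proof.
have [->|a0 _] := eqVneq a 0.
  by move=> /= b0; exists 1 => // e e0 _; rewrite add0r mulf_neq0 // gt_eqF.
case: (ltgtP a 0) a0 => [alt|agt|//] _.
  have := @ev_small_lt (- a) (- b); rewrite oppr_gt0 => /(_ alt).
  apply: ev_small_imp => e _; rewrite mulrN -opprD oppr_gt0 => H.
  by rewrite lt_eqF.
by apply: ev_small_imp (@ev_small_lt a b agt) => e _ H; rewrite gt_eqF.
Qed.

End SmallEps.

(** * Cells as contact sets of affine minorants *)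

Section Cells.
Variables (R : realFieldType) (n : nat) (X Y : 'I_n -> R).

Implicit Types (i j k : 'I_n) (l : R * R * R) (V B C D : {set 'I_n}) (w : 'rV[R]_n).
Implicit Types (T : {set {set 'I_n}}).

Definition ev l i : R := l.1.1 * X i + l.1.2 * Y i + l.2.

Definition det3 i j k : R :=
  (X j - X i) * (Y k - Y i) - (X k - X i) * (Y j - Y i).

Definition gen_pos := forall i j k, i != j -> i != k -> j != k -> det3 i j k != 0.

Definition addl l e l' : R * R * R :=
  (l.1.1 + e * l'.1.1, l.1.2 + e * l'.1.2, l.2 + e * l'.2).

Lemma evDZ l l' e i : ev (addl l e l') i = ev l i + e * ev l' i.
Proof. rewrite /ev /=; ring. Qed.

Definition supports V w C l :=
  forall i, i \in V -> ev l i <= w 0 i ?= iff (i \in C).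

Definition iscell V w C : Prop :=
  [/\ C \subset V, (2 < #|C|)%N & exists l, supports V w C l].

(* The regular subdivision of V induced by w: in general position the cells of
   dimension 2 are those with more than two points. *)
Definition cells V w : {set {set 'I_n}} := [set C | `[< iscell V w C >]].

Lemma cellsP V w C : reflect (iscell V w C) (C \in cells V w).
Proof. by rewrite inE; apply: asboolP. Qed.

Definition aff_on w C := exists l, forall i, i \in C -> w 0 i = ev l i.

Lemma aff_onS w C D : C \subset D -> aff_on w D -> aff_on w C.
Proof. by move=> /subsetP s [l H]; exists l => i /s/H. Qed.

Lemma aff_onDZ w w' e C : aff_on w C -> aff_on w' C -> aff_on (w + e *: w') C.
Proof.
move=> [l H] [l' H'].
exists (addl l e l') => i iC.
by rewrite evDZ !mxE (H i iC) (H' i iC).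
Qed.

Lemma aff_onD w w' C : aff_on w C -> aff_on w' C -> aff_on (w + w') C.
Proof. by move=> H H'; rewrite -[w']scale1r; apply: aff_onDZ. Qed.

Lemma aff_on0 C : aff_on 0 C.
Proof. by exists (0, 0, 0) => i _; rewrite /ev /= mxE; ring. Qed.

Lemma aff_onZ w e C : aff_on w C -> aff_on (e *: w) C.
Proof. by move=> H; rewrite -[e *: w]add0r; apply: aff_onDZ => //; apply: aff_on0. Qed.

Lemma aff_on_sum (I : Type) (r : seq I) (Q : pred I) (F : I -> 'rV[R]_n) C :
  (forall t, Q t -> aff_on (F t) C) -> aff_on (\sum_(t <- r | Q t) F t) C.
Proof.
move=> H; apply: (big_ind (fun u => aff_on u C)) => //; first exact: aff_on0.
by move=> *; exact: aff_onD.
Qed.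

Lemma iscell_aff V w C : iscell V w C -> aff_on w C.
Proof.
case=> /subsetP sCV _ [l Hl]; exists l => i iC; apply/esym/eqP.
by rewrite (Hl i (sCV _ iC)).2.
Qed.

Lemma iscell_restrict V B w C : C \subset B -> B \subset V -> iscell V w C -> iscell B w C.
Proof.
move=> sCB /subsetP sBV [_ c3 [l Hl]]; split=> //; exists l => i /sBV; exact: Hl.
Qed.

(** Outside B the supporting function stays strictly below for small e; on B it agrees with [w], so
    only [w'] and its own supporting function are compared there. *)
Lemma iscell_refine V w B w' C :
  iscell V w B -> iscell B w' C -> ev_small (fun e => iscell V (w + e *: w') C).
Proof.
move=> [sBV _ [l Hl]] [sCB c3 [l' Hl']].
have : ev_small (fun e => forall i, i \in V -> i \notin B ->
     0 < (w 0 i - ev l i) + e * (w' 0 i - ev l' i)).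
  apply: ev_small_forall => i; case: (boolP (i \in V)) => iV; last first.
    by exists 1 => // e _ _; rewrite (negbTE iV).
  case: (boolP (i \in B)) => iB; first by exists 1 => // e _ _; rewrite iB.
  have /ev_small_lt H : 0 < w 0 i - ev l i.
    by rewrite subr_gt0 (lt_leif (Hl i iV)) iB.
  by apply: ev_small_imp (H (w' 0 i - ev l' i)) => e _ ?.
apply: ev_small_imp => e egt He; split=> //; first exact: subset_trans sBV.
exists (addl l e l') => i iV.
rewrite evDZ !mxE; case: (boolP (i \in B)) => iB; last first.
  have := He i iV iB; have -> : (i \in C) = false.
    by apply: contraNF iB; apply: (subsetP sCB).
  by move=> H; apply/leifP; lra.
have /eqP -> : ev l i == w 0 i by rewrite (Hl i iV).2.
rewrite /Order.leif lerD2l ler_pM2l // (inj_eq (addrI _)) (inj_eq (mulfI (lt0r_neq0 egt))).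
exact: Hl'.
Qed.

Lemma iscell_perturb V w C w' :
  iscell V w C -> aff_on w' C -> ev_small (fun e => iscell V (w + e *: w') C).
Proof.
move=> H [l Hl]; apply: iscell_refine (H) _; case: (H) => _ c3 _; split=> //.
by exists l => i iC; rewrite iC (Hl i iC); apply: leif_refl.
Qed.

Hypothesis gp : gen_pos.

Lemma interp3 i j k a b c : i != j -> i != k -> j != k ->
  exists l, [/\ ev l i = a, ev l j = b & ev l k = c].
Proof.
move=> ij ik jk; have d0 := gp ij ik jk.
pose d := det3 i j k.
pose al := ((b - a) * (Y k - Y i) - (c - a) * (Y j - Y i)) / d.
pose be := ((X j - X i) * (c - a) - (X k - X i) * (b - a)) / d.
exists (al, be, a - al * X i - be * Y i).
rewrite /ev /= /al /be /d; move: d0; rewrite /det3 => d0.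
split; field; exact: d0.
Qed.

Lemma ev_zero3 l i j k : i != j -> i != k -> j != k ->
  ev l i = 0 -> ev l j = 0 -> ev l k = 0 -> l = (0, 0, 0).
Proof.
case: l => -[a b] c ij ik jk; have := gp ij ik jk; rewrite /ev /det3 /= => d0 ei ej ek.
set d := (X in X != 0) in d0.
have da : a * d = 0.
  have -> : a * d = (a * X j + b * Y j + c - (a * X i + b * Y i + c)) * (Y k - Y i)
     - (a * X k + b * Y k + c - (a * X i + b * Y i + c)) * (Y j - Y i) by rewrite /d; ring.
  by rewrite ei ej ek; ring.
have db : b * d = 0.
  have -> : b * d = (a * X k + b * Y k + c - (a * X i + b * Y i + c)) * (X j - X i)
     - (a * X j + b * Y j + c - (a * X i + b * Y i + c)) * (X k - X i) by rewrite /d; ring.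
  by rewrite ei ej ek; ring.
move/eqP: da; rewrite mulf_eq0 (negbTE d0) orbF => /eqP a0.
move/eqP: db; rewrite mulf_eq0 (negbTE d0) orbF => /eqP b0.
by move: ei; rewrite a0 b0 !mul0r !add0r => ->.
Qed.

Lemma ev_eq3 l l' i j k : i != j -> i != k -> j != k ->
  ev l i = ev l' i -> ev l j = ev l' j -> ev l k = ev l' k -> forall z, ev l z = ev l' z.
Proof.
move=> ij ik jk ei ej ek z.
pose d : R * R * R := addl l (-1) l'.
have Hd x : ev d x = ev l x - ev l' x by rewrite evDZ mulN1r.
have := @ev_zero3 d i j k ij ik jk; rewrite !Hd ei ej ek !subrr => /(_ erefl erefl erefl) d0.
by apply/eqP; rewrite -subr_eq0 -Hd d0 /ev /= !mul0r !add0r.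
Qed.

Lemma card_gt2P C : (2 < #|C|)%N -> exists i j k,
  [/\ i \in C, j \in C & k \in C] /\ [/\ i != j, i != k & j != k].
Proof.
move=> c3; have /card_gt0P[i iC] : (0 < #|C|)%N by apply: leq_trans c3.
have /card_gt0P[j] : (0 < #|C :\ i|)%N by move: c3; rewrite (cardsD1 i C) iC add1n ltnS => /ltnW.
rewrite !inE => /andP[ji jC].
have /card_gt0P[k] : (0 < #|C :\ i :\ j|)%N.
  by move: c3; rewrite (cardsD1 i C) iC (cardsD1 j (C :\ i)) !inE ji jC.
rewrite !inE => /and3P[kj ki kC].
by exists i, j, k; split; split=> //; rewrite eq_sym.
Qed.

End Cells.

(** * Vectors of a subspace avoiding finitely many hyperplanes *)

Section LinearGeneric.
Variables (R : realFieldType) (n : nat).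

Lemma avoid_hyperplanes (S : {vspace 'rV[R]_n}) (cs : seq 'cV[R]_n) :
  (forall c, c \in cs -> exists2 u, u \in S & (u *m c) 0 0 != 0) ->
  exists2 v, v \in S & forall c, c \in cs -> (v *m c) 0 0 != 0.
Proof.
elim: cs => [|c cs IH] H; first by exists 0; rewrite ?mem0v.
have [c' c'cs|v vS Hv] := IH; first by apply: H; rewrite inE c'cs orbT.
have [u uS Hu] := H c (mem_head _ _).
have : ev_small (fun e => forall c', c' \in c :: cs -> (v *m c') 0 0 + e * (u *m c') 0 0 != 0).
  apply: ev_small_seq => c'; rewrite inE => /predU1P[->|c'cs]; apply: ev_small_neq0.
    by rewrite Hu orbT.
  by rewrite (Hv _ c'cs).
case/ev_small_ex => e _ He; exists (v + e *: u); first by rewrite memvD ?memvZ.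
by move=> c' /He; rewrite mulmxDl -scalemxAl !mxE.
Qed.

End LinearGeneric.

(** * Spans of secondary cones, and existence of cells *)

Section SecondaryCones.
Variables (R : realFieldType) (n : nat) (X Y : 'I_n -> R).
Implicit Types (i j k : 'I_n) (l g : R * R * R) (V B C D : {set 'I_n}) (w : 'rV[R]_n).
Implicit Types (T : {set {set 'I_n}}).

Local Notation ev := (ev X Y).
Local Notation det3 := (det3 X Y).
Local Notation cells := (cells X Y).
Local Notation iscell := (iscell X Y).
Local Notation supports := (supports X Y).
Local Notation aff_on := (aff_on X Y).

(* The lifted points i, j, k, m are coplanar iff the row vector of heights is
   orthogonal to [chi]. *)
Definition chi (z : 'I_n * 'I_n * 'I_n * 'I_n) : 'cV[R]_n :=
  let: (i, j, k, m) := z in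
  det3 j k m *: delta_mx i 0 - det3 i k m *: delta_mx j 0
  + det3 i j m *: delta_mx k 0 - det3 i j k *: delta_mx m 0.

Lemma chiE w i j k m : (w *m chi (i, j, k, m)) 0 0 =
  w 0 i * det3 j k m - w 0 j * det3 i k m + w 0 k * det3 i j m - w 0 m * det3 i j k.
Proof.
rewrite /chi !(mulmxDr, mulmxN, mulmxBr) -!scalemxAr -!colE !mxE; ring.
Qed.

Definition quad_in (z : 'I_n * 'I_n * 'I_n * 'I_n) C :=
  let: (i, j, k, m) := z in [&& i \in C, j \in C, k \in C & m \in C].

(* The linear span of the secondary cone of T when T is regular. *)
Definition cone_span T : {vspace 'rV[R]_n} :=
  (\bigcap_(z | [exists C in T, quad_in z C]) lker (linfun (mulmxr (chi z))))%VS.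

Definition codim_span T := (n - \dim (cone_span T))%N.

Lemma mem_cone_span T w : reflect
  (forall C z, C \in T -> quad_in z C -> (w *m chi z) 0 0 = 0) (w \in cone_span T).
Proof.
rewrite memvE; apply: (iffP subv_bigcapP) => [H C z CT zC|H z /exists_inP[C CT zC]].
  have /H : [exists C in T, quad_in z C] by apply/exists_inP; exists C.
  by rewrite -memvE memv_ker lfunE /= => /eqP->; rewrite mxE.
rewrite -memvE memv_ker lfunE /=; apply/eqP/matrixP => a b; rewrite !ord1 [RHS]mxE.
exact: H CT zC.
Qed.

Lemma cone_spanS T T' : T \subset T' -> (cone_span T' <= cone_span T)%VS.
Proof.
move=> /subsetP sTT'; apply/subvP => w /mem_cone_span H; apply/mem_cone_span => C z /sTT'.
exact: H.
Qed.

Lemma cone_spanU T T' : cone_span (T :|: T') = (cone_span T :&: cone_span T')%VS.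
Proof.
apply/vspaceP => w; rewrite memv_cap; apply/mem_cone_span/andP.
  by move=> H; split; apply/mem_cone_span => C z CT; apply: H; rewrite inE CT ?orbT.
move=> [/mem_cone_span H /mem_cone_span H'] C z; rewrite inE => /orP[/H|/H'] //; exact.
Qed.

Lemma cone_span0 : cone_span set0 = fullv.
Proof.
by apply/vspaceP => w; rewrite memvf; apply/mem_cone_span => C z; rewrite inE.
Qed.

Lemma aff_on_chi w C z : aff_on w C -> quad_in z C -> (w *m chi z) 0 0 = 0.
Proof.
case: z => [[[i j] k] m] [l H] /= /and4P[iC jC kC mC].
rewrite chiE !H // /ev /det3; ring.
Qed.

Lemma feasible_push V w l g j : j \in V -> 0 < ev g j ->
  (forall i, i \in V -> ev l i <= w 0 i) ->
  exists e k,
    [/\ [/\ 0 <= e, k \in V & 0 < ev g k], e * ev g k = w 0 k - ev l k,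
        ev (addl l e g) k = w 0 k & forall i, i \in V -> ev (addl l e g) i <= w 0 i].
Proof.
move=> jV gj Hl.
pose F i := (w 0 i - ev l i) / ev g i.
have Pj : (j \in V) && (0 < ev g j) by rewrite jV.
have [k /andP[kV gk] kmin] :=
  @Order.TotalTheory.arg_minP _ R _ j (fun i => (i \in V) && (0 < ev g i)) F Pj.
exists (F k), k; have He : F k * ev g k = w 0 k - ev l k by rewrite divfK ?gt_eqF.
split=> //; first by split=> //; rewrite divr_ge0 ?subr_ge0 ?Hl // ltW.
  by rewrite evDZ He addrC subrK.
move=> i iV; rewrite evDZ; have [gi|gi] := ltrP 0 (ev g i).
  have := kmin i; rewrite iV gi => /(_ isT); rewrite /F ler_pdivlMr // => ?; lra.
have := Hl i iV; have : 0 <= F k by rewrite divr_ge0 ?subr_ge0 ?Hl // ltW.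
move=> ? ?; nra.
Qed.

Lemma iscell_tight V w l : (forall i, i \in V -> ev l i <= w 0 i) ->
  (2 < #|[set i in V | ev l i == w 0%R i]|)%N -> iscell V w [set i in V | ev l i == w 0 i].
Proof.
move=> H c3; split=> //; first by apply/subsetP => i; rewrite inE => /andP[].
by exists l => i iV; rewrite /Order.leif inE iV; split; rewrite ?H.
Qed.

Hypothesis gp : gen_pos X Y.

(** Three points of a cell determine an affine function; the coplanarity relations put the other
    points of the cell on it. *)
Lemma cone_span_aff T w : (forall C, C \in T -> 2 < #|C|)%N ->
  reflect (forall C, C \in T -> aff_on w C) (w \in cone_span T).
Proof.
move=> T3; apply: (iffP (mem_cone_span T w)) => [H C CT|H C z CT]; last first.
  exact/aff_on_chi/H.
have [i [j [k [[iC jC kC] [ij ik jk]]]]] := card_gt2P (T3 _ CT).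
have [l [li lj lk]] := interp3 gp (w 0 i) (w 0 j) (w 0 k) ij ik jk.
exists l => m mC.
have := H C (i, j, k, m) CT; rewrite /= iC jC kC mC chiE -li -lj -lk => /(_ isT) E.
have := gp ij ik jk => d0; apply: (mulIf d0).
have E2 : ev l i * det3 j k m - ev l j * det3 i k m + ev l k * det3 i j m - ev l m * det3 i j k = 0.
  rewrite /ev /det3; ring.
by move/eqP: E; move/eqP: E2; rewrite !subr_eq0 => /eqP <- /eqP <-.
Qed.

Lemma card_ge3_set C i j k : i \in C -> j \in C -> k \in C ->
  i != j -> i != k -> j != k -> (2 < #|C|)%N.
Proof.
move=> iC jC kC ij ik jk; have : [set i; j; k] \subset C.
  by apply/subsetP => x; rewrite !inE => /orP[/orP[]|] /eqP->.
by move/subset_leq_card; apply: leq_trans; rewrite -setUA !cardsU1 !inE cards1 negb_or ij ik jk.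
Qed.

(** Gift wrapping: the horizontal plane through a lowest lifted point is tilted about that point
    until it meets a second one, then about the edge so found. *)
Lemma exists_cell V w : (2 < #|V|)%N -> exists C, iscell V w C.
Proof.
move=> V3; have [a [b [c [[aV bV cV] [ab ac bc]]]]] := card_gt2P V3.
have [i iV imin] := @Order.TotalTheory.arg_minP _ R _ a (mem V) (fun i => w 0 i) aV.
have {}iV : i \in V := iV.
pose l0 : R * R * R := (0, 0, w 0 i).
have l0E z : ev l0 z = w 0 i by rewrite /ev /l0 /=; ring.
have H0 z : z \in V -> ev l0 z <= w 0 z by move=> zV; rewrite l0E; apply: imin.
have other u v : exists2 z, z \in V & (z != u) && (z != v).
  have [->|au] := eqVneq u a.
    have [->|bv] := eqVneq v b; first by exists c => //; rewrite eq_sym ac eq_sym.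
    by exists b => //; rewrite eq_sym ab eq_sym.
  have [->|av] := eqVneq v a; last by exists a => //; rewrite eq_sym au eq_sym.
  have [->|bu] := eqVneq u b; first by exists c => //; rewrite eq_sym bc eq_sym.
  by exists b => //; rewrite (eq_sym b u) bu eq_sym ab.
have [j jV /andP[ji _]] := other i i; have [k kV /andP[ki kj]] := other i j.
have [g [gi gj _]] : exists g, [/\ ev g i = 0, ev g j = 1 & ev g k = 0].
  by apply: interp3; rewrite // eq_sym.
have gj0 : 0 < ev g j by rewrite gj.
have [e [j' [[_ j'V gj'] _ tj' H1]]] := feasible_push jV gj0 H0.
set l1 := addl _ _ _ in tj' H1.
have ij' : i != j' by apply: contraTneq gj' => <-; rewrite gi ltxx.
have ti : ev l1 i = w 0 i by rewrite evDZ gi mulr0 addr0 l0E.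
have [k' k'V /andP[k'i k'j]] := other i j'.
have [g2 [g2i g2j g2k]] : exists g, [/\ ev g i = 0, ev g j' = 0 & ev g k' = 1].
  by apply: interp3; rewrite // eq_sym.
have gk0 : 0 < ev g2 k' by rewrite g2k.
have [e2 [k2 [[_ k2V gk2] _ tk2 H2]]] := feasible_push k'V gk0 H1.
set l2 := addl _ _ _ in tk2 H2.
have ik2 : i != k2 by apply: contraTneq gk2 => <-; rewrite g2i ltxx.
have jk2 : j' != k2 by apply: contraTneq gk2 => <-; rewrite g2j ltxx.
have ti2 : ev l2 i = w 0 i by rewrite evDZ g2i mulr0 addr0.
have tj2 : ev l2 j' = w 0 j' by rewrite evDZ g2j mulr0 addr0.
exists [set i in V | ev l2 i == w 0 i]; apply: iscell_tight => //.
by apply: (@card_ge3_set _ i j' k2) => //; rewrite inE ?ti2 ?tj2 ?tk2 eqxx andbT.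
Qed.

(** For weights of sum 1, the value of l at the point with weights [lam]. Two weight vectors
    describe the same point when these values agree for all l. *)
Definition bary (lam : 'I_n -> R) l := \sum_i lam i * ev l i.

Definition in_hull C (lam : 'I_n -> R) :=
  [/\ forall i, 0 <= lam i, forall i, i \notin C -> lam i = 0 & \sum_i lam i = 1].

Lemma baryDZ lam l g e :
  bary lam (addl l e g) = bary lam l + e * bary lam g.
Proof.
by rewrite /bary mulr_sumr -big_split /=; apply: eq_bigr => i _; rewrite evDZ; ring.
Qed.

Lemma bary_gt0 C lam g : in_hull C lam -> 0 < bary lam g -> exists2 j, j \in C & 0 < ev g j.
Proof.
move=> [lam0 lamC _] H; apply: contrapT => N.
move: H; rewrite ltNge => /negP; apply; rewrite -oppr_ge0 -sumrN; apply: sumr_ge0 => i _.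
rewrite oppr_ge0; case: (boolP (i \in C)) => iC; last by rewrite lamC // mul0r.
rewrite mulr_ge0_le0 // leNgt; apply/negP => gi; apply: N; by exists i.
Qed.

Lemma bary_le C lam (f1 f2 : 'I_n -> R) : in_hull C lam -> (forall i, i \in C -> f1 i <= f2 i) ->
  \sum_i lam i * f1 i <= \sum_i lam i * f2 i.
Proof.
move=> [lam0 lamC _] H; apply: ler_sum => i _.
case: (boolP (i \in C)) => iC; first by rewrite ler_wpM2l // H.
by rewrite lamC // !mul0r.
Qed.

Definition gen_heights w :=
  forall i j k m, uniq [:: i; j; k; m] -> (w *m chi (i, j, k, m)) 0 0 != 0.

(** Among all cells, one whose supporting function is largest at the given point contains it: were a
    barycentric coordinate negative, a pivot across the opposite edge would give a larger value.
    Generic heights make the cells triangles. *)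
Lemma covering_generic V w lam : gen_heights w -> (2 < #|V|)%N -> in_hull V lam ->
  exists2 C, iscell V w C & exists2 mu, in_hull C mu & forall l, bary mu l = bary lam l.
Proof.
move=> gw V3 hl; have [C0 C0c] := exists_cell w V3.
have exl C : exists l, iscell V w C -> supports V w C l.
  by case: (pselect (iscell V w C)) => [[_ _ [l Hl]]|N]; [exists l | exists (0,0,0)].
pose lC C := projT1 (cid (exl C)).
have lCP C : iscell V w C -> supports V w C (lC C) by move=> /(projT2 (cid (exl C))).
have C0P : C0 \in cells V w by apply/cellsP.
have [C /cellsP Cc Cmax] :=
  @Order.TotalTheory.arg_maxP _ R _ C0 (fun C => C \in cells V w) (fun C => bary lam (lC C)) C0P.
exists C => //; have [sCV c3 _] := Cc; have Hl := lCP _ Cc; set l := lC C in Hl.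
have [i [j [k [[iC jC kC] [ij ik jk]]]]] := card_gt2P c3.
have inV x : x \in C -> x \in V by apply: (subsetP sCV).
have tight x : x \in C -> ev l x = w 0 x.
  by move=> xC; apply/eqP; rewrite (Hl x (inV _ xC)).2.
have Cijk x : x \in C -> [|| x == i, x == j | x == k].
  move=> xC; apply: contraT; rewrite !negb_or => /and3P[xi xj xk].
  have /gw : uniq [:: i; j; k; x].
    by rewrite /= !inE !negb_or ij ik jk !(eq_sym _ x) xi xj xk.
  rewrite (@aff_on_chi w C) ?eqxx //; last by rewrite /= iC jC kC xC.
  by exists l => y /tight.
(* Here g is the barycentric coordinate of a. Pushing l along -g keeps b and c tight and reaches a
   new point x, hence a cell contradicting the maximality of C if g is negative at the point. *)
have Hnn a b c g : a \in C -> b \in C -> c \in C -> a != b -> a != c -> b != c ->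
    (forall x, x \in C -> [|| x == a, x == b | x == c]) ->
    ev g a = 1 -> ev g b = 0 -> ev g c = 0 -> 0 <= bary lam g.
  move=> aC bC cC ab ac bc Cabc ga gb gc; rewrite leNgt; apply/negP => lg.
  pose g' : R * R * R := addl (0, 0, 0) (-1) g.
  have g'E x : ev g' x = - ev g x by rewrite evDZ /ev /=; ring.
  have bg' : 0 < bary lam g'.
    rewrite /bary (eq_bigr (fun x => - (lam x * ev g x))) ?sumrN ?oppr_gt0 // => x _.
    by rewrite g'E mulrN.
  have [z zV gz] := bary_gt0 hl bg'.
  have Hl1 x : x \in V -> ev l x <= w 0 x by move/Hl => -[].
  have [e [x [[e0 xV gx] He tx H']]] := feasible_push zV gz Hl1.
  set l' := addl _ _ _ in tx H'.
  have xC : x \notin C.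
    by apply/negP => /Cabc /or3P[] /eqP E; move: gx; rewrite E g'E ?ga ?gb ?gc; lra.
  have egt : 0 < e.
    rewrite lt_neqAle e0 andbT; apply/eqP => e00; move: He; rewrite -e00 mul0r => /esym/eqP.
    by rewrite subr_eq0 eq_sym (Hl x xV).2 (negbTE xC).
  have ta : ev l' b = w 0 b by rewrite evDZ g'E gb oppr0 mulr0 addr0 tight.
  have tc : ev l' c = w 0 c by rewrite evDZ g'E gc oppr0 mulr0 addr0 tight.
  set C' := [set y in V | ev l' y == w 0 y].
  have xneq y : y \in C -> y != x by move=> yC; apply: contraNneq xC => <-.
  have [bC' cC' xC'] : [/\ b \in C', c \in C' & x \in C'].
    by split; rewrite inE ?ta ?tc ?tx eqxx andbT //; apply: inV.
  have C'c : iscell V w C'.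
    by apply: iscell_tight => //; apply: (@card_ge3_set _ b c x) => //; apply: xneq.
  have C'P : C' \in cells V w by apply/cellsP.
  have := Cmax C' C'P.
  have -> : bary lam (lC C') = bary lam l'.
    apply: eq_bigr => y _; congr (_ * _).
    have Ht z' : z' \in C' -> ev (lC C') z' = ev l' z'.
      move=> zC'; have zV' : z' \in V by move: zC'; rewrite inE => /andP[].
      by apply: etrans (_ : w 0 z' = _); [apply/eqP; rewrite (lCP _ C'c z' zV').2
        | move: zC'; rewrite inE => /andP[_ /eqP]].
    by apply: (ev_eq3 gp bc (xneq _ bC) (xneq _ cC)); apply: Ht.
  by rewrite baryDZ /= gerDl leNgt mulr_gt0.
have [gi [gii gij gik]] := interp3 gp 1 0 0 ij ik jk.
have [gj [gji gjj gjk]] := interp3 gp 0 1 0 ij ik jk.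
have [gk [gki gkj gkk]] := interp3 gp 0 0 1 ij ik jk.
pose mu x := if x == i then bary lam gi else if x == j then bary lam gj
  else if x == k then bary lam gk else 0.
have muE F : \sum_x mu x * F x = bary lam gi * F i + bary lam gj * F j + bary lam gk * F k.
  rewrite (bigD1 i) //= (bigD1 j) 1?eq_sym //= (bigD1 k) /=; last by rewrite !(eq_sym k) ik.
  rewrite big1 ?addr0; last first.
    by move=> x /andP[/andP[/negbTE xi /negbTE xj] /negbTE xk]; rewrite /mu xi xj xk mul0r.
  by rewrite /mu !eqxx !(eq_sym _ i) (negbTE ij) (negbTE ik) (eq_sym k) (negbTE jk) addrA.
have mub l' : bary mu l' = bary lam l'.
  rewrite {1}/bary muE /bary !mulr_suml -!big_split; apply: eq_bigr => x _ /=.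
  rewrite -!mulrA -!mulrDr; congr (_ * _).
  (* L is l' written in the barycentric coordinate functions of the triangle i, j, k. *)
  pose L : R * R * R := (gi.1.1 * ev l' i + gj.1.1 * ev l' j + gk.1.1 * ev l' k,
                         gi.1.2 * ev l' i + gj.1.2 * ev l' j + gk.1.2 * ev l' k,
                         gi.2 * ev l' i + gj.2 * ev l' j + gk.2 * ev l' k).
  have LE y : ev L y = ev gi y * ev l' i + ev gj y * ev l' j + ev gk y * ev l' k.
    rewrite /L /ev /=; ring.
  rewrite -LE; apply: (ev_eq3 gp ij ik jk); rewrite LE.
  - by rewrite gii gji gki; ring.
  - by rewrite gij gjj gkj; ring.
  - by rewrite gik gjk gkk; ring.
exists mu => //; split.
- move=> x; rewrite /mu; case: eqP => _; last case: eqP => _; last case: eqP => _ //.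
  + exact: (Hnn i j k).
  + apply: (Hnn j i k) => //; rewrite 1?eq_sym // => x' /Cijk; by rewrite orbCA.
  + apply: (Hnn k i j) => //; rewrite 1?eq_sym // => x' /Cijk.
    by rewrite orbA orbC.
- move=> x xC; rewrite /mu.
  have E y : y \in C -> (x == y) = false by move=> yC; apply: contraNF xC => /eqP->.
  by rewrite !E.
- have := mub (0, 0, 1); rewrite /bary.
  under eq_bigr do rewrite /ev /= !mul0r !add0r mulr1.
  under [RHS]eq_bigr do rewrite /ev /= !mul0r !add0r mulr1.
  by case: hl => _ _ ->.
Qed.

End SecondaryCones.

(** * Cells cover the convex hull *)

Section Covering.
Variables (R : realFieldType) (n : nat) (X Y : 'I_n -> R).
Implicit Types (i j k : 'I_n) (l g : R * R * R) (V B C D : {set 'I_n}) (w : 'rV[R]_n).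
Implicit Types (T : {set {set 'I_n}}).

Local Notation ev := (ev X Y).
Local Notation det3 := (det3 X Y).
Local Notation cells := (cells X Y).
Local Notation iscell := (iscell X Y).
Local Notation supports := (supports X Y).
Local Notation aff_on := (aff_on X Y).
Local Notation chi := (chi X Y).
Local Notation bary := (bary X Y).
Local Notation cone_span := (cone_span X Y).

Hypothesis gp : gen_pos X Y.

Lemma chi_interp w l i j k m : ev l i = w 0 i -> ev l j = w 0 j -> ev l k = w 0 k ->
  (w *m chi (i, j, k, m)) 0 0 = (ev l m - w 0 m) * det3 i j k.
Proof. move=> li lj lk; rewrite chiE -li -lj -lk /ev /det3; ring. Qed.

Lemma chi_neq0 i j k m : uniq [:: i; j; k; m] ->
  exists u : 'rV[R]_n, (u *m chi (i, j, k, m)) 0 0 != 0.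
Proof.
rewrite /= !inE !negb_or => /and4P[/and3P[ij ik im] /andP[jk jm] km _].
exists (delta_mx 0 i); rewrite chiE !mxE !eqxx /= (eq_sym j) (eq_sym k) (eq_sym m).
rewrite (negbTE ij) (negbTE ik) (negbTE im) !mul0r mul1r subr0 addr0 subr0; exact: gp.
Qed.

Lemma exists_gen_heights : exists w, gen_heights X Y w.
Proof.
pose zs := [seq chi z | z <- enum {: 'I_n * 'I_n * 'I_n * 'I_n} &
  uniq [:: z.1.1.1; z.1.1.2; z.1.2; z.2]].
have [c|v _ Hv] := @avoid_hyperplanes R n fullv zs.
  case/mapP => -[[[i j] k] m]; rewrite mem_filter => /andP[u _] ->.
  by have [w Hw] := chi_neq0 u; exists w; rewrite ?memvf.
exists v => i j k m u; apply: Hv; apply: map_f; by rewrite mem_filter u mem_enum.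
Qed.

(** The heights are moved to generic ones, by so little that no nonzero value of [chi] changes sign.
    A cell of the generic heights then lies in a cell of [w]. *)
Lemma covering V w lam : (2 < #|V|)%N -> in_hull V lam ->
  exists2 C, iscell V w C & exists2 mu, in_hull C mu & forall l, bary mu l = bary lam l.
Proof.
move=> V3 hl; have [eta Heta] := exists_gen_heights.
have : ev_small (fun e => forall z, [/\ uniq [:: z.1.1.1; z.1.1.2; z.1.2; z.2] ->
    ((w + e *: eta) *m chi z) 0 0 != 0,
    0 < (w *m chi z) 0 0 -> 0 < ((w + e *: eta) *m chi z) 0 0 &
    (w *m chi z) 0 0 < 0 -> ((w + e *: eta) *m chi z) 0 0 < 0]).
  apply: ev_small_forall => -[[[i j] k] m]; set z := (i, j, k, m).
  have E e : ((w + e *: eta) *m chi z) 0 0 = (w *m chi z) 0 0 + e * (eta *m chi z) 0 0.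
    by rewrite mulmxDl -scalemxAl [LHS]mxE [X in _ + X]mxE.
  set a := (w *m chi z) 0 0 in E *; set b := (eta *m chi z) 0 0 in E *.
  have H1 : ev_small (fun e => uniq [:: i; j; k; m] -> a + e * b != 0).
    case: (boolP (uniq _)) => u; last by exists 1.
    have : ev_small (fun e => a + e * b != 0) by apply: ev_small_neq0; rewrite Heta ?orbT.
    by apply: ev_small_imp.
  have H2 : ev_small (fun e => 0 < a -> 0 < a + e * b).
    case: (ltrP 0 a) => ha; last by exists 1.
    by apply: ev_small_imp (ev_small_lt b ha).
  have H3 : ev_small (fun e => a < 0 -> a + e * b < 0).
    case: (ltrP a 0) => ha; last by exists 1.
    have := @ev_small_lt _ (- a) (- b); rewrite oppr_gt0 => /(_ ha).
    by apply: ev_small_imp => e _; rewrite mulrN -opprD oppr_gt0.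
  apply: ev_small_imp (ev_small_and H1 (ev_small_and H2 H3)) => e _ [h1 [h2 h3]].
  by rewrite E; split.
case/ev_small_ex => e _ He; set w' := w + e *: eta in He.
have gw' : gen_heights X Y w' by move=> i j k m u; case: (He (i, j, k, m)) => /(_ u).
have [C Cc [mu [mu0 muC mu1] Hmu]] := covering_generic gp gw' V3 hl.
have [sCV c3 [l' Hl']] := Cc.
have [i [j [k [[iC jC kC] [ij ik jk]]]]] := card_gt2P c3.
have tl' x : x \in C -> ev l' x = w' 0 x.
  by move=> xC; apply/eqP; rewrite (Hl' x (subsetP sCV _ xC)).2.
have [l [li lj lk]] := interp3 gp (w 0 i) (w 0 j) (w 0 k) ij ik jk.
have sgn x : (w' *m chi (i, j, k, x)) 0 0 = (ev l' x - w' 0 x) * det3 i j k.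
  by apply: chi_interp; apply: tl'.
have sgn0 x : (w *m chi (i, j, k, x)) 0 0 = (ev l x - w 0 x) * det3 i j k.
  exact: chi_interp.
have d0 := gp ij ik jk.
(* A violation for w is a strict sign of [chi]; it would persist for w' and contradict the
   feasibility of l'. *)
have feas x : x \in V -> ev l x <= w 0 x.
  move=> xV; have := (Hl' x xV).1; have [_ h2 h3] := He (i, j, k, x).
  move: h2 h3; rewrite sgn sgn0 leNgt; set d := det3 i j k in d0 *; move=> h2 h3 H.
  rewrite leNgt; apply/negP => N; move/negP: H; apply; case: (ltgtP d 0) d0 => // hd _.
    have : (ev l x - w 0 x) * d < 0 by rewrite nmulr_llt0 // subr_gt0.
    by move/h3; rewrite nmulr_llt0 // subr_gt0.
  have : 0 < (ev l x - w 0 x) * d by rewrite pmulr_lgt0 // subr_gt0.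
  by move/h2; rewrite pmulr_lgt0 // subr_gt0.
have tl x : x \in C -> ev l x = w 0 x.
  move=> xC; have [_ h2 h3] := He (i, j, k, x).
  move: h2 h3; rewrite sgn tl' // subrr mul0r ltxx => h2 h3.
  have /eqP : (w *m chi (i, j, k, x)) 0 0 = 0.
    by apply/eqP; case: (ltgtP ((w *m chi (i, j, k, x)) 0 0) 0) => // [/h3|/h2].
  by rewrite sgn0 mulf_eq0 (negbTE d0) orbF subr_eq0 => /eqP.
have sC : C \subset [set x in V | ev l x == w 0 x].
  by apply/subsetP => x xC; rewrite inE tl ?eqxx ?(subsetP sCV).
exists [set x in V | ev l x == w 0 x].
  by apply: iscell_tight => //; apply: leq_trans c3 (subset_leq_card sC).
exists mu => //; split=> // x; move=> xN; apply: muC; apply: contraNN xN; exact: subsetP.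
Qed.

(** The barycentre of a cell C' of w' is covered by a cell C of w, which is a cell of w' too. Both
    supporting functions take the value of the lower envelope of w' there, so that of C touches w'
    at all of C', and three common points force C = C'. *)
Lemma cells_sub_eq V w w' : (2 < #|V|)%N -> cells V w \subset cells V w' ->
  cells V w = cells V w'.
Proof.
move=> V3 /subsetP sub; apply/setP => C'; apply/idP/idP; first exact: sub.
move=> /cellsP [sC'V c3' [l' Hl']].
have c0 : #|C'|%:R != 0 :> R by rewrite pnatr_eq0 -lt0n; apply: leq_trans c3'.
pose lam i : R := if i \in C' then #|C'|%:R^-1 else 0.
have hl : in_hull V lam.
  split=> [i|i iV|]; rewrite /lam.
  - by case: ifP => // _; rewrite invr_ge0 ler0n.
  - by case: ifP => // /(subsetP sC'V); rewrite (negbTE iV).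
  - by rewrite -big_mkcond sumr_const -[LHS]mulr_natl divff.
have hl' : in_hull C' lam by case: hl => l0 _ l1; split=> // i; rewrite /lam => /negbTE->.
have [C Cc [mu [mu0 muC mu1] Hmu]] := covering w V3 hl.
have CT : C \in cells V w by apply/cellsP.
have /cellsP[sCV c3 [l Hl]] := sub _ CT.
have tight (E : {set 'I_n}) m x : E \subset V -> supports V w' E m -> x \in E -> ev m x = w' 0 x.
  by move=> /subsetP sE Hm xE; apply/eqP; rewrite (Hm x (sE _ xE)).2.
have e1 : \sum_i mu i * w' 0 i = bary lam l.
  rewrite -Hmu; apply: eq_bigr => i _.
  case: (boolP (i \in C)) => iC; last by rewrite muC // !mul0r.
  by rewrite (tight C l).
have e2 : bary lam l' = \sum_i lam i * w' 0 i.
  apply: eq_bigr => i _; rewrite /lam; case: ifP => iC; last by rewrite !mul0r.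
  by rewrite (tight C' l').
have e3 : bary lam l' <= \sum_i mu i * w' 0 i.
  rewrite -Hmu; apply: (@bary_le R n V) => [|i iV]; last by have [] := Hl' i iV.
  by split=> // i iV; apply: muC; apply: contraNN iV; apply: subsetP.
have e4 : bary lam l <= \sum_i lam i * w' 0 i.
  by apply: (@bary_le R n V) => // i iV; have [] := Hl i iV.
have E0 : \sum_i lam i * (w' 0 i - ev l i) = 0.
  under eq_bigr do rewrite mulrBr.
  rewrite sumrB -/(bary lam l); apply/eqP; rewrite subr_eq0 eq_le e4 andbT -e2 -e1; exact: e3.
have sub' : C' \subset C.
  apply/subsetP => x xC'; have xV := subsetP sC'V _ xC'; rewrite -(Hl x xV).2 eq_sym -subr_eq0.
  have Hge i : predT i -> 0 <= lam i * (w' 0 i - ev l i).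
    move=> _; case: hl => l0 lV _; case: (boolP (i \in V)) => iV.
      by rewrite mulr_ge0 // subr_ge0; case: (Hl i iV).
    by rewrite lV // mul0r.
  have /eqP := psumr_eq0P Hge E0 (isT : predT x); rewrite {1}/lam xC'.
  by rewrite mulf_eq0 invr_eq0 (negbTE c0).
suff -> : C' = C by [].
have [i [j [k [[iC jC kC] [ij ik jk]]]]] := card_gt2P c3'.
have inC x : x \in C' -> ev l x = ev l' x.
  move=> xC; rewrite (tight C' l') // (tight C l) //; exact: subsetP xC.
apply/setP => x; apply/idP/idP; first exact: subsetP.
move=> xC; rewrite -(Hl' x (subsetP sCV _ xC)).2.
rewrite -(ev_eq3 gp ij ik jk (inC _ iC) (inC _ jC) (inC _ kC)).
by rewrite (tight C l).
Qed.

(** The secondary cone is open in its span: every old cell survives, and [cells_sub_eq] excludes new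
    ones. *)
Lemma cells_perturb V w eta : (2 < #|V|)%N -> eta \in cone_span (cells V w) ->
  ev_small (fun e => cells V (w + e *: eta) = cells V w).
Proof.
move=> V3 /(cone_span_aff gp) H.
have {}H C : C \in cells V w -> aff_on eta C.
  by apply: H => D /cellsP[].
have : ev_small (fun e => forall C, C \in cells V w -> iscell V (w + e *: eta) C).
  apply: ev_small_forall => C; case: (boolP (C \in _)) => CT; last by exists 1.
  apply: ev_small_imp (iscell_perturb ((elimT (cellsP _ _ _ _ _) CT)) (H _ CT)) => e _ //.
apply: ev_small_imp => e _ He; symmetry; apply: cells_sub_eq => //.
by apply/subsetP => C /He ?; apply/cellsP.
Qed.

Lemma mem_cone_span_cells V w : w \in cone_span (cells V w).
Proof. by apply/(cone_span_aff gp) => C /cellsP => [[]|/iscell_aff]. Qed.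

End Covering.

(** * Regular subdivisions and secondary cones of a configuration *)

Section AffineDim.
Variables (K : fieldType) (E : vectType K).
Implicit Type (S : set E).

Lemma affine_dim_le S (U : {vspace E}) :
  (forall x y, S x -> S (x + y) -> y \in U) -> (affine_dim S <= \dim U)%N.
Proof.
move=> H; apply/bigmax_leqP => k /asboolP[x0 [X [Sx0 fX SX]]].
have /eqP <- : \dim <<X>> == k by move: fX; rewrite /free size_tuple.
by apply/dimvS/span_subvP => x /SX; apply: H.
Qed.

Lemma affine_dim_ge S k x0 (X : k.-tuple E) :
  S x0 -> free X -> (forall x, x \in X -> S (x0 + x)) -> (k <= affine_dim S)%N.
Proof.
move=> Sx0 fX SX; have kd : (k < (\dim {:E}).+1)%N.
  have /eqP <- : \dim <<X>> == k by move: fX; rewrite /free size_tuple.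
  by rewrite ltnS dimvS // subvf.
apply: (@leq_bigmax_cond _ _ _ (Ordinal kd)) => /=.
by apply/asboolP; exists x0, X.
Qed.

End AffineDim.

Lemma ord2P (a : 'I_2) : a = 0 \/ a = 1.
Proof. by case: a => -[|[|//]] ha; [left|right]; apply: val_inj. Qed.

Section Configurations.
Variables (R : realType) (n : nat) (P : 'I_n -> 'rV[R]_2) (s : R).
Implicit Types (i j k : 'I_n) (C V : {set 'I_n}) (w : 'rV[R]_n) (l : R * R * R).

Definition px i := P i 0 0.
(** The shear will make all ordinates distinct. Affine functions remain affine, so cells do not
    depend on it. *)
Definition py i := P i 0 1 + s * P i 0 0.

Local Notation ev := (ev px py).
Local Notation cells := (cells px py).

Definition aff_val l (x : 'rV[R]_2) : R := l.1.1 * x 0 0 + l.1.2 * (x 0 1 + s * x 0 0) + l.2.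

Lemma ev_val l i : ev l i = aff_val l (P i).
Proof. by []. Qed.

Lemma val_sum l (Q : pred 'I_n) (lam : 'I_n -> R) : \sum_(i | Q i) lam i = 1 ->
  aff_val l (\sum_(i | Q i) lam i *: P i) = \sum_(i | Q i) lam i * ev l i.
Proof.
move=> l1; rewrite /aff_val !summxE -[X in _ + X]mulr1 -l1 !mulr_sumr -!big_split /= !mulr_sumr.
rewrite -!big_split /=; apply: eq_bigr => i _; rewrite !mxE /ev /px /py; ring.
Qed.

Lemma gen_pos_config : general_position P -> gen_pos px py.
Proof.
move=> [Pinj Hnc] i j k ij ik jk; apply/eqP => d0.
apply: (Hnc i j k ij ik jk); exists (P i), (P j - P i); split.
  by rewrite subr_eq0 (inj_eq Pinj) eq_sym.
have nz : P j - P i != 0 by rewrite subr_eq0 (inj_eq Pinj) eq_sym.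
have d1 : (P j 0 0 - P i 0 0) * (P k 0 1 - P i 0 1)
        = (P k 0 0 - P i 0 0) * (P j 0 1 - P i 0 1).
  move: d0; rewrite /det3 /px /py => d0; apply/eqP; rewrite -subr_eq0 -d0; apply/eqP; ring.
move=> q; rewrite !inE => /or3P[] /eqP->.
- by exists 0; rewrite scale0r addr0.
- by exists 1; rewrite scale1r addrC subrK.
have [x0|x0] := eqVneq (P j 0 0 - P i 0 0) 0.
  have y0 : P j 0 1 - P i 0 1 != 0.
    apply: contra_neq nz => y0; apply/rowP => a; rewrite !mxE.
    by case: (ord2P a) => ->.
  exists ((P k 0 1 - P i 0 1) / (P j 0 1 - P i 0 1)); apply/rowP => a; rewrite !mxE.
  case: (ord2P a) => ->; last by rewrite divfK // addrC subrK.
  move: d1; rewrite x0 mul0r => /esym/eqP; rewrite mulf_eq0 (negbTE y0) orbF subr_eq0.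
  by rewrite mulr0 addr0 => /eqP.
exists ((P k 0 0 - P i 0 0) / (P j 0 0 - P i 0 0)); apply/rowP => a; rewrite !mxE.
case: (ord2P a) => ->; first by rewrite divfK // addrC subrK.
by rewrite mulrAC -d1 mulrAC divff // mul1r addrC subrK.
Qed.

Hypothesis gp : gen_pos px py.
Hypothesis n3 : (2 < n)%N.

Lemma setT3 : (2 < #|[set: 'I_n]%SET|)%N. Proof. by rewrite cardsT card_ord. Qed.

(** The projection f lets the lemma serve both the points and their lifts. *)
Lemma free_diff (d : nat) (Q : 'I_n -> 'rV[R]_d) (f : 'rV[R]_d -> 'rV[R]_2) i j k :
  linear f -> (forall m, f (Q m) = P m) -> i != j -> i != k -> j != k ->
  free [:: Q j - Q i; Q k - Q i].
Proof.
move=> fl fQ ij ik jk; have d0 := gp ij ik jk.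
have f0 : f 0 = 0 by have := fl (-1) 0 0; rewrite scaler0 addr0 scaleN1r addrC subrr.
have fZ a u : f (a *: u) = a *: f u by have := fl a u 0; rewrite f0 !addr0.
have fD u v : f (u + v) = f u + f v by have := fl 1 u v; rewrite !scale1r.
have fB u v : f (u - v) = f u - f v by rewrite fD -scaleN1r fZ scaleN1r.
apply/(@freeP _ _ 2 [tuple Q j - Q i; Q k - Q i]) => c.
rewrite !big_ord_recl big_ord0 addr0 /= => H.
have := congr1 f H; rewrite f0 fD !fZ !fB !fQ => E.
have e0 := congr1 (fun u : 'rV_2 => u 0 0) E; have e1 := congr1 (fun u : 'rV_2 => u 0 1) E.
move: e0 e1; rewrite !mxE; set c0 := c ord0; set c1 := c _ => e0 e1.
have c00 : c0 * det3 px py i j k = 0.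
  have -> : c0 * det3 px py i j k =
   (c0 * (P j 0 0 - P i 0 0) + c1 * (P k 0 0 - P i 0 0)) * (P k 0 1 - P i 0 1)
   - (c0 * (P j 0 1 - P i 0 1) + c1 * (P k 0 1 - P i 0 1)) * (P k 0 0 - P i 0 0).
    rewrite /det3 /px /py; ring.
  by rewrite e0 e1 !mul0r subrr.
have c10 : c1 * det3 px py i j k = 0.
  have -> : c1 * det3 px py i j k =
   (c0 * (P j 0 1 - P i 0 1) + c1 * (P k 0 1 - P i 0 1)) * (P j 0 0 - P i 0 0)
   - (c0 * (P j 0 0 - P i 0 0) + c1 * (P k 0 0 - P i 0 0)) * (P j 0 1 - P i 0 1).
    rewrite /det3 /px /py; ring.
  by rewrite e0 e1 !mul0r subrr.
move=> a; have : a = ord0 \/ a = lift ord0 ord0.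
  by case: a => -[|[|//]] ha; [left|right]; apply: val_inj.
by move=> [] ->; apply/eqP; [move/eqP: c00 | move/eqP: c10]; rewrite mulf_eq0 (negbTE d0) orbF.
Qed.

Lemma conv_hull_pt (d : nat) (Q : 'I_n -> 'rV[R]_d) C i : i \in C -> conv_hull Q C (Q i).
Proof.
move=> iC; exists (fun j => (j == i)%:R); split=> [j||]; first exact: ler0n.
  by rewrite (bigD1 i) //= eqxx big1 ?addr0 // => j /andP[_ /negbTE->].
by rewrite (bigD1 i) //= eqxx scale1r big1 ?addr0 // => j /andP[_ /negbTE->]; rewrite scale0r.
Qed.

Lemma conv_hull_dim C : (2 < #|C|)%N -> affine_dim (conv_hull P C) = 2%N.
Proof.
move=> /card_gt2P[i [j [k [[iC jC kC] [ij ik jk]]]]].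
apply/eqP; rewrite eqn_leq; apply/andP; split.
  apply: leq_trans (@affine_dim_le _ _ _ fullv _) _; first by move=> *; rewrite memvf.
  by rewrite dimvf /dim /= mul1n.
apply: (@affine_dim_ge _ _ _ 2 (P i) [tuple P j - P i; P k - P i]).
- exact: conv_hull_pt.
- exact: (@free_diff _ P id).
- by move=> x; rewrite !inE => /orP[] /eqP->; rewrite addrC subrK; apply: conv_hull_pt.
Qed.

Lemma val_conv_le w C C' l x : supports px py [set: 'I_n] w C l -> conv_hull P C' x ->
  exists lam, [/\ forall i, 0 <= lam i, \sum_(i in C') lam i = 1,
    x = \sum_(i in C') lam i *: P i &
    aff_val l x <= \sum_(i in C') lam i * w 0 i ?= iff [forall (i | i \in C'), (i \in C) || (lam i == 0)]].
Proof.
move=> Hl [lam [lam0 lam1 ->]]; exists lam; split=> //; rewrite val_sum //.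
apply: leif_sum => i _; have [h1 h2] : ev l i <= w 0 i ?= iff (i \in C) by apply: Hl; rewrite inE.
rewrite /Order.leif ler_wpM2l //; split=> //.
have [->|l0] := eqVneq (lam i) 0; first by rewrite !mul0r eqxx orbT.
by rewrite (inj_eq (mulfI l0)) h2 orbF.
Qed.

Lemma cells_subdivision w : is_subdivision P (cells [set: 'I_n]%SET w).
Proof.
split.
- by move=> C /cellsP[_ c3 _]; apply: conv_hull_dim.
- apply/seteqP; split => x /=.
    move=> [C _ [lam [lam0 lam1 ->]]].
    exists (fun i => if i \in C then lam i else 0); split.
    + by move=> i; case: ifP.
    + by rewrite -lam1 [RHS]big_mkcond /=; apply: eq_bigl => i; rewrite inE.
    + rewrite [LHS]big_mkcond /=; apply: eq_big => i; first by rewrite inE.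
      by case: ifP => // _; rewrite scale0r.
  move=> [lam [lam0]]; rewrite (eq_bigl predT) => [lam1|i]; last by rewrite inE.
  rewrite (eq_bigl predT) => [->|i]; last by rewrite inE.
  have hl : in_hull [set: 'I_n]%SET lam by split=> // i; rewrite inE.
  have [C Cc [mu [mu0 muC mu1] Hmu]] := covering gp w setT3 hl.
  exists C; first exact/cellsP.
  have mE : \sum_(i in C) mu i = 1.
    by rewrite -mu1 [LHS]big_mkcond; apply: eq_bigr => i _; case: ifPn => // /muC.
  exists mu; split=> //; have vE l : aff_val l (\sum_i lam i *: P i) = aff_val l (\sum_(i in C) mu i *: P i).
    rewrite !val_sum //.
    have := Hmu l; rewrite /bary => <-; rewrite [RHS]big_mkcond.
    by apply: eq_bigr => i _; case: ifPn => // /muC ->; rewrite mul0r.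
  have e0 := vE (1, 0, 0); have e1 := vE (0, 1, 0); move: e0 e1; rewrite /aff_val /=.
  rewrite !mul1r !mul0r !addr0 !add0r => e0; rewrite e0 => /addIr e1.
  by apply/rowP => a; case: (ord2P a) => ->.
move=> C C' /cellsP[_ _ [l Hl]] /cellsP[_ _ [l' Hl']] F.
have eqv x : conv_hull P C x -> conv_hull P C' x -> aff_val l x = aff_val l' x.
  have key D D' m m' : supports px py [set: 'I_n]%SET w D m ->
      supports px py [set: 'I_n]%SET w D' m' -> conv_hull P D x -> aff_val m' x <= aff_val m x.
    move=> Hm Hm' xD; have [lam [lam0 lam1 xE [h' _]]] := val_conv_le Hm' xD.
    apply: le_trans h' _; rewrite xE val_sum //; apply: ler_sum => i iD.
    have /eqP -> // : ev m i == w 0 i by rewrite (Hm i (finset.in_setT i)).2.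
  by move=> xC xC'; apply/eqP; rewrite eq_le (key C' C l' l) // (key C C' l l').
(* On the hull of D the function m' lies below m, with equality exactly on the hull of D'. The
   functional u is the linear part of m' - m in the coordinates before the shear. *)
have face D D' m m' : supports px py [set: 'I_n]%SET w D m ->
    supports px py [set: 'I_n]%SET w D' m' ->
    (forall x, conv_hull P D x -> conv_hull P D' x -> aff_val m x = aff_val m' x) ->
    is_face (conv_hull P D) (conv_hull P D `&` conv_hull P D')%classic.
  move=> Hm Hm' mm.
  pose u : 'cV[R]_2 := \col_a (if a == 0 then (m'.1.1 - m.1.1) + s * (m'.1.2 - m.1.2)
                                else m'.1.2 - m.1.2).
  have uE x : (x *m u) 0 0 = aff_val m' x - aff_val m x - (m'.2 - m.2).
    rewrite mxE big_ord_recl big_ord_recl big_ord0 !mxE /= /aff_val.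
    have -> : lift ord0 ord0 = 1 :> 'I_2 by apply: val_inj.
    ring.
  have tm i : i \in D -> ev m i = w 0 i.
    by move=> iD; apply/eqP; rewrite (Hm i (finset.in_setT i)).2.
  have mle x : conv_hull P D x -> aff_val m' x <= aff_val m x.
    move=> xD; have [lam [lam0 lam1 xE [h' _]]] := val_conv_le Hm' xD.
    by apply: le_trans h' _; rewrite xE val_sum //; apply: ler_sum => i iD; rewrite tm.
  exists u, (- (m'.2 - m.2)); split.
    by move=> x xD; rewrite uE gerDr subr_le0 mle.
  apply/seteqP; split => x /=; move=> [xD].
    by move=> xD'; split=> //; rewrite uE mm // subrr add0r.
  rewrite uE => E; split=> //; have {}E : aff_val m' x = aff_val m x by lra.
  have [lam [lam0 lam1 xE [_ h']]] := val_conv_le Hm' xD.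
  have : aff_val m' x == \sum_(i in D) lam i * w 0 i.
    by rewrite E {1}xE val_sum //; apply/eqP; apply: eq_bigr => i iD; rewrite tm.
  rewrite h' => /forall_inP H.
  have l0 i : i \in D -> i \notin D' -> lam i = 0.
    by move=> iD iD'; have := H i iD; rewrite (negbTE iD') => /eqP.
  have sumE (Z : lmodType R) (f : 'I_n -> Z) : \sum_(i in D') (if i \in D then lam i else 0) *: f i
      = \sum_(i in D) lam i *: f i.
    rewrite [LHS]big_mkcond [RHS]big_mkcond; apply: eq_bigr => i _.
    case: (boolP (i \in D')) => iD'; case: (boolP (i \in D)) => iD //; first by rewrite scale0r.
    by rewrite l0 // scale0r.
  exists (fun i => if i \in D then lam i else 0); split.
  - by move=> i; case: ifP.
  - have := sumE R^o (fun=> 1); rewrite /GRing.scale /=.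
    by under eq_bigr do rewrite mulr1; under [in RHS]eq_bigr do rewrite mulr1; rewrite lam1.
  - by rewrite sumE.
split.
- exact: face Hl Hl' eqv.
- by rewrite /F classical_sets.setIC; apply: face Hl' Hl _ => x *; rewrite eqv.
move=> i [iC iC']; rewrite -(Hl i (finset.in_setT i)).2 -(Hl' i (finset.in_setT i)).2.
by rewrite !ev_val eqv.
Qed.

End Configurations.

Definition regular_cells (R : realFieldType) (n : nat) (X Y : 'I_n -> R) (V : {set 'I_n})
    (k : nat) : {set {set {set 'I_n}}} :=
  [set T | `[< exists w, cells X Y V w = T >] && (codim_span X Y T == k)].

(** * Lower facets of the lifted configuration, and dimensions of secondary cones *)

Section RegularSubdivisions.
Variables (R : realType) (n : nat) (P : 'I_n -> 'rV[R]_2) (s : R).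
Implicit Types (i j k : 'I_n) (C V : {set 'I_n}) (w : 'rV[R]_n) (l : R * R * R).

Local Notation px := (px P).
Local Notation py := (py P s).
Local Notation ev := (ev px py).
Local Notation cells := (cells px py).

Hypothesis gp : gen_pos px py.
Hypothesis n3 : (2 < n)%N.

Lemma lift_lsub w i : lsubmx (lift_pt P w i) = P i.
Proof. by rewrite /lift_pt row_mxKl. Qed.

Lemma lift_rsub w i : rsubmx (lift_pt P w i) 0 0 = w 0 i.
Proof. by rewrite /lift_pt row_mxKr mxE mulr1n. Qed.

Lemma induced_cells w : induced_subdivision P w = cells [set: 'I_n]%SET w.
Proof.
pose colv l : 'cV[R]_2 := \col_a (if a == 0 then l.1.1 + s * l.1.2 else l.1.2).
have colvE l (x : 'rV[R]_2) : (x *m colv l) 0 0 + l.2 = aff_val s l x.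
  rewrite mxE big_ord_recl big_ord_recl big_ord0 !mxE /= /aff_val.
  have -> : lift ord0 ord0 = 1 :> 'I_2 by apply: val_inj.
  ring.
set K := conv_hull (lift_pt P w) [set: 'I_n]%SET.
have Klift i : K (lift_pt P w i) by apply: conv_hull_pt; rewrite inE.
have hull_ge l C y : supports px py [set: 'I_n]%SET w C l -> K y ->
    exists lam, [/\ forall i, 0 <= lam i, \sum_i lam i = 1, y = \sum_i lam i *: lift_pt P w i
     & aff_val s l (lsubmx y) <= (rsubmx y) 0 0 ?= iff [forall i, (i \in C) || (lam i == 0)]].
  move=> Hl [lam [lam0 lam1 yE]].
  have yP : conv_hull P [set: 'I_n]%SET (lsubmx y).
    exists lam; split=> //; rewrite yE linear_sum /=; apply: eq_bigr => i _.
    by rewrite linearZ /= lift_lsub.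
  have {}lam1 : \sum_i lam i = 1 by rewrite -lam1; apply: eq_bigl => i; rewrite inE.
  have {}yE : y = \sum_i lam i *: lift_pt P w i.
    by rewrite yE; apply: eq_bigl => i; rewrite inE.
  exists lam; split=> //.
  have -> : aff_val s l (lsubmx y) = \sum_i lam i * ev l i.
    rewrite -val_sum // yE linear_sum /=; congr (aff_val _ _ _); apply: eq_bigr => i _.
    by rewrite linearZ /= lift_lsub.
  have -> : (rsubmx y) 0 0 = \sum_i lam i * w 0 i.
    rewrite yE linear_sum /= summxE; apply: eq_bigr => i _.
    by rewrite linearZ /= mxE lift_rsub.
  have -> : [forall i, (i \in C) || (lam i == 0)] = [forall (i | true), (i \in C) || (lam i == 0)].
    by [].
  apply: leif_sum => i _.
  have [h1 h2] : ev l i <= w 0 i ?= iff (i \in C) by apply: Hl; rewrite inE.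
  rewrite /Order.leif ler_wpM2l //; split=> //.
  have [->|l0] := eqVneq (lam i) 0; first by rewrite !mul0r eqxx orbT.
  by rewrite (inj_eq (mulfI l0)) h2 orbF.
apply/setP => C; rewrite inE; apply/asboolP/cellsP => [[F [[a [c [Hh FE dF]]] CE]]|].
  pose l : R * R * R := (a 0 0 - s * a 1 0, a 1 0, c).
  have lE x : (x *m a) 0 0 + c = aff_val s l x.
    rewrite -colvE; congr ((_ *m _) 0 0 + _); apply/colP => b; rewrite !mxE /=.
    by case: (ord2P b) => -> //=; rewrite addrNK.
  have Hl : supports px py [set: 'I_n]%SET w C l.
    move=> i _; have := Hh _ (Klift i); rewrite lift_lsub lift_rsub lE -ev_val => h.
    rewrite /Order.leif; split=> //; rewrite CE inE; apply/eqP/asboolP.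
      by rewrite FE => e; split; [exact: Klift | rewrite lift_lsub lift_rsub lE -ev_val].
    by rewrite FE => -[_]; rewrite lift_lsub lift_rsub lE -ev_val.
  split; [exact/finset.subsetT| |by exists l].
  (* A facet is the hull of its lifted points; at most two of them span dimension at most 1. *)
  rewrite ltnNge; apply/negP => C2.
  have Ftight y : F y -> exists lam, [/\ \sum_(i in C) lam i = 1 &
      y = \sum_(i in C) lam i *: lift_pt P w i].
    rewrite FE => -[Ky]; rewrite lE => E.
    have [lam [lam0 lam1 yE [_ /esym H]]] := hull_ge l C y Hl Ky.
    move: H; rewrite E eqxx => /forallP H.
    have l0 i : i \notin C -> lam i = 0 by have := H i => /orP[->//|/eqP].
    exists lam; split.
      by rewrite -lam1 [LHS]big_mkcond; apply: eq_bigr => i _; case: ifPn => // /l0.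
    rewrite yE [RHS]big_mkcond; apply: eq_bigr => i _; case: ifPn => // /l0 ->.
    by rewrite scale0r.
  have [C0|[b bC]] := set_0Vmem C.
    suff : (affine_dim F <= \dim (0%VS : {vspace 'rV[R]_(2+1)}))%N by rewrite dF dimv0.
    apply: affine_dim_le => x y /Ftight[lam []]; rewrite C0 big_set0 => /esym/eqP.
    by rewrite oner_eq0.
  pose L := [seq lift_pt P w i - lift_pt P w b | i <- enum (C :\ b)].
  have FL y : F y -> y - lift_pt P w b \in <<L>>%VS.
    move=> /Ftight[lam [lam1 ->]].
    rewrite -[X in _ - X]scale1r -lam1 scaler_suml -sumrB; apply: memv_suml => i iC.
    rewrite -scalerBr memvZ //; have [->|ib] := eqVneq i b; first by rewrite subrr mem0v.
    by apply/memv_span/map_f; rewrite mem_enum !inE ib.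
  suff : (affine_dim F <= \dim <<L>>)%N.
    rewrite dF => /leq_trans /(_ (dim_span _)); rewrite size_map -cardE.
    by move: C2; rewrite (cardsD1 b C) bC add1n ltnS => h /(leq_trans) /(_ h).
  apply: affine_dim_le => x y /FL h1 /FL h2.
  by rewrite -[y](addrK x) [y + x]addrC -[x + y](subrK (lift_pt P w b)) -addrA memvD //
     -opprB memvN.
move=> [_ c3 [l Hl]].
pose F := [set y | K y /\ (rsubmx y) 0 0 = ((lsubmx y) *m colv l) 0 0 + l.2]%classic.
exists F; split; last first.
  apply/setP => i; rewrite inE; rewrite -(Hl i (finset.in_setT i)).2; apply/eqP/asboolP => [e|].
    by split=> //; rewrite lift_lsub lift_rsub colvE -ev_val.
  by move=> [_]; rewrite lift_lsub lift_rsub colvE -ev_val.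
exists (colv l), l.2; split=> //.
  by move=> y /(hull_ge l C y Hl)[lam [_ _ _]]; rewrite colvE => -[].
apply/eqP; rewrite eqn_leq; apply/andP; split.
  (* These two vectors span the direction of the supporting plane. *)
  pose e (a : 'I_2) : 'rV[R]_(2+1) := row_mx (delta_mx 0 a) ((delta_mx 0 a *m colv l)).
  pose L := [:: e 0; e 1]; pose U := <<L>>%VS.
  apply: (@leq_trans (\dim U)); last exact: dim_span.
  apply: affine_dim_le => x y [_ hx] [_ hy].
  have hr : rsubmx y = lsubmx y *m colv l.
    apply/matrixP => a b; rewrite !ord1.
    have : rsubmx (x + y) 0 0 = rsubmx x 0 0 + rsubmx y 0 0 by rewrite raddfD mxE.
    have : (lsubmx (x + y) *m colv l) 0 0 = (lsubmx x *m colv l) 0 0 + (lsubmx y *m colv l) 0 0.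
      by rewrite raddfD /= mulmxDl [LHS]mxE.
    move: hx hy => -> -> -> h.
    by apply: (@addrI _ ((lsubmx x *m colv l) 0 0 + l.2)); rewrite -h addrAC.
  have -> : y = lsubmx y 0 0 *: e 0 + lsubmx y 0 1 *: e 1.
    rewrite -[LHS]hsubmxK hr /e !scale_row_mx add_row_mx !scalemxAl -mulmxDl.
    have <- : lsubmx y = lsubmx y 0 0 *: delta_mx 0 0 + lsubmx y 0 1 *: delta_mx 0 1.
      by apply/rowP => a; rewrite !mxE; case: (ord2P a) => -> /=; rewrite ?mulr1 ?mulr0 ?addr0 ?add0r.
    by [].
  by rewrite memvD // memvZ // memv_span // !inE eqxx ?orbT.
have [i [j [k [[iC jC kC] [ij ik jk]]]]] := card_gt2P c3.
have FC m : m \in C -> F (lift_pt P w m).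
  move=> mC; split=> //; rewrite lift_lsub lift_rsub colvE -ev_val; apply/esym/eqP.
  by rewrite (Hl m (finset.in_setT m)).2.
apply: (@affine_dim_ge _ _ _ 2 (lift_pt P w i)
  [tuple lift_pt P w j - lift_pt P w i; lift_pt P w k - lift_pt P w i]).
- exact: FC.
- apply: (@free_diff _ _ _ _ gp _ _ lsubmx) => //; first exact: linearP.
  by move=> m; rewrite lift_lsub.
- by move=> x; rewrite !inE => /orP[] /eqP->; rewrite addrC subrK; apply: FC.
Qed.

(** The cone lies in its span; conversely a basis of the span, scaled by a small e and translated to
    w, stays in the cone by [cells_perturb]. *)
Lemma secondary_cone_dim w :
  affine_dim (secondary_cone P (cells [set: 'I_n]%SET w)) =
  \dim (cone_span px py (cells [set: 'I_n]%SET w)).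
Proof.
set T := cells _ w; have V3 : (2 < #|[set: 'I_n]%SET|)%N by rewrite cardsT card_ord.
have scE w' : secondary_cone P T w' <-> cells [set: 'I_n]%SET w' = T.
  by rewrite /secondary_cone /= induced_cells.
apply/eqP; rewrite eqn_leq; apply/andP; split.
  apply: affine_dim_le => x y /scE h1 /scE h2.
  have inT u : cells [set: 'I_n]%SET u = T -> u \in cone_span px py T.
    by move=> <-; apply: mem_cone_span_cells.
  by rewrite -[y](addrK x) [y + x]addrC memvB // inT.
pose B := vbasis (cone_span px py T).
have : ev_small (fun e => forall u, u \in (B : seq _) -> cells [set: 'I_n]%SET (w + e *: u) = T).
  by apply: ev_small_seq => u uB; apply: cells_perturb => //; apply: vbasis_mem.
case/ev_small_ex => e egt He.
apply: (@affine_dim_ge _ _ _ _ w [tuple of map ( *:%R e) B]).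
- exact/scE.
- have /andP[_ /freeP fB] := vbasisP (cone_span px py T).
  apply/freeP => c Hc i; have := fB (fun a => c a * e).
  have E : \sum_(a < \dim (cone_span px py T)) (c a * e) *: B`_a = 0.
    rewrite -[RHS]Hc; apply: eq_bigr => a _.
    by rewrite (nth_map 0) ?size_tuple // scalerA.
  by move=> /(_ E i) /eqP; rewrite mulf_eq0 (gt_eqF egt) orbF => /eqP.
- by move=> x /mapP[u uB ->]; apply/scE/He.
Qed.

Lemma num_regular_cells (k : nat) :
  num_regular_subdivisions P k = #|regular_cells px py [set: 'I_n]%SET k|.
Proof.
apply: eq_card => T; rewrite !inE.
apply/asboolP/andP => [[[_ [w]]]|[/asboolP[w <-] /eqP <-]].
  rewrite induced_cells => <-; rewrite /subdivision_dim secondary_cone_dim => <-.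
  by split=> //; apply/asboolP; exists w.
rewrite /subdivision_dim secondary_cone_dim; split=> //; split; last first.
  by exists w; apply: induced_cells.
exact: cells_subdivision.
Qed.

End RegularSubdivisions.

(** * Subdivisions of a chain of blocks *)

Section Families.
Variables (R : realFieldType) (n : nat) (X Y : 'I_n -> R).
Implicit Types (i j k : 'I_n) (l g : R * R * R) (V B C D : {set 'I_n}) (w : 'rV[R]_n).
Implicit Types (T U : {set {set 'I_n}}) (Bs : seq {set 'I_n}).

Local Notation ev := (ev X Y).
Local Notation cells := (cells X Y).
Local Notation aff_on := (aff_on X Y).
Local Notation cone_span := (cone_span X Y).
Local Notation codim_span := (codim_span X Y).
Local Notation regular_cells := (regular_cells X Y).

Hypothesis gp : gen_pos X Y.

Lemma dim_cone_span T : (\dim (cone_span T) <= n)%N.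
Proof. by apply: leq_trans (dimvS (subvf _)) _; rewrite dimvf /dim /= mul1n. Qed.

(** As B and D share at most one point, any height vector is the sum of one constant on B and one
    vanishing on D. The two spans are therefore transversal. *)
Lemma codim_spanU T U B D : (forall C, C \in T -> C \subset B) ->
  (forall C, C \in U -> C \subset D) -> (forall C, C \in T -> 2 < #|C|)%N ->
  (forall C, C \in U -> 2 < #|C|)%N -> (#|B :&: D| <= 1)%N ->
  codim_span (T :|: U) = (codim_span T + codim_span U)%N.
Proof.
move=> TB UD T3 U3 BD.
have full : (cone_span T + cone_span U)%VS = fullv.
  apply/vspaceP => w; rewrite memvf; apply/memv_addP.
  have [c Hc] : exists c, forall i, i \in B -> i \in D -> w 0 i = c.
    have [BD0|[z zBD]] := set_0Vmem (B :&: D).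
      by exists 0 => i iB iD; move/setP: BD0 => /(_ i); rewrite !inE iB iD.
    exists (w 0 z) => i iB iD; congr (w 0 _); apply/eqP; apply: contraT => iz.
    move: BD; rewrite (cardsD1 z) zBD (cardsD1 i) !inE iz iB iD; lia.
  pose w2 : 'rV[R]_n := \row_i (if i \in D then w 0 i else c).
  exists w2.
    apply/(cone_span_aff gp _ T3) => C CT; exists (0, 0, c) => i iC.
    rewrite /ev /= !mul0r !add0r mxE; case: ifP => // iD.
    by apply: Hc => //; apply: (subsetP (TB _ CT)).
  exists (w - w2); last by rewrite addrC subrK.
  apply/(cone_span_aff gp _ U3) => C CU; exists (0, 0, 0) => i iC.
  by rewrite /ev /= !mul0r !add0r !mxE (subsetP (UD _ CU)) // subrr.
have := dimv_sum_cap (cone_span T) (cone_span U); rewrite full dimvf /dim /= mul1n.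
rewrite /codim_span cone_spanU; have := dim_cone_span T; have := dim_cone_span U.
by move: (\dim (cone_span T :&: _)) (\dim (cone_span T)) (\dim (cone_span U)); lia.
Qed.

Definition ublocks Bs := [set i | has (fun D : {set 'I_n} => i \in D) Bs].

Lemma ublocksP Bs i : reflect (exists2 D, D \in Bs & i \in D) (i \in ublocks Bs).
Proof. by rewrite inE; apply: hasP. Qed.

Fixpoint chain_blocks Bs : bool :=
  if Bs is B :: Bs' then (#|B :&: ublocks Bs'| <= 1)%N && chain_blocks Bs' else true.

(** One regular subdivision for each block, all merged into U; the one of B is recovered as the set
    of members of U inside B. *)
Definition block_family Bs U : Prop :=
  (forall C, C \in U -> exists2 B, B \in Bs & C \subset B) /\
  (forall B, B \in Bs -> exists w, cells B w = [set C in U | C \subset B]).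

Lemma block_family3 Bs U : block_family Bs U -> forall C, C \in U -> (2 < #|C|)%N.
Proof.
move=> [h1 h2] C CU; have [B BBs CB] := h1 C CU; have [w E] := h2 B BBs.
have : C \in cells B w by rewrite E inE CU.
by case/cellsP.
Qed.

Lemma chain_blocks_cap B Bs D : chain_blocks (B :: Bs) -> D \in Bs -> (#|B :&: D| <= 1)%N.
Proof.
move=> /andP[h _] DBs; apply: leq_trans h; apply/subset_leq_card/setIS.
by apply/subsetP => i iD; apply/ublocksP; exists D.
Qed.

Lemma block_family_cons B Bs T U w : chain_blocks (B :: Bs) -> cells B w = T ->
  block_family Bs U -> block_family (B :: Bs) (T :|: U) /\ T = [set C in T :|: U | C \subset B].
Proof.
move=> ch wT fU; have [h1 h2] := fU.
have T3 C : C \in T -> (2 < #|C|)%N by rewrite -wT => /cellsP[].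
have TB C : C \in T -> C \subset B by rewrite -wT => /cellsP[].
have U3 := block_family3 fU.
have small C D : (2 < #|C|)%N -> C \subset B -> D \in Bs -> ~~ (C \subset D).
  move=> c3 CB DBs; apply/negP => CD; have := chain_blocks_cap ch DBs.
  rewrite leqNgt => /negP; apply; apply: leq_trans (ltnW c3) _.
    by apply: subset_leq_card; rewrite subsetI CB CD.
have TE : T = [set C in T :|: U | C \subset B].
  apply/setP => C; rewrite !inE; case: (boolP (C \in T)) => [CT|_] /=; first by rewrite TB.
  apply/esym/negbTE/negP => /andP[CU CB]; have [D DBs CD] := h1 C CU.
  by have /negP := small _ _ (U3 _ CU) CB DBs.
split=> //; split.
  move=> C; rewrite inE => /orP[/TB CB|/h1[D DBs CD]]; first by exists B; rewrite ?mem_head.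
  by exists D => //; rewrite inE DBs orbT.
move=> D; rewrite inE => /predU1P[->|DBs]; first by exists w; rewrite wT.
have [w' E] := h2 D DBs; exists w'; rewrite E; apply/setP => C; rewrite !inE.
case: (boolP (C \in T)) => //= CT; have := small _ _ (T3 _ CT) (TB _ CT) DBs.
by move/negbTE->; rewrite andbF.
Qed.

Definition family_set Bs m : {set {set {set 'I_n}}} :=
  [set U | `[< block_family Bs U >] && (codim_span U == m)].

Lemma codim_span0 : codim_span set0 = 0%N.
Proof. by rewrite /codim_span cone_span0 dimvf /dim /= mul1n subnn. Qed.

(** Cells have at least three points and distinct blocks share at most one, so a family determines
    its part in each block; codimensions add by [codim_spanU]. *)
Lemma card_family_set Bs : chain_blocks Bs ->
  (forall B, B \in Bs -> forall m, (((dpoly nat (#|B| - 2))`_m)%R <= #|regular_cells B m|)%N) ->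
  forall m, (((\prod_(B <- Bs) dpoly nat (#|B| - 2))`_m)%R <= #|family_set Bs m|)%N.
Proof.
elim: Bs => [|B Bs IH] ch H m.
  rewrite big_nil coef1; case: eqP => // ->; apply/card_gt0P; exists set0.
  rewrite inE codim_span0 eqxx andbT; apply/asboolP; split=> C; rewrite ?inE //.
have chB : chain_blocks Bs by case/andP: ch.
have {}IH := IH chB (fun D DBs => H D (mem_behead (s := B :: Bs) DBs)).
pose S := [set x : {set {set 'I_n}} * {set {set 'I_n}} |
  [&& `[< exists w, cells B w = x.1 >], `[< block_family Bs x.2 >]
    & (codim_span x.1 + codim_span x.2 == m)%N]].
apply: (@leq_trans #|S|); last first.
  rewrite -(card_in_imset (f := fun x => x.1 :|: x.2) (D := mem S)).
    apply/subset_leq_card/subsetP => U' /imsetP[[T U]]; rewrite inE /=.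
    move=> /and3P[/asboolP[w wT] /asboolP fU /eqP E] ->.
    have [f' _] := block_family_cons ch wT fU.
    rewrite inE; apply/andP; split; first exact/asboolP.
    have U3 := block_family3 fU; case: (fU) => h1 _.
    rewrite (@codim_spanU _ _ B (ublocks Bs)) ?E //.
    - by move=> C; rewrite -wT => /cellsP[].
    - move=> C /h1[D DBs CD]; apply: subset_trans CD _.
      by apply/subsetP => i iD; apply/ublocksP; exists D.
    - by move=> C; rewrite -wT => /cellsP[].
    - by case/andP: ch.
  move=> [T U] [T' U']; rewrite !inE /=.
  move=> /and3P[/asboolP[w wT] /asboolP fU _] /and3P[/asboolP[w' wT'] /asboolP fU' _] E.
  have [_ TE] := block_family_cons ch wT fU; have [_ TE'] := block_family_cons ch wT' fU'.
  have TT : T = T' by rewrite TE E -TE'.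
  rewrite -TT in E wT' TE'; rewrite TT; congr (_, _).
  have disj W : block_family Bs W -> T = [set C in T :|: W | C \subset B] -> W = (T :|: W) :\: T.
    move=> fW TW; apply/setP => C; rewrite !inE; case: (boolP (C \in T)) => //= CT.
    apply/negP => CW; have [D DBs CD] := fW.1 C CW.
    have : C \in cells B w by rewrite wT.
    case/cellsP => CB c3 _; have := chain_blocks_cap ch DBs; rewrite leqNgt => /negP; apply.
    apply: leq_trans (ltnW c3) _.
    by apply: subset_leq_card; rewrite subsetI CB CD.
  by rewrite (disj U fU TE) (disj U' fU' TE') E.
rewrite big_cons coefM.
rewrite -[X in (_ <= X)%N]sum1_card (partition_big (fun x => inord (codim_span x.1) : 'I_m.+1) predT) //=.
apply: leq_sum => a _.
have [am _] := (ltn_ord a, isT).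
apply: (@leq_trans (#|regular_cells B a| * #|family_set Bs (m - a)|)%N).
  by apply: leq_mul; [apply: H; rewrite mem_head | apply: IH].
rewrite -cardsX sum1_card; apply/subset_leq_card/subsetP => -[T U].
rewrite !inE /= => /andP[/andP[h1 /eqP h2] /andP[h3 /eqP h4]].
have hS : (T, U) \in S.
  by rewrite /S in_set; apply/and3P; split; rewrite //= h2 h4 subnKC // -ltnS.
by apply/andP; split=> //=; rewrite h2 inord_val.
Qed.

(** A constant shift on each block makes its heights agree with those of the later blocks at the
    common point, if any. *)
Lemma glue_heights Bs (th : {set 'I_n} -> 'rV[R]_n) : chain_blocks Bs ->
  exists w, forall B, B \in Bs -> aff_on (w - th B) B.
Proof.
elim: Bs => [|B Bs IH] ch; first by exists 0.
have [w Hw] : exists w, forall D, D \in Bs -> aff_on (w - th D) D by apply: IH; case/andP: ch.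
have [c Hc] : exists c, forall i, i \in B -> i \in ublocks Bs -> w 0 i - th B 0 i = c.
  have := ch => /= /andP[h _]; have [B0|[z zB]] := set_0Vmem (B :&: ublocks Bs).
    by exists 0 => i iB iD; move/setP: B0 => /(_ i); rewrite in_setI iB iD inE.
  exists (w 0 z - th B 0 z) => i iB iD; have -> // : i = z.
  apply/eqP; apply: contraT => iz.
  move: h; rewrite (cardsD1 z) zB (cardsD1 i) in_setD1 in_setI iB iD iz; lia.
exists (\row_i (if i \in B then th B 0 i + c else w 0 i)) => D.
rewrite inE => /predU1P[->|DBs].
  exists (0, 0, c) => i iB; rewrite !mxE iB /ev /= !mul0r !add0r addrAC subrr add0r.
  by [].
have [l Hl] := Hw D DBs; exists l => i iD; rewrite -Hl // !mxE; case: ifP => // iB.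
congr (_ - _); rewrite -(Hc i iB); first by rewrite addrC subrK.
by apply/ublocksP; exists D.
Qed.

End Families.

(** * Piecewise linear interpolation on a grid *)

Lemma prev_true (Q : pred nat) k : Q 0%N -> (0 < k)%N ->
  exists s, [/\ (s < k)%N, Q s & forall i, (s < i < k)%N -> ~~ Q i].
Proof.
move=> Q0; elim: k => // k IH _; case: (boolP (Q k)) => Qk.
  by exists k; split=> // i; lia.
have k0 : (0 < k)%N by case: k Qk {IH} => //; rewrite Q0.
have [s [sk Qs H]] := IH k0; exists s; split=> //; first exact: ltnW.
move=> i hi; have [->//|ik] := eqVneq i k; apply: H; move/eqP: ik; lia.
Qed.

Lemma next_true (Q : pred nat) M k : Q M -> (k < M)%N ->
  exists s, [/\ (k < s <= M)%N, Q s & forall i, (k < i < s)%N -> ~~ Q i].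
Proof.
move=> QM kM; have := @prev_true (fun i => Q (M - i)%N) (M - k)%N.
rewrite subn0 => /(_ QM); rewrite subn_gt0 => /(_ kM)[s [sk Qs H]].
exists (M - s)%N; split=> //; first by lia.
by move=> i hi; have := H (M - i)%N; rewrite subKn; [apply; lia | lia].
Qed.

Section Grid.
Variables (R : realFieldType) (x : nat -> R) (m : nat).
Hypothesis x_incr : forall i j, (i < j)%N -> (j <= m.+1)%N -> x i < x j.
Implicit Types (f g h : nat -> R) (v : pred nat).

Definition slope f i := (f i.+1 - f i) / (x i.+1 - x i).

(* Second differences: [bend f i] sits at the grid point [i.+1]. *)
Definition bend f i := slope f i.+1 - slope f i.

Definition line (a b : R) : nat -> R := fun j => a * x j + b.

Lemma gap_gt0 i : (i <= m)%N -> 0 < x i.+1 - x i.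
Proof. by move=> im; rewrite subr_gt0 x_incr. Qed.

Lemma slopeD f g c i : slope (fun j => f j + c * g j) i = slope f i + c * slope g i.
Proof. by rewrite /slope; ring. Qed.

Lemma bendD f g c i : bend (fun j => f j + c * g j) i = bend f i + c * bend g i.
Proof. by rewrite /bend !slopeD; ring. Qed.

Lemma bend_ext f g i : (f i = g i) -> f i.+1 = g i.+1 -> f i.+2 = g i.+2 -> bend f i = bend g i.
Proof. by rewrite /bend /slope => -> -> ->. Qed.

Lemma slope_line a b i : (i <= m)%N -> slope (line a b) i = a.
Proof.
move=> im; have := gap_gt0 im => /gt_eqF/negbT h; rewrite /slope /line.
by field.
Qed.

Lemma bend_line a b i : (i < m)%N -> bend (line a b) i = 0.
Proof. by move=> im; rewrite /bend !slope_line ?subrr // ltnW. Qed.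

Lemma slopeK f i : (i <= m)%N -> f i.+1 = f i + slope f i * (x i.+1 - x i).
Proof.
by move=> im; have := gap_gt0 im => /gt_eqF/negbT h; rewrite /slope divfK // addrC subrK.
Qed.

(** The discrete form of integrating f'' f by parts. *)
Lemma energy_identity f s M : (s + M <= m)%N ->
  \sum_(i < M) bend f (s + i) * f (s + i).+1
  + \sum_(i < M.+1) slope f (s + i) ^+ 2 * (x (s + i).+1 - x (s + i)%N)
  = slope f (s + M) * f (s + M).+1 - slope f s * f s.
Proof.
elim: M => [|M IH] hM.
  rewrite big_ord0 big_ord1 addn0 in hM *; rewrite (slopeK f hM); ring.
have IH' := IH (ltnW (leq_trans _ hM)); rewrite addnS ltnS leqnn in IH'.
rewrite big_ord_recr [X in _ + X]big_ord_recr /= addrACA {}IH' // /bend addnS.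
have h : ((s + M).+1 <= m)%N by rewrite -addnS.
rewrite [f (s + M).+2](slopeK f h); ring.
Qed.

(** The products of [bend] with f and the boundary terms vanish, so the energy identity leaves a
    vanishing sum of squared slopes. *)
Lemma grid_uniq f s s' : (s <= s')%N -> (s' <= m.+1)%N -> f s = 0 -> f s' = 0 ->
  (forall i, (s < i.+1 < s')%N -> f i.+1 = 0 \/ bend f i = 0) ->
  forall j, (s <= j <= s')%N -> f j = 0.
Proof.
move=> ss' s'm fs fs' H j /andP[sj js'].
have [E|ne] := eqVneq s s'; first by have -> : j = s by lia.
pose M := (s' - s).-1; have s'E : s' = (s + M).+1 by rewrite /M; lia.
have hM : (s + M <= m)%N by lia.
have := energy_identity f hM; rewrite -s'E fs fs' !mulr0 subrr big1 ?add0r; last first.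
  move=> i _; have iM := ltn_ord i.
  by have [|->|->] := H (s + i)%N; [lia | rewrite mulr0 | rewrite mul0r].
move=> E.
have sl0 i : (i <= M)%N -> slope f (s + i) = 0.
  move=> iM; have Hge (i' : 'I_M.+1) : predT i' ->
      0 <= slope f (s + i') ^+ 2 * (x (s + i').+1 - x (s + i')%N).
    move=> _; rewrite mulr_ge0 ?sqr_ge0 // ltW // gap_gt0 //; have := ltn_ord i'; lia.
  have /eqP := psumr_eq0P Hge E (isT : predT (inord i : 'I_M.+1)); rewrite inordK //.
  rewrite mulf_eq0 sqrf_eq0 [x _ - _ == 0]gt_eqF ?orbF; first by move/eqP.
  by apply: gap_gt0; lia.
have : forall d, (s + d <= s')%N -> f (s + d)%N = 0.
  elim=> [|d IH] hd; first by rewrite addn0.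
  rewrite addnS (slopeK f) ?sl0 ?IH ?mul0r ?addr0 //; lia.
by move=> /(_ (j - s)%N); rewrite subnKC //; apply.
Qed.

Lemma line_through f s s' : (s < s')%N -> (s' <= m.+1)%N ->
  exists a b, f s = line a b s /\ f s' = line a b s'.
Proof.
move=> ss' s'm; have := x_incr ss' s'm; rewrite -subr_gt0 => /gt_eqF/negbT h.
exists ((f s' - f s) / (x s' - x s)), (f s - (f s' - f s) / (x s' - x s) * x s).
by rewrite /line; split; field.
Qed.

Lemma grid_uniq_line f a b s s' : (s <= s')%N -> (s' <= m.+1)%N ->
  f s = line a b s -> f s' = line a b s' ->
  (forall i, (s < i.+1 < s')%N -> f i.+1 = line a b i.+1 \/ bend f i = 0) ->
  forall j, (s <= j <= s')%N -> f j = line a b j.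
Proof.
move=> ss' s'm fs fs' H j hj; apply/eqP; rewrite -subr_eq0 -mulN1r; apply/eqP.
apply: (@grid_uniq (fun j => f j + -1 * line a b j) s s') => //.
- by rewrite fs mulN1r subrr.
- by rewrite fs' mulN1r subrr.
move=> i hi; have [->|E] := H i hi; first by left; rewrite mulN1r subrr.
by right; rewrite bendD E bend_line ?mulr0 ?addr0 //; lia.
Qed.

Lemma flat_line f s s' : (s < s')%N -> (s' <= m.+1)%N ->
  (forall i, (s < i.+1 < s')%N -> bend f i = 0) ->
  exists a b, forall j, (s <= j <= s')%N -> f j = line a b j.
Proof.
move=> ss' s'm H; have [a [b [h1 h2]]] := line_through f ss' s'm; exists a, b.
by apply: grid_uniq_line => //; [exact: ltnW | move=> i /H; right].
Qed.

Definition is_interp v h f :=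
  [/\ f 0%N = h 0%N, f m.+1 = h m.+1 &
      forall i, (i < m)%N -> if v i then f i.+1 = h i.+1 else bend f i = 0].

Lemma exists_interp v h : exists f, is_interp v h f.
Proof.
(* Induction on the right end M with a free value y there: after the last knot s before M the
   solution is a chord. *)
suff H : forall M, (0 < M)%N -> (M <= m.+1)%N -> forall y, exists f, [/\ f 0%N = h 0%N, f M = y &
    forall i, (i.+1 < M)%N -> if v i then f i.+1 = h i.+1 else bend f i = 0].
  have [f [h1 h2 h3]] := H m.+1 isT (leqnn _) (h m.+1); by exists f.
elim/ltn_ind => M IH M0 Mm y.
have [s [sM Qs Hs]] := @prev_true (fun i => (i == 0%N) || v i.-1) M isT M0.
have [f0 [f00 f0s f0P]] : exists f, [/\ f 0%N = h 0%N, f s = h s &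
    forall i, (i.+1 < s)%N -> if v i then f i.+1 = h i.+1 else bend f i = 0].
  have [->|s0] := posnP s; first by exists h.
  by apply: IH => //; lia.
have [a [b [la lb]]] := @line_through (fun j => if (j <= s)%N then h s else y) _ _ sM Mm.
rewrite leqnn in la; rewrite leqNgt sM /= in lb.
exists (fun j => if (j <= s)%N then f0 j else line a b j); split=> //.
  by rewrite leqNgt sM.
move=> i iM; case: (ltngtP i.+1 s) => hi.
- have := f0P i hi; case: (v i) => /= E //.
  by rewrite -E; apply: bend_ext; rewrite ifT //; lia.
- have /negbTE : ~~ ((i.+1 == 0%N) || v i) by have := Hs i.+1; rewrite /= hi iM; apply.
  rewrite /= => ->; rewrite -(@bend_line a b i); last by lia.
  have E j : (s <= j)%N -> (if (j <= s)%N then f0 j else line a b j) = line a b j.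
    move=> sj; case: ifP => // js; have -> : j = s by lia.
    by rewrite f0s la.
  by apply: bend_ext; apply: E; lia.
- by move: Qs; rewrite -hi /= => ->; rewrite hi f0s.
Qed.

(** The difference of f and the line vanishes from s to s', and the strict bends at both ends make
    it grow away from that interval. *)
Lemma convex_support f s s' : (s < s')%N -> (s' <= m.+1)%N ->
  (forall i, (i < m)%N -> 0 <= bend f i) ->
  (forall i, (s < i.+1 < s')%N -> bend f i = 0) ->
  ((0 < s)%N -> 0 < bend f s.-1) -> ((s' <= m)%N -> 0 < bend f s'.-1) ->
  exists a b, forall j, (j <= m.+1)%N -> line a b j <= f j ?= iff (s <= j <= s')%N.
Proof.
move=> ss' s'm cvx flat bs bs'.
have [a [b E]] := flat_line ss' s'm flat; exists a, b => j jm.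
pose e j := f j + -1 * line a b j.
have be i : (i < m)%N -> bend e i = bend f i.
  by move=> im; rewrite bendD bend_line // mulr0 addr0.
have e0 i : (s <= i <= s')%N -> e i = 0 by move=> /E; rewrite /e => ->; rewrite mulN1r subrr.
have se i : (s <= i < s')%N -> slope e i = 0.
  by move=> hi; rewrite /slope !e0 ?subrr ?mul0r //; lia.
have up d : (s' + d <= m)%N -> 0 < slope e (s' + d) /\ 0 < e (s' + d).+1.
  elim: d => [|d IH] hd.
    rewrite addn0 in hd *; have sl : 0 < slope e s'.
      have := bs' hd; rewrite -be; last by lia.
      by rewrite /bend (se s'.-1) ?subr0; [rewrite prednK //; lia | lia].
    split=> //; rewrite (slopeK e hd) (e0 s'); last by lia.
    by rewrite add0r mulr_gt0 // gap_gt0.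
  have [h1 h2] : 0 < slope e (s' + d) /\ 0 < e (s' + d).+1 by apply: IH; lia.
  rewrite addnS in hd *; have sl : 0 < slope e (s' + d).+1.
    have := cvx (s' + d)%N hd; rewrite -be // /bend subr_ge0; exact: lt_le_trans.
  split=> //; rewrite (slopeK e hd); apply: addr_gt0 => //; apply: mulr_gt0 => //.
  exact: gap_gt0.
have down d : (d < s)%N -> slope e (s - d.+1) < 0 /\ 0 < e (s - d.+1)%N.
  elim: d => [|d IH] hd.
    have s0 : (0 < s)%N by lia.
    have hm : (s.-1 <= m)%N by lia.
    have sl : slope e s.-1 < 0.
      have := bs s0; rewrite -be; last by lia.
      by rewrite /bend prednK // (se s) ?sub0r ?oppr_gt0 //; lia.
    rewrite subn1; split=> //; have := slopeK e hm; rewrite prednK // e0; last by lia.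
    have := gap_gt0 hm; rewrite prednK // => g E1.
    by nra.
  have [h1 h2] : slope e (s - d.+1) < 0 /\ 0 < e (s - d.+1)%N by apply: IH; lia.
  have sE : (s - d.+1 = (s - d.+2).+1)%N by lia.
  have hm : (s - d.+2 <= m)%N by lia.
  have sl : slope e (s - d.+2) < 0.
    apply: le_lt_trans h1; rewrite -subr_ge0 sE.
    by rewrite -/(bend e _) be ?cvx //; lia.
  split=> //; move: h2; rewrite sE (slopeK e hm) => h2.
  by have := gap_gt0 hm; nra.
apply/leifP; case: ifP => [/E -> //|h].
rewrite -subr_gt0 -mulN1r -/(e j).
have [js|sj] := ltnP j s.
  have [_] := down (s - j.+1)%N (ltac:(lia)); by have -> : (s - (s - j.+1).+1 = j)%N by lia.
have s'j : (s' < j)%N by move: h; lia.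
have [_] := up (j.-1 - s')%N (ltac:(lia)); by have -> : ((s' + (j.-1 - s')).+1 = j)%N by lia.
Qed.

Definition hinge k : nat -> R := fun j => if (k <= j)%N then x j - x k else 0.

Lemma bend_hinge k i : (k < m)%N -> (i < m)%N -> bend (hinge k.+1) i = (i == k)%:R.
Proof.
move=> km im.
have sl j : (j <= m)%N -> slope (hinge k.+1) j = if (k < j)%N then 1 else 0.
  move=> jm; have := gap_gt0 jm => /gt_eqF/negbT h; rewrite /slope /hinge.
  have [kj|jk] := ltnP k j; first by rewrite ifT ?ltnS 1?ltnW //; field.
  rewrite ltnS; case: leqP => kj; last by rewrite subrr mul0r.
  have -> : k = j by lia.
  by rewrite !(subrr, subr0, mul0r).
rewrite /bend (sl i.+1 im) (sl i (ltnW im)) ltnS; case: (ltngtP i k) => h.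
- by rewrite subrr.
- by rewrite subrr.
- by rewrite subr0.
Qed.

Section Collinear.
Variable h : nat -> R.
Hypothesis h_gen : forall a b i j k, (i < j < k)%N -> (k <= m.+1)%N ->
  h i = line a b i -> h j = line a b j -> h k = line a b k -> False.

Definition out_coord f v i := if v i then 0 < bend f i else f i.+1 < h i.+1.

Lemma interp_at v f k : is_interp v h f -> (k <= m.+1)%N ->
  [|| k == 0%N, k == m.+1 | v k.-1] -> f k = h k.
Proof.
move=> [f0 fm fP] km /or3P[/eqP->//|/eqP->//|vk].
case: k km vk => // k; rewrite ltnS leq_eqVlt => /predU1P[->//|km] vk.
by have := fP k km; rewrite vk.
Qed.

(** Otherwise f would be affine between the knots surrounding the point and equal to h there, which
    puts three values of h on a line. *)
Lemma interp_generic v f i : is_interp v h f -> (i < m)%N ->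
  if v i then bend f i != 0 else f i.+1 != h i.+1.
Proof.
move=> hf im; pose Q k := [|| k == 0%N, k == m.+1 | v k.-1].
have [s [si Qs Hs]] := @prev_true Q i.+1 isT isT.
have Qm : Q m.+1 by rewrite /Q eqxx orbT.
have [s' [/andP[is' s'm] Qs' Hs']] := next_true Qm (im : (i.+1 < m.+1)%N).
have ss' : (s < s')%N by lia.
have nv j : (s < j.+1 < s')%N -> j != i -> bend f j = 0.
  move=> hj ji; have [_ _ fP] := hf; have := fP j; case: (boolP (v j)) => vj; last by apply; lia.
  have [lt|gt|E] := ltngtP j i; last by rewrite E eqxx in ji.
    by have := Hs j.+1; rewrite /Q /= vj !orbT; move=> /(_ (ltac:(lia))).
  by have := Hs' j.+1; rewrite /Q /= vj !orbT; move=> /(_ (ltac:(lia))).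
have key : bend f i = 0 -> f i.+1 = h i.+1 -> False.
  move=> b0 E; have [|a [b Hl]] := flat_line (f := f) ss' s'm.
    by move=> j hj; have [->//|ji] := eqVneq j i; apply: nv.
  apply: (h_gen (a := a) (b := b) (i := s) (j := i.+1) (k := s')); rewrite ?si ?is' //.
  - by rewrite -(interp_at hf _ Qs) ?Hl //; lia.
  - by rewrite -E Hl //; lia.
  - by rewrite -(interp_at hf _ Qs') ?Hl //; lia.
have [_ _ fP] := hf; have := fP i im; case: (v i) => E; apply/eqP => E'; exact: key.
Qed.

(* The energy identity applied to [f - f'] forces [f = f'] on the grid. *)
Lemma out_coord_inj v v' f f' : is_interp v h f -> is_interp v' h f' ->
  (forall i, (i < m)%N -> v i != v' i -> out_coord f v i = out_coord f' v' i) ->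
  forall i, (i < m)%N -> v i = v' i.
Proof.
move=> hf hf' H; have [f0 fm fP] := hf; have [f0' fm' fP'] := hf'.
pose d j := f j + -1 * f' j.
(* If, say, only v contains i, the product is [bend f i] times h - f', and equal out-coordinates
   give both factors the same sign. *)
have term i : (i < m)%N -> 0 <= bend d i * d i.+1 /\ (v i != v' i -> 0 < bend d i * d i.+1).
  move=> im; have := H i im; have := fP i im; have := fP' i im.
  have := interp_generic hf im; have := interp_generic hf' im.
  rewrite /out_coord bendD /d; case: (v i); case: (v' i) => /=.
  - by move=> _ _ -> -> _; rewrite mulN1r subrr mulr0.
  - move=> n1 n2 b0 -> /(_ isT) E; rewrite b0 mulr0 addr0 mulN1r.
    suff h1 : 0 < bend f i * (h i.+1 - f' i.+1) by split=> //; apply: ltW.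
    have [hb|hb] := ltrP 0 (bend f i); first by rewrite mulr_gt0 // subr_gt0 -E.
    rewrite nmulr_rgt0; last by rewrite lt_neqAle n2.
    by rewrite subr_lt0 lt_neqAle eq_sym n1 leNgt -E ltNge hb.
  - move=> n1 n2 -> b0 /(_ isT) E; rewrite b0 add0r !mulN1r mulNr -mulrN opprB.
    suff h1 : 0 < bend f' i * (h i.+1 - f i.+1) by split=> //; apply: ltW.
    have [hb|hb] := ltrP 0 (bend f' i); first by rewrite mulr_gt0 // subr_gt0 E.
    rewrite nmulr_rgt0; last by rewrite lt_neqAle n1.
    by rewrite subr_lt0 lt_neqAle eq_sym n2 leNgt E ltNge hb.
  - by move=> _ _ -> -> _; rewrite mulr0 addr0 mul0r.
have := @energy_identity d 0 m; rewrite add0n => /(_ (leqnn m)).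
have d0 : d 0%N = 0 by rewrite /d f0 f0' mulN1r subrr.
have dm : d m.+1 = 0 by rewrite /d fm fm' mulN1r subrr.
rewrite d0 dm !mulr0 subrr => E.
have S2 : 0 <= \sum_(i < m.+1) slope d (0 + i) ^+ 2 * (x (0 + i).+1 - x (0 + i)%N).
  apply: sumr_ge0 => i _; rewrite mulr_ge0 ?sqr_ge0 // ltW // gap_gt0 // add0n -ltnS.
  exact: ltn_ord.
have Hge (i : 'I_m) : predT i -> 0 <= bend d (0 + i) * d (0 + i).+1.
  by move=> _; have [] := term _ (ltn_ord i).
have S1 : \sum_(i < m) bend d (0 + i) * d (0 + i).+1 = 0.
  by apply/eqP; rewrite eq_le (sumr_ge0 _ Hge) andbT -[X in _ <= X]E lerDl.
move=> i im; have := psumr_eq0P Hge S1 (isT : predT (Ordinal im)) => /= E0.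
have [_ h1] := term i im; apply/eqP; apply: contraT => /h1; rewrite add0n in E0.
by rewrite E0 ltxx.
Qed.

End Collinear.
End Grid.

(** * Intervals between consecutive breaks *)

Section Intervals.
Variables (brk act : pred nat).

(** [s] is the last break met, [i] the next position to test, [k] the number of positions left; the
    position i + k closes the last interval whether or not it is a break. *)
Fixpoint intervals s i k : seq (nat * nat) :=
  if k is k'.+1 then
    if brk i then (s, i) :: intervals i i.+1 k' else intervals s i.+1 k'
  else [:: (s, i)].

Lemma intervalsP s i k t : (s < i)%N -> (forall j, (s < j < i)%N -> ~~ brk j) ->
  t \in intervals s i k ->
  [/\ (s <= t.1)%N, (t.1 < t.2 <= i + k)%N, (t.1 == s) || (brk t.1 && (i <= t.1)%N),
      (t.2 == (i + k)%N) || brk t.2 & forall j, (t.1 < j < t.2)%N -> ~~ brk j].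
Proof.
elim: k s i => [|k IH] s i si Hs /=.
  by rewrite inE => /eqP -> /=; rewrite addn0; split; rewrite ?leqnn ?si ?eqxx.
case: (boolP (brk i)) => bi.
  rewrite inE => /predU1P[->|] /=.
    by split=> //; rewrite ?eqxx ?bi ?orbT // si /= leq_addr.
  have Hi j : (i < j < i.+1)%N -> ~~ brk j by lia.
  move=> /(IH i i.+1 (ltnSn i) Hi)[h1 h2 h3 h4 h5]; rewrite addSnnS in h2 h4.
  split=> //; first exact: leq_trans (ltnW si) h1.
  by case/orP: h3 => [/eqP->|/andP[-> h]]; rewrite ?bi ?leqnn ?orbT // (ltnW h) orbT.
have Hi j : (s < j < i.+1)%N -> ~~ brk j.
  move=> hj; have [->//|ji] := eqVneq j i; apply: Hs; move/eqP: ji; lia.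
move=> /(IH s i.+1 (ltnW si) Hi)[h1 h2 h3 h4 h5]; rewrite addSnnS in h2 h4; split=> //.
by case/orP: h3 => [->//|/andP[-> h]]; rewrite (ltnW h) orbT.
Qed.

Lemma mem_intervals s i k a b : (s < i)%N -> (a < b)%N -> (i <= b <= i + k)%N ->
  (a == s) || (brk a && (i <= a)%N) -> (b == (i + k)%N) || brk b ->
  (forall j, (a < j < b)%N -> ~~ brk j) -> (a, b) \in intervals s i k.
Proof.
elim: k s i => [|k IH] s i si ab hb ha hb' H /=.
  rewrite inE; have -> : b = i by lia.
  case/orP: ha => [/eqP->//|/andP[_ ia]]; lia.
case: (boolP (brk i)) => bi.
  have [E|bni] := eqVneq b i.
    have -> : a = s by case/orP: ha => [/eqP//|/andP[_ ia]]; lia.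
    by rewrite E mem_head.
  rewrite inE; apply/orP; right; apply: IH => //; rewrite ?addSnnS //.
  - by move/eqP: bni; lia.
  - case/orP: ha => [/eqP E|/andP[ba ia]].
      by have := H i; rewrite bi E si /=; move/eqP: bni => bni /(_ (ltac:(lia))).
    by rewrite ba /=; lia.
apply: IH => //; rewrite ?addSnnS //; first exact: ltnW.
- have [E|/eqP bni] := eqVneq b i; last by lia.
  by move: hb'; rewrite E (negbTE bi) orbF => /eqP; lia.
- case/orP: ha => [->//|/andP[ba ia]]; rewrite ba /=; apply/orP; right.
  by rewrite ltn_neqAle ia andbT; apply: contraNneq bi => ->.
Qed.

Lemma intervals_sorted s i k : (s < i)%N -> (forall j, (s < j < i)%N -> ~~ brk j) ->
  pairwise (fun t1 t2 : nat * nat => t1.2 <= t2.1)%N (intervals s i k).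
Proof.
elim: k s i => [|k IH] s i si Hs //=.
case: (boolP (brk i)) => bi /=; last first.
  apply: IH; first exact: ltnW.
  by move=> j hj; have [->//|/eqP ji] := eqVneq j i; apply: Hs; lia.
have Hi j : (i < j < i.+1)%N -> ~~ brk j by lia.
rewrite (IH i i.+1 (ltnSn i) Hi) andbT.
by apply/allP => t /(intervalsP (ltnSn i) Hi)[].
Qed.

Definition cnt s i := count act (iota s.+1 (i - s.+1)).

Lemma prod_intervals s i k : (s < i)%N ->
  \prod_(t <- intervals s i k) dpoly nat (cnt t.1 t.2) = wblocks brk act (cnt s i) i k.
Proof.
elim: k s i => [|k IH] s i si /=; first by rewrite big_seq1.
case: (brk i); first by rewrite big_cons IH // {2}/cnt subnn.
rewrite IH 1?ltnW //; congr (wblocks _ _ _ _ _).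
rewrite /cnt (_ : i.+1 - s.+1 = (i - s.+1) + 1)%N; last by lia.
by rewrite iotaD count_cat /= addn0 subnKC.
Qed.

End Intervals.

(** * Subdivisions seen from the lowest point *)

(** Used to show that the cells at p cost exactly one dimension for each element of Phi. The
    induction moves one vector of the complement into L. *)
Lemma dim_complement (K : fieldType) (E : vectType K) (I : finType) (L W : {vspace E})
    (S : {set I}) (e : I -> E) : (L <= W)%VS -> (forall i, i \in S -> e i \in W) ->
  (forall w, w \in W -> exists c : I -> K, w - \sum_(i in S) c i *: e i \in L) ->
  (forall c : I -> K, \sum_(i in S) c i *: e i \in L -> forall i, i \in S -> c i = 0) ->
  \dim W = (\dim L + #|S|)%N.
Proof.
have [k] := ubnP #|S|; elim: k S L => // k IH S L hk LW eW dec ind.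
have [S0|[i iS]] := set_0Vmem S.
  rewrite S0 cards0 addn0; apply/eqP; rewrite eqn_leq (dimvS LW) andbT; apply: dimvS.
  by apply/subvP => w /dec[c]; rewrite S0 big_set0 subr0.
have eL : e i \notin L.
  apply/negP => eL; have h : \sum_(j in S) (j == i)%:R *: e j \in L.
    rewrite (bigD1 i) //= eqxx scale1r big1 ?addr0 // => j /andP[_ /negbTE->].
    by rewrite scale0r.
  by have /eqP := ind (fun j => (j == i)%:R) h i iS; rewrite eqxx oner_eq0.
have dimL : \dim (L + <[e i]>)%VS = (\dim L).+1.
  have e0 : e i != 0 by apply: contraNneq eL => ->; rewrite mem0v.
  rewrite dimv_disjoint_sum; first by rewrite dim_vline e0 addn1.
  apply/eqP; rewrite -subv0; apply/subvP => u; rewrite memv_cap => /andP[uL /vlineP[c uc]].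
  have [c0|c0] := eqVneq c 0; first by rewrite uc c0 scale0r mem0v.
  by case/negP: eL; rewrite -[e i](scalerK c0) -uc memvZ.
have := IH (S :\ i) (L + <[e i]>)%VS; rewrite dimL (cardsD1 i S) iS addSnnS add1n; apply.
- by move: hk; rewrite (cardsD1 i S) iS.
- by rewrite subv_add LW -memvE eW.
- by move=> j; rewrite !inE => /andP[_ /eW].
- move=> w /dec[c]; rewrite (big_setD1 i iS) /= => h; exists c.
  have -> : w - \sum_(j in S :\ i) c j *: e j =
      (w - (c i *: e i + \sum_(j in S :\ i) c j *: e j)) + c i *: e i.
    by rewrite -[RHS]addrA opprD [X in _ = _ + X]addrAC addNr add0r.
  by rewrite memv_add // memvZ // memv_line.
- move=> c /memv_addP[u uL [y /vlineP[a ->] Ec]] j; rewrite !inE => /andP[ji jS].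
  pose c' z := if z == i then - a else c z.
  suff h : \sum_(z in S) c' z *: e z \in L by have := ind c' h j jS; rewrite /c' (negbTE ji).
  rewrite (big_setD1 i iS) /= /c' eqxx scaleNr.
  rewrite (eq_bigr (fun z => c z *: e z)) => [|z]; first by rewrite Ec addrCA addNr addr0.
  by rewrite !inE => /andP[/negbTE->].
Qed.

Lemma card_ord_pred N (Q : pred nat) : #|[set i : 'I_N | Q i]| = count Q (iota 0 N).
Proof.
rewrite cardsE cardE size_filter -val_enum_ord count_map.
by rewrite enumT; apply: eq_count => i; rewrite !inE.
Qed.

Lemma count_nth_iota m (s : m.-tuple bool) : count (nth false s) (iota 0 m) = count id s.
Proof.
by rewrite -[in RHS](mkseq_nth false s) size_tuple count_map; apply: eq_count.
Qed.

Lemma all2_implb (s t : seq bool) i : all2 implb s t -> size s = size t ->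
  nth false s i -> nth false t i.
Proof.
elim: s t i => [|a s IH] [|b t] [|i] //= /andP[ab st] [sz]; first by apply/implyP.
exact: IH.
Qed.

Lemma card_dep_triple (A B C : finType) (Q : A -> B -> bool) (S : A -> B -> C -> bool) :
  #|[set d : A * B * C | Q d.1.1 d.1.2 && S d.1.1 d.1.2 d.2]| =
  (\sum_a \sum_(b | Q a b) #|[set c | S a b c]|)%N.
Proof.
rewrite pair_big_dep /=.
under eq_bigr do rewrite -sum1dep_card.
by rewrite pair_big_dep sum1dep_card /=; apply: eq_card => d; rewrite !inE.
Qed.

Section Star.
Variables (R : realFieldType) (n : nat) (X Y : 'I_n -> R).
Implicit Types (l : R * R * R) (V B C D Z : {set 'I_n}) (w : 'rV[R]_n).
Implicit Types (T U : {set {set 'I_n}}).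

Local Notation ev := (ev X Y).
Local Notation cells := (cells X Y).
Local Notation iscell := (iscell X Y).
Local Notation supports := (supports X Y).
Local Notation aff_on := (aff_on X Y).
Local Notation cone_span := (cone_span X Y).
Local Notation codim_span := (codim_span X Y).

Hypothesis gp : gen_pos X Y.
Variables (p : 'I_n) (m : nat) (q : nat -> 'I_n).
Hypothesis q_inj : forall i j, (i <= m.+1)%N -> (j <= m.+1)%N -> q i = q j -> i = j.
Hypothesis q_above : forall j, (j <= m.+1)%N -> Y p < Y (q j).

(* In these coordinates a height function vanishing at p corresponds to the
   function [w 0 (q j) / qb j] on the line, the supporting functions of the cells
   at p to affine functions of [qx], and constants to multiples of [qh]. *)
Definition qb j := Y (q j) - Y p.
Definition qx j := (X (q j) - X p) / qb j.
Definition qh j := (qb j)^-1.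

Hypothesis qx_incr : forall i j, (i < j)%N -> (j <= m.+1)%N -> qx i < qx j.

Local Notation line := (line qx).
Local Notation hinge := (hinge qx).
Local Notation bend := (bend qx).

Lemma qb_gt0 j : (j <= m.+1)%N -> 0 < qb j.
Proof. by move=> jm; rewrite subr_gt0 q_above. Qed.

Lemma qb_neq0 j : (j <= m.+1)%N -> qb j != 0.
Proof. by move=> /qb_gt0/gt_eqF->. Qed.

Lemma q_neq_p j : (j <= m.+1)%N -> q j != p.
Proof. by move=> /q_above; apply: contraTneq => ->; rewrite ltxx. Qed.

Lemma ev_q l j : (j <= m.+1)%N -> ev l (q j) = qb j * line l.1.1 l.1.2 j + ev l p.
Proof.
move=> /qb_neq0 h; have E : qb j * qx j = X (q j) - X p by rewrite /qx mulrC divfK.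
by rewrite /line mulrDr mulrCA E /qb /ev; ring.
Qed.

Definition lin a b c : R * R * R := (a, b, c - a * X p - b * Y p).

Lemma ev_lin_p a b c : ev (lin a b c) p = c.
Proof. by rewrite /ev /lin /=; ring. Qed.

Lemma ev_lin_q a b c j : (j <= m.+1)%N -> ev (lin a b c) (q j) = qb j * line a b j + c.
Proof. by move=> jm; rewrite ev_q // ev_lin_p. Qed.

(** Inverse of q, with the default value m + 2 at p and at all labels outside the image of q. *)
Definition qidx i := find (fun j => q j == i) (iota 0 m.+2).

Lemma qidx_q j : (j <= m.+1)%N -> qidx (q j) = j.
Proof.
move=> jm; have hs : has (fun k => q k == q j) (iota 0 m.+2).
  by apply/hasP; exists j; rewrite // mem_iota.
have lt : (qidx (q j) < m.+2)%N by rewrite -[X in (_ < X)%N](size_iota 0) -has_find.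
have /eqP := nth_find 0%N hs; rewrite -/(qidx _) nth_iota // add0n => E.
exact: q_inj E.
Qed.

Lemma qidx_p : qidx p = m.+2.
Proof.
rewrite /qidx hasNfind ?size_iota //; apply/hasPn => j; rewrite mem_iota => /andP[_ jm].
exact: q_neq_p.
Qed.

Definition qvec (u : nat -> R) : 'rV[R]_n :=
  \row_i (if (qidx i < m.+2)%N then qb (qidx i) * u (qidx i) else 0).

Lemma qvec_q u j : (j <= m.+1)%N -> qvec u 0 (q j) = qb j * u j.
Proof. by move=> jm; rewrite mxE qidx_q // ltnS jm. Qed.

Lemma qvec_p u : qvec u 0 p = 0.
Proof. by rewrite mxE qidx_p ltnn. Qed.

Definition gset (Q : pred nat) : {set 'I_n} := [set q j | j : 'I_m.+2 & Q j].

Lemma mem_gset Q j : (j <= m.+1)%N -> (q j \in gset Q) = Q j.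
Proof.
move=> jm; apply/imsetP/idP => [[k] | Qj]; last by exists (Ordinal (jm : j < m.+2)%N); rewrite ?inE.
rewrite inE => Qk E; have -> // : j = k.
by apply: q_inj => //; rewrite -ltnS.
Qed.

Lemma gsetP Q i : i \in gset Q -> exists2 j, (j <= m.+1)%N & Q j /\ i = q j.
Proof. by case/imsetP => k; rewrite inE => Qk ->; exists k; rewrite // -ltnS. Qed.

Lemma card_gset Q : #|gset Q| = count Q (iota 0 m.+2).
Proof.
rewrite card_in_imset ?card_ord_pred // => j k _ _ /q_inj E; apply/val_inj/E; by rewrite -ltnS.
Qed.

Lemma p_gset Q : p \notin gset Q.
Proof. by apply/negP => /gsetP[j /q_neq_p h [_ E]]; rewrite E eqxx in h. Qed.

Definition Vp := p |: gset predT.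

Lemma gset_sub Q : gset Q \subset Vp.
Proof. by apply/subsetP => i /gsetP[j jm [_ ->]]; rewrite !inE mem_gset ?orbT. Qed.

Lemma star_sub Q : p |: gset Q \subset Vp.
Proof. by apply/subsetP => i; rewrite inE => /orP[|/(subsetP (gset_sub Q))//]; rewrite !inE => ->. Qed.

Lemma aff_starP w (Q : pred nat) : aff_on w (p |: gset Q) <->
  exists a b, forall j, (j <= m.+1)%N -> Q j -> w 0 (q j) = qb j * line a b j + w 0 p.
Proof.
split=> [[l H]|[a [b H]]].
  exists l.1.1, l.1.2 => j jm Qj; rewrite !H ?inE ?eqxx //; first exact: ev_q.
  by rewrite mem_gset // Qj orbT.
exists (lin a b (w 0 p)) => i; rewrite in_setU1 => /predU1P[->|/gsetP[j jm [Qj ->]]].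
  by rewrite ev_lin_p.
by rewrite ev_lin_q // H.
Qed.

Lemma aff_gset w (Q : pred nat) a b c :
  (forall j, (j <= m.+1)%N -> Q j -> w 0 (q j) = qb j * line a b j + c) ->
  aff_on w (gset Q).
Proof. by move=> H; exists (lin a b c) => i /gsetP[j jm [Qj ->]]; rewrite ev_lin_q // H. Qed.

Lemma supports_star g (Q : pred nat) a b : (forall j, (j <= m.+1)%N -> line a b j <= g j ?= iff Q j) ->
  supports Vp (qvec g) (p |: gset Q) (lin a b 0).
Proof.
move=> H i; rewrite in_setU1 => /predU1P[->|/gsetP[j jm [_ ->]]].
  by rewrite ev_lin_p qvec_p in_setU1 eqxx; apply: leif_refl.
rewrite ev_lin_q // addr0 qvec_q // in_setU1 (negbTE (q_neq_p jm)) mem_gset //=.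
have [h1 h2] : line a b j <= g j ?= iff Q j by apply: H.
by rewrite /Order.leif ler_pM2l ?qb_gt0 // (inj_eq (mulfI (qb_neq0 jm))).
Qed.

(** The value -1 at p lies below the height 0 and keeps p out of the cell; divided by [qb j], it
    raises the heights by [qh]. *)
Lemma supports_block g (Q : pred nat) a b :
  (forall j, (j <= m.+1)%N -> line a b j <= g j + qh j ?= iff Q j) ->
  supports Vp (qvec g) (gset Q) (lin a b (-1)).
Proof.
move=> H i; rewrite in_setU1 => /predU1P[->|/gsetP[j jm [_ ->]]].
  by rewrite ev_lin_p qvec_p (negbTE (p_gset _)); apply/leifP; rewrite ltrN10.
rewrite ev_lin_q // qvec_q // mem_gset //.
have [h1 h2] : line a b j <= g j + qh j ?= iff Q j by apply: H.
have E : qb j * g j = qb j * (g j + qh j) - 1.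
  by rewrite mulrDr /qh mulfV ?qb_neq0 // addrK.
rewrite /Order.leif E lerD2r ler_pM2l ?qb_gt0 // (inj_eq (addIr _)).
by rewrite (inj_eq (mulfI (qb_neq0 jm))).
Qed.

(** Such a line would give an affine function of the plane that vanishes at three of the points but
    equals -1 at p. *)
Lemma qh_gen a b i j k : (i < j < k)%N -> (k <= m.+1)%N ->
  qh i = line a b i -> qh j = line a b j -> qh k = line a b k -> False.
Proof.
move=> /andP[ij jk] km hi hj hk.
have H z : (z <= m.+1)%N -> qh z = line a b z -> ev (lin a b (-1)) (q z) = 0.
  by move=> zm hz; rewrite ev_lin_q // -hz /qh mulfV ?qb_neq0 // subrr.
have jm : (j <= m.+1)%N by lia.
have im : (i <= m.+1)%N by lia.
have ne a' b' : (a' <= m.+1)%N -> (b' <= m.+1)%N -> (a' < b')%N -> q a' != q b'.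
  by move=> h1 h2 h3; apply/eqP => /(q_inj h1 h2); lia.
have := ev_zero3 gp (ne i j im jm ij) (ne i k im km (ltn_trans ij jk)) (ne j k jm km jk)
  (H i im hi) (H j jm hj) (H k km hk).
by move=> /(congr1 (ev^~ p)); rewrite ev_lin_p /ev /= !mul0r !add0r; lra.
Qed.

Lemma bend_sum (F : nat -> nat -> R) M i :
  bend (fun j => \sum_(k < M) F k j) i = \sum_(k < M) bend (F k) i.
Proof.
elim: M => [|M IH]; first by rewrite /bend /slope !big_ord0 !subrr !mul0r subrr.
rewrite big_ord_recr /= -IH -[X in _ + X]mul1r -bendD.
by apply: bend_ext; rewrite big_ord_recr /= mul1r.
Qed.

(** The function with bends c that vanishes at the grid points 0 and 1. *)
Definition comb (c : nat -> R) : nat -> R := fun j => \sum_(k < m) c k * hinge k.+1 j.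

Lemma bendZ c f i : bend (fun j => c * f j) i = c * bend f i.
Proof. by rewrite /bend /slope; ring. Qed.

Lemma bend_comb c i : (i < m)%N -> bend (comb c) i = c i.
Proof.
move=> im; rewrite (bend_sum (fun k j => c k * hinge k.+1 j)) (bigD1 (Ordinal im)) //= big1 ?addr0 => [|k].
  by rewrite bendZ (bend_hinge qx_incr) // eqxx mulr1.
rewrite -val_eqE /= => ki; rewrite bendZ (bend_hinge qx_incr) // eq_sym (negbTE ki).
by rewrite mulr0.
Qed.

(** * Heights with prescribed cells at p and prescribed blocks *)

Section Decomposition.
Variables (v Phi : pred nat) (f : nat -> R).
Hypothesis f_interp : is_interp qx m v qh f.

Local Notation out := (out_coord qx qh f v).

Hypothesis Phi_out : forall i, (i < m)%N -> Phi i -> out i.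

(* The q_k with [brkJ k] separate consecutive blocks, those with [dropK k] lie in
   no block; the q_k with [onstar k] are the neighbours of p in its cells, and
   those with [brkS k] separate consecutive cells at p. *)
Definition brkJ k := [|| k == 0%N, k == m.+1 | out k.-1 && v k.-1].
Definition dropK k := [&& (0 < k)%N, (k < m.+1)%N, out k.-1 & ~~ v k.-1].
Definition brkS k := [|| k == 0%N, k == m.+1 | v k.-1 && ~~ Phi k.-1].
Definition onstar k := [|| k == 0%N, k == m.+1, v k.-1 | Phi k.-1].

Definition star t := p |: gset (fun j => (t.1 <= j <= t.2)%N && onstar j).
Definition block t := gset (fun j => (t.1 <= j <= t.2)%N && ~~ dropK j).

Definition stars := [seq star t | t <- intervals brkS 0 1 m].
Definition blocks := [seq block t | t <- intervals brkJ 0 1 m].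

Lemma interval_full (brk : pred nat) t : brk 0%N -> brk m.+1 -> t \in intervals brk 0 1 m ->
  [/\ (t.1 < t.2 <= m.+1)%N, brk t.1, brk t.2 & forall j, (t.1 < j < t.2)%N -> ~~ brk j].
Proof.
move=> b0 bm; have H0 j : (0 < j < 1)%N -> ~~ brk j by lia.
move=> /(intervalsP (ltn0Sn 0) H0)[_ h2 h3 h4 h5]; split=> //.
  by case/orP: h3 => [/eqP->//|/andP[]].
by case/orP: h4 => [/eqP->|].
Qed.

Lemma interval_around (brk : pred nat) k : brk 0%N -> brk m.+1 -> (0 < k < m.+1)%N -> ~~ brk k ->
  exists2 t, t \in intervals brk 0 1 m & (t.1 < k < t.2)%N.
Proof.
move=> b0 bm /andP[k0 km] nk; have [s [sk bs Hs]] := prev_true b0 k0.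
have [s' [/andP[ks' s'm] bs' Hs']] := next_true bm km.
exists (s, s'); last by rewrite /= sk.
apply: mem_intervals => //=; try lia.
move=> j hj; have [E|/eqP ne] := eqVneq j k; first by rewrite E.
by have [jk|kj] := ltnP j k; [apply: Hs | apply: Hs']; lia.
Qed.

Lemma interval_from (brk : pred nat) k : brk 0%N -> brk m.+1 -> (k < m.+1)%N -> brk k ->
  exists2 t, t \in intervals brk 0 1 m & t.1 = k.
Proof.
move=> b0 bm km bk; have [s' [/andP[ks' s'm] bs' Hs']] := next_true bm km.
exists (k, s') => //; apply: mem_intervals => //; try lia.
Qed.

Lemma interval_to (brk : pred nat) k : brk 0%N -> brk m.+1 -> (0 < k <= m.+1)%N -> brk k ->
  exists2 t, t \in intervals brk 0 1 m & t.2 = k.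
Proof.
move=> b0 bm /andP[k0 km] bk; have [s [sk bs Hs]] := prev_true b0 k0.
exists (s, k) => //; apply: mem_intervals => //; try lia.
Qed.

Lemma brkS0 : brkS 0. Proof. by []. Qed.
Lemma brkSm : brkS m.+1. Proof. by rewrite /brkS eqxx orbT. Qed.
Lemma brkJ0 : brkJ 0. Proof. by []. Qed.
Lemma brkJm : brkJ m.+1. Proof. by rewrite /brkJ eqxx orbT. Qed.

Lemma brkS_onstar k : brkS k -> onstar k.
Proof. by rewrite /brkS /onstar => /or3P[->|->|/andP[-> _]]; rewrite ?orbT. Qed.

Lemma brkS_int i : (i < m)%N -> brkS i.+1 = v i && ~~ Phi i.
Proof. by move=> im; rewrite /brkS /= eqSS ltn_eqF. Qed.

Lemma brkJ_int i : (i < m)%N -> brkJ i.+1 = out i && v i.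
Proof. by move=> im; rewrite /brkJ /= eqSS ltn_eqF. Qed.

Lemma onstar_int i : (i < m)%N -> onstar i.+1 = v i || Phi i.
Proof. by move=> im; rewrite /onstar /= eqSS ltn_eqF. Qed.

Lemma dropK_int i : (i < m)%N -> dropK i.+1 = out i && ~~ v i.
Proof. by move=> im; rewrite /dropK /= ltnS im. Qed.

Lemma brkJ_dropK k : brkJ k -> ~~ dropK k.
Proof.
rewrite /brkJ /dropK => /or3P[/eqP->//|/eqP->|/andP[_ ->]]; by rewrite ?ltnn ?andbF.
Qed.

Lemma f_gen i : (i < m)%N -> if v i then bend f i != 0 else f i.+1 != qh i.+1.
Proof. move=> im; exact: (interp_generic qx_incr qh_gen f_interp im). Qed.

(* Slope jumps of a convex function whose domains of linearity are the blocks. *)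
Definition jump i : R := if out i && v i then bend f i + (~~ Phi i)%:R else 0.

(** With F = [comb jump], the heights must lie above F - f for the cells at p and above F - qh for
    the blocks. Off the discarded points f >= qh, and F - qh is taken. At a discarded point f < qh,
    so F - f is the larger one; adding 1, or any positive number, takes the point off the cells at p
    unless it is in Phi. *)
Definition coarse j : R :=
  comb jump j - f j + (if dropK j then (~~ Phi j.-1)%:R else f j - qh j).

Lemma jump_ge0 i : (i < m)%N -> 0 <= jump i ?= iff ~~ (out i && v i).
Proof.
move=> im; apply/leifP; rewrite /jump /out_coord; case: (v i) => //=.
  by rewrite andbT; case: ltrP => //= h; rewrite ltr_wpDr // ler0n.
by rewrite andbF /= eqxx.
Qed.

Lemma coarse_star j : (j <= m.+1)%N -> comb jump j + -1 * f j <= coarse j ?= iff onstar j.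
Proof.
move=> jm; rewrite /coarse mulN1r; apply/leifP.
have ends : f j = qh j -> dropK j = false -> onstar j -> if onstar j then
    comb jump j - f j == comb jump j - f j + (if dropK j then (~~ Phi j.-1)%:R else f j - qh j)
  else comb jump j - f j < comb jump j - f j + (if dropK j then (~~ Phi j.-1)%:R else f j - qh j).
  by move=> -> -> ->; rewrite subrr addr0.
have [f0 fm fP] := f_interp.
case: j jm ends => [|i] jm ends; first exact: ends.
have [E|ne] := eqVneq i m.
  by apply: ends; rewrite ?E // /dropK ?ltnn ?andbF // /onstar eqxx orbT.
have im : (i < m)%N by rewrite ltn_neqAle ne.
have := fP i im; have := f_gen im; have := Phi_out im; have := onstar_int im.
have := dropK_int im; rewrite /out_coord /= in ends *; move: ends.
case: (v i) => /= ends; first by rewrite andbF => dK oS _ _ fi; apply: ends.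
rewrite andbT => -> -> h3 h4 _.
have [lt|ge] := ltrP (f i.+1) (qh i.+1).
  case: (Phi i) => /=; first by rewrite addr0.
  by rewrite ltrDl ltr01.
case: (Phi i) h3 => [/(_ isT)|_]; first by rewrite ltNge ge.
by rewrite ltrDl subr_gt0 lt_neqAle eq_sym h4.
Qed.

Lemma coarse_block j : (j <= m.+1)%N -> comb jump j <= coarse j + qh j ?= iff ~~ dropK j.
Proof.
move=> jm; apply/leifP; rewrite /coarse; case: (boolP (dropK j)) => /= hK; last first.
  by apply/eqP; ring.
case/and4P: hK jm => j0 jm' ho nv _; case: j j0 jm' ho nv => // i _ im /= ho nv.
have : f i.+1 < qh i.+1 by move: ho; rewrite /out_coord (negbTE nv).
have : 0 <= (~~ Phi i)%:R :> R by rewrite ler0n.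
by move=> h1 h2; lra.
Qed.

Lemma star_cell t : t \in intervals brkS 0 1 m -> iscell Vp (qvec coarse) (star t).
Proof.
move=> /(interval_full brkS0 brkSm)[/andP[st tm] b1 b2 H].
have pb i : (i < m)%N -> bend (fun j => comb jump j + -1 * f j) i = jump i - bend f i.
  by move=> im; rewrite bendD bend_comb // mulN1r.
have [_ _ fP] := f_interp.
(* At an upward bend of f the jump exceeds it by 1, or cancels it for i in Phi; at a downward bend
   of f there is no jump, and -f bends upwards. *)
have pbS i : (i < m)%N -> 0 <= jump i - bend f i ?= iff ~~ brkS i.+1.
  move=> im; apply/leifP; rewrite brkS_int // /jump.
  have := fP i im; have := f_gen im; have := Phi_out im; rewrite /out_coord.
  case: (v i) => /= [ho nb _|_ _ ->]; last by rewrite andbF subrr.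
  rewrite andbT; case: ltrP ho => /= hb ho.
    by case: (Phi i) => /=; rewrite ?addr0 ?subrr // addrAC subrr add0r ltr01.
  case: (Phi i) ho => [/(_ isT)//|_] /=.
  by rewrite sub0r oppr_gt0 lt_neqAle nb.
have tm1 : (t.1 <= m.+1)%N by lia.
split.
- exact: star_sub.
- apply: (@card_ge3_set _ _ p (q t.1) (q t.2)).
  + by rewrite !inE eqxx.
  + by rewrite in_setU1 mem_gset // leqnn (ltnW st) brkS_onstar // orbT.
  + by rewrite in_setU1 mem_gset // leqnn (ltnW st) brkS_onstar // orbT.
  + by rewrite eq_sym q_neq_p.
  + by rewrite eq_sym q_neq_p.
  + by apply/eqP => /(q_inj tm1 tm); lia.
have [||||a [b Hab]] :=
  @convex_support _ _ _ qx_incr (fun j => comb jump j + -1 * f j) t.1 t.2 st tm.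
- by move=> i im; rewrite pb //; have [] := pbS i im.
- move=> i hi; have im : (i < m)%N by lia.
  by rewrite pb //; apply/esym/eqP; rewrite (pbS i im).2 H.
- move=> t0; have im : (t.1.-1 < m)%N by lia.
  by rewrite pb // (lt_leif (pbS _ im)) negbK prednK.
- move=> t2m; have im : (t.2.-1 < m)%N by lia.
  by rewrite pb // (lt_leif (pbS _ im)) negbK prednK //; lia.
exists (lin a b 0); apply: supports_star => j jm.
exact: leif_trans (Hab j jm) (coarse_star jm).
Qed.

Lemma block_cell t : t \in intervals brkJ 0 1 m -> (2 < #|block t|)%N ->
  iscell Vp (qvec coarse) (block t).
Proof.
move=> /(interval_full brkJ0 brkJm)[/andP[st tm] b1 b2 H] c3; split=> //; first exact: gset_sub.
have [||||a [b Hab]] := @convex_support _ _ _ qx_incr (comb jump) t.1 t.2 st tm.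
- by move=> i im; rewrite bend_comb //; have [] := jump_ge0 im.
- move=> i hi; have im : (i < m)%N by lia.
  by rewrite bend_comb //; apply/esym/eqP; rewrite (jump_ge0 im).2 -brkJ_int // H.
- move=> t0; have im : (t.1.-1 < m)%N by lia.
  by rewrite bend_comb // (lt_leif (jump_ge0 im)) negbK -brkJ_int // prednK.
- move=> t2m; have im : (t.2.-1 < m)%N by lia.
  by rewrite bend_comb // (lt_leif (jump_ge0 im)) negbK -brkJ_int // prednK //; lia.
exists (lin a b (-1)); apply: supports_block => j jm.
exact: leif_trans (Hab j jm) (coarse_block jm).
Qed.

(* The perturbations [eta i], for i in Phi, are affine on the blocks but not
   on the star cell whose angle at p contains q_(i+1) in its interior. *)
Definition eta i := qvec (if v i then hinge i.+1 else fun j => (j == i.+1)%:R).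

Lemma star_in t : t \in intervals brkS 0 1 m -> star t \in stars.
Proof. exact: map_f. Qed.

(** The hinge bends only at a separator of blocks; the other kind of perturbation is supported at a
    point that no block contains. *)
Lemma eta_block t i : t \in intervals brkJ 0 1 m -> (i < m)%N -> Phi i ->
  aff_on (eta i) (block t).
Proof.
move=> /(interval_full brkJ0 brkJm)[/andP[st tm] b1 b2 H] im Pi.
have ho := Phi_out im Pi; rewrite /eta; case: (boolP (v i)) => vi.
  have bi : brkJ i.+1 by rewrite brkJ_int // ho.
  have [is1|s1i] := leqP i.+1 t.1.
    apply: (@aff_gset _ _ 1 (- qx i.+1) 0) => j jm /andP[/andP[sj jt] _].
    have ij : (i.+1 <= j)%N := leq_trans is1 sj.
    by rewrite qvec_q // /hinge ij /line mul1r addr0.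
  have it2 : (t.2 <= i.+1)%N by rewrite leqNgt; apply/negP => h; have := H i.+1; rewrite s1i h bi => /(_ isT).
  apply: (@aff_gset _ _ 0 0 0) => j jm /andP[/andP[sj jt] _].
  rewrite qvec_q // /hinge /line mul0r !addr0; case: ifP => // h.
  have -> : j = i.+1 by apply/eqP; rewrite eqn_leq h (leq_trans jt it2).
  by rewrite subrr mulr0.
apply: (@aff_gset _ _ 0 0 0) => j jm /andP[_ nd].
rewrite qvec_q // /line mul0r !addr0; case: eqP => [E|]; last by rewrite mulr0.
by move: nd; rewrite E dropK_int // ho vi.
Qed.

Definition combPhi c := comb (fun k => if Phi k && v k then c k else 0).

Lemma sum_eta_q (c : nat -> R) j : (j <= m.+1)%N ->
  (\sum_(i < m | Phi i) c i *: eta i) 0 (q j) =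
  qb j * (combPhi c j + (if [&& 0 < j, j < m.+1, Phi j.-1 & ~~ v j.-1]%N then c j.-1 else 0)).
Proof.
move=> jm; rewrite summxE mulrDr /combPhi /comb mulr_sumr.
rewrite (bigID (fun i : 'I_m => v i)) /=; congr (_ + _).
  rewrite big_mkcond /=; apply: eq_bigr => i _; rewrite mxE /eta.
  case: ifP => [/andP[_ ->]|_]; first by rewrite qvec_q //= mulrCA.
  by rewrite mul0r mulr0.
case: ifP => [/and4P[j0 jm1 Pj nv]|h].
  have hj : (j.-1 < m)%N by lia.
  rewrite (bigD1 (Ordinal hj)) /=; last by rewrite Pj.
  rewrite big1 ?addr0; last first.
    move=> i /andP[/andP[_ nvi]]; rewrite -val_eqE /= => ij.
    rewrite mxE /eta (negbTE nvi) qvec_q // [j == i.+1](_ : _ = false) ?mulr0 //.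
    by apply/negbTE; apply: contraNneq ij => ->.
  by rewrite mxE /eta (negbTE nv) qvec_q // prednK // eqxx mulr1 mulrC.
rewrite mulr0 big1 // => i /andP[Pi nvi]; rewrite mxE /eta (negbTE nvi) qvec_q //.
rewrite [j == i.+1](_ : _ = false) ?mulr0 //; apply/negbTE; apply: contraFneq h => ->.
by rewrite /= ltnS ltn_ord Pi nvi.
Qed.

Lemma sum_eta_p (c : nat -> R) : (\sum_(i < m | Phi i) c i *: eta i) 0 p = 0.
Proof. by rewrite summxE big1 // => i _; rewrite mxE /eta qvec_p mulr0. Qed.

Lemma correct_stars w : exists c : nat -> R, forall Z, Z \in stars ->
  aff_on (w - \sum_(i < m | Phi i) c i *: eta i) Z.
Proof.
(* u is w seen on the line, and g interpolates it at v. Subtracting the bends of g at the elements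
   of Phi in v, and u - g at those outside v, leaves a function without bends inside the angle of
   each cell at p. *)
pose u j := (w 0 (q j) - w 0 p) / qb j.
have [g g_interp] := exists_interp qx_incr v u; have [g0 gm gP] := g_interp.
pose c i := if v i then bend g i else u i.+1 - g i.+1.
exists c => Z /mapP[t /(interval_full brkS0 brkSm)[/andP[st tm] b1 b2 H] ->].
pose F j := g j + -1 * combPhi c j.
have [i hi|a [b Hab]] := flat_line (f := F) qx_incr st tm.
  have im : (i < m)%N by lia.
  have := H i.+1 hi; rewrite brkS_int // bendD bend_comb // /c.
  have := gP i im; case: (v i) => /= [_ /negPn ->|-> _]; rewrite /= ?mulN1r ?subrr //.
  by rewrite andbF oppr0 addr0.
apply/aff_starP; exists a, b => j jm /andP[hj oj]; rewrite -Hab //.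
rewrite !mxE (sum_eta_q c jm) sum_eta_p subr0 /F.
have E : w 0 (q j) = qb j * u j + w 0 p by rewrite /u mulrC divfK ?qb_neq0 // subrK.
have uE : u j - (if [&& 0 < j, j < m.+1, Phi j.-1 & ~~ v j.-1]%N then c j.-1 else 0) = g j.
  have [->|j0] := posnP j; first by rewrite /= subr0 g0.
  have [->|jm1] := eqVneq j m.+1; first by rewrite ltnn andbF /= subr0 gm.
  have lt : (j < m.+1)%N by rewrite ltn_neqAle jm1.
  have hj' : (j.-1 < m)%N by lia.
  move: oj; rewrite /onstar (gtn_eqF j0) (negbTE jm1) /= lt /c.
  have := gP _ hj'; rewrite prednK //; case: (v j.-1) => /= [-> _|_ ->] /=.
    by rewrite andbF subr0.
  by rewrite subKr.
rewrite E -uE; move: (if _ then _ else _) => z; ring.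
Qed.

(** On the cell at p around i, the combination of hinges agrees with a line at all knots, hence
    everywhere by [grid_uniq_line]. So c i is a bend of a line, or the deviation of a point from
    it. *)
Lemma sum_eta_stars (c : nat -> R) : (forall Z, Z \in stars ->
    aff_on (\sum_(i < m | Phi i) c i *: eta i) Z) ->
  forall i, (i < m)%N -> Phi i -> c i = 0.
Proof.
move=> Hs i im Pi; have nS : ~~ brkS i.+1 by rewrite brkS_int // Pi andbF.
have [t tS /andP[ti it]] := interval_around brkS0 brkSm (im : 0 < i.+1 < m.+1)%N nS.
have [/andP[st tm] b1 b2 H] := interval_full brkS0 brkSm tS.
have /aff_starP[a [b Hab]] := Hs _ (star_in tS).
have dl j : (0 < j < m.+1)%N && v j.-1 || brkS j ->
    [&& 0 < j, j < m.+1, Phi j.-1 & ~~ v j.-1]%N = false.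
  rewrite /brkS => h; apply/negbTE/negP => /and4P[h1 h2 h3 h4]; move: h.
  by rewrite h3 (negbTE h4) !andbF /= (gtn_eqF h1) (ltn_eqF h2).
have val j : (t.1 <= j <= t.2)%N -> onstar j ->
    line a b j = combPhi c j
      + (if [&& 0 < j, j < m.+1, Phi j.-1 & ~~ v j.-1]%N then c j.-1 else 0).
  move=> hj oj; have jm : (j <= m.+1)%N by lia.
  have := Hab j jm; rewrite hj oj sum_eta_p addr0 sum_eta_q // => /(_ isT) /esym.
  by move/(mulfI (qb_neq0 jm)).
have E : forall j, (t.1 <= j <= t.2)%N -> combPhi c j = line a b j.
  apply: (grid_uniq_line qx_incr (ltnW st) tm).
  - by rewrite val ?leqnn ?(ltnW st) ?brkS_onstar // dl ?b1 ?orbT // addr0.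
  - by rewrite val ?leqnn ?(ltnW st) ?brkS_onstar // dl ?b2 ?orbT // addr0.
  move=> k hk; have km : (k < m)%N by lia.
  case: (boolP (v k)) => vk; last by right; rewrite bend_comb // (negbTE vk) andbF.
  have ok : onstar k.+1 by rewrite onstar_int ?vk.
  left; rewrite (val _ _ ok); last by lia.
  by rewrite dl ?addr0 //= ltnS km vk.
case: (boolP (v i)) => vi.
  have := bend_comb (fun k => if Phi k && v k then c k else 0) im; rewrite Pi vi /= => <-.
  apply: etrans (bend_line qx_incr a b im).
  by apply: bend_ext; apply: E; lia.
have hi : (t.1 <= i.+1 <= t.2)%N by rewrite (ltnW ti) (ltnW it).
have := val i.+1 hi; rewrite onstar_int // Pi orbT E //.
rewrite /= ltnS im vi /= => /(_ isT) /eqP.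
by rewrite -subr_eq0 opprD addrA subrr sub0r oppr_eq0 => /eqP.
Qed.

Lemma block_family_chain : chain_blocks blocks.
Proof.
rewrite /blocks; have H0 j : (0 < j < 1)%N -> ~~ brkJ j by lia.
have := intervals_sorted m (ltn0Sn 0) H0.
have : forall t, t \in intervals brkJ 0 1 m -> (t.1 <= t.2 <= m.+1)%N.
  by move=> t /(interval_full brkJ0 brkJm)[/andP[/ltnW -> ->]].
elim: (intervals _ _ _ _) => //= t ts IH Ht /andP[/allP h1 h2]; rewrite IH //; last first.
  by move=> t' t'ts; apply: Ht; rewrite inE t'ts orbT.
rewrite andbT; have /andP[t12 t2m] := Ht t (mem_head _ _).
apply: (@leq_trans #|[set q t.2]|); last by rewrite cards1.
apply/subset_leq_card/subsetP => i; rewrite in_setI => /andP[/gsetP[j jm [/andP[hj _] ->]]].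
move=> /ublocksP[D /mapP[t' t'ts ->]]; rewrite mem_gset // inE => /andP[hj' _].
by have := h1 t' t'ts => h; have -> : j = t.2 by lia.
Qed.

Lemma star3 t : t \in intervals brkS 0 1 m -> (2 < #|star t|)%N.
Proof. by move=> /star_cell[]. Qed.

Lemma iscell_shift V w w' C : iscell V w C -> aff_on (w' - w) V -> iscell V w' C.
Proof.
move=> [sCV c3 [l Hl]] [l' Hl']; split=> //; exists (addl l 1 l') => i iV.
have E : w' 0 i = w 0 i + ev l' i by rewrite -Hl' // !mxE addrCA subrr addr0.
rewrite evDZ mul1r E /Order.leif lerD2r (inj_eq (addIr _)).
exact: Hl.
Qed.

Definition flats : {set 'I_m} := [set i : 'I_m | Phi i].
Definition star_set : {set {set 'I_n}} := [set Z | Z \in stars].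

Lemma star_set3 Z : Z \in star_set -> (2 < #|Z|)%N.
Proof. by rewrite inE => /mapP[t /star3 h ->]. Qed.

Lemma eta_cone_span U i : block_family X Y blocks U -> (i < m)%N -> Phi i ->
  eta i \in cone_span U.
Proof.
move=> fU im Pi; apply/(cone_span_aff gp _ (block_family3 fU)) => C CU.
have [B /mapP[t tJ ->] CB] := fU.1 C CU.
by apply: aff_onS CB _; apply: eta_block.
Qed.

(** The vectors [eta i], i in Phi, are a basis of a complement: they lie in the span for U,
    [correct_stars] shows that they suffice, and [sum_eta_stars] that they are independent. *)
Lemma codim_spanU_stars U : block_family X Y blocks U ->
  codim_span (U :|: star_set) = (codim_span U + #|flats|)%N.
Proof.
move=> fU; have S3 := star_set3; have U3 := block_family3 fU.
have US3 C : C \in U :|: star_set -> (2 < #|C|)%N by rewrite in_setU => /orP[/U3|/S3].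
have sumE (k : 'I_m -> R) : exists k' : nat -> R,
    (forall i : 'I_m, k' i = k i) /\
    \sum_(i in flats) k i *: eta i = \sum_(i < m | Phi i) k' i *: eta i.
  pose k' j := if insub j is Some i then k i else 0.
  have kE (i : 'I_m) : k' i = k i by rewrite /k' valK.
  by exists k'; split=> //; apply: eq_big => i; rewrite ?inE // kE.
have dimE : \dim (cone_span U) = (\dim (cone_span (U :|: star_set)) + #|flats|)%N.
  apply: (@dim_complement _ _ _ _ _ flats (fun i : 'I_m => eta i)).
  - exact/cone_spanS/subsetUl.
  - by move=> i; rewrite inE => Pi; apply: eta_cone_span.
  - move=> w wU; have [c Hc] := correct_stars w; exists (fun i : 'I_m => c i).
    have -> : \sum_(i in flats) c i *: eta i = \sum_(i < m | Phi i) c i *: eta i.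
      by apply: eq_bigl => i; rewrite inE.
    apply/(cone_span_aff gp _ US3) => C; rewrite in_setU => /orP[CU|]; last first.
      by rewrite inE => /Hc.
    have : w - \sum_(i < m | Phi i) c i *: eta i \in cone_span U.
      rewrite memvB // memv_suml // => i Pi; rewrite memvZ //.
      exact: eta_cone_span.
    by move/(cone_span_aff gp _ U3); apply.
  - move=> k; have [k' [kk' ->]] := sumE k; move/(cone_span_aff gp _ US3) => H i.
    rewrite inE -kk' => Pi; apply: sum_eta_stars (ltn_ord i) Pi => Z ZS.
    by apply: H; rewrite in_setU [X in _ || X]inE ZS orbT.
rewrite /codim_span dimE; have := dim_cone_span X Y U; rewrite dimE.
by move: (\dim _) => d; lia.
Qed.

(* The heights are built by coarse heights, a perturbation inducing U on the
   blocks, and a generic perturbation in the cone they span. *)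
Lemma realize U : block_family X Y blocks U -> exists w,
  [/\ star_set \subset cells Vp w, U \subset cells Vp w &
      codim_span (cells Vp w) = (codim_span U + #|flats|)%N].
Proof.
move=> fU; have S3 := star_set3; have U3 := block_family3 fU.
have US3 C : C \in U :|: star_set -> (2 < #|C|)%N by rewrite in_setU => /orP[/U3|/S3].
have exth B : exists w, B \in blocks -> cells B w = [set C in U | C \subset B].
  case: (boolP (B \in blocks)) => [/fU.2[w E]|_]; first by exists w.
  by exists 0.
pose th B := projT1 (cid (exth B)).
have thP B : B \in blocks -> cells B (th B) = [set C in U | C \subset B].
  exact: projT2 (cid (exth B)).
have [w1 Hw1] := glue_heights X Y th block_family_chain.
(* The correction is affine on every block, so w2 still induces U there while becoming affine on the
   cells at p. *)
have [c Hc] := correct_stars w1; set w2 := w1 - _ in Hc.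
have w2B B : B \in blocks -> aff_on (w2 - th B) B.
  move=> BB; have -> : w2 - th B = (w1 - th B) + (-1) *: \sum_(i < m | Phi i) c i *: eta i.
    by rewrite scaleN1r addrAC.
  apply: aff_onDZ; first exact: Hw1.
  have [t tJ ->] := mapP BB.
  by apply: aff_on_sum => i Pi; apply/aff_onZ/eta_block.
have UE C : C \in U -> ev_small (fun e => iscell Vp (qvec coarse + e *: w2) C).
  move=> CU; have [B BB CB] := fU.1 C CU.
  have CthB : C \in cells B (th B) by rewrite thP // inE CU.
  have Cw2 : iscell B w2 C.
    by apply: iscell_shift (w2B B BB); apply/cellsP.
  apply: iscell_refine (Cw2); have [t tJ E] := mapP BB; rewrite E; apply: block_cell => //.
  by rewrite -E; apply: leq_trans (U3 _ CU) (subset_leq_card CB).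
have SE Z : Z \in star_set -> ev_small (fun e => iscell Vp (qvec coarse + e *: w2) Z).
  rewrite inE => ZS; apply: iscell_perturb; last exact: Hc.
  by have /mapP[t tS ->] := ZS; apply: star_cell.
have : ev_small (fun e => forall C, C \in U :|: star_set -> iscell Vp (qvec coarse + e *: w2) C).
  apply: ev_small_forall => C; case: (boolP (C \in _)) => [|_]; last by exists 1.
  rewrite in_setU => /orP[/UE|/SE]; exact: ev_small_imp.
case/ev_small_ex => e _; set w3 := qvec coarse + _ => Hw3.
(* A coplanarity that does not hold on all of L is destroyed by a generic g in L. Hence the
   remaining cells, whatever they are, impose no further condition on the span. *)
pose L := cone_span (U :|: star_set).
pose cs := [seq chi X Y z | z <- enum {: 'I_n * 'I_n * 'I_n * 'I_n} &
  `[< exists2 u, u \in L & (u *m chi X Y z) 0 0 != 0 >]].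
have [ch|g gL Hg] := @avoid_hyperplanes _ _ L cs.
  by case/mapP => z; rewrite mem_filter => /andP[/asboolP h _] ->.
have : ev_small (fun e => (forall C, C \in U :|: star_set -> iscell Vp (w3 + e *: g) C) /\
    (forall c', c' \in cs -> (w3 *m c') 0 0 + e * (g *m c') 0 0 != 0)).
  apply: ev_small_and; last first.
    by apply: ev_small_seq => c' /Hg h; apply: ev_small_neq0; rewrite h orbT.
  apply: ev_small_forall => C; case: (boolP (C \in _)) => CU; last by exists 1.
  have := iscell_perturb (Hw3 _ CU); move/(cone_span_aff gp _ US3): gL => /(_ _ CU) h /(_ _ h).
  exact: ev_small_imp.
case/ev_small_ex => e' _ [Hc4 Hg4]; set w4 := w3 + _ in Hc4.
have sub : U :|: star_set \subset cells Vp w4.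
  by apply/subsetP => C /Hc4 h; apply/cellsP.
exists w4; split.
- exact: subset_trans (subsetUr _ _) sub.
- exact: subset_trans (subsetUl _ _) sub.
rewrite -codim_spanU_stars //; congr (n - \dim _)%N; apply/eqP.
rewrite eqEsubv cone_spanS //=; apply/subvP => u uL; apply/mem_cone_span => C z CT zC.
apply/eqP; apply: contraT => nz.
have zcs : chi X Y z \in cs.
  by apply: map_f; rewrite mem_filter mem_enum andbT; apply/asboolP; exists u.
have := Hg4 _ zcs; have := aff_on_chi (iscell_aff (elimT (cellsP _ _ _ _ _) CT)) zC.
rewrite /w4 mulmxDl -scalemxAl [LHS]mxE [X in _ + X]mxE => ->.
by rewrite eqxx.
Qed.

(** The difference of the two supporting functions vanishes at p, hence is a line in j; it is at
    most 0 at both ends of t and at least 0 strictly between them, so it is 0. *)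
Lemma star_tight w t C j : star_set \subset cells Vp w -> t \in intervals brkS 0 1 m ->
  (t.1 < j < t.2)%N -> C \in cells Vp w -> p \in C -> q j \in C -> C = star t.
Proof.
move=> /subsetP sT tS /andP[sj js'] /cellsP[CV _ [l' Hl']] pC qC.
have /cellsP[ZV _ [l Hl]] : star t \in cells Vp w by apply: sT; rewrite inE star_in.
have [/andP[st tm] b1 b2 _] := interval_full brkS0 brkSm tS.
have pV : p \in Vp by rewrite in_setU1 eqxx.
have qV k : (k <= m.+1)%N -> q k \in Vp by move=> km; rewrite in_setU1 mem_gset // orbT.
have jm : (j <= m.+1)%N := leq_trans (ltnW js') tm.
have tm1 : (t.1 <= m.+1)%N := leq_trans (ltnW st) tm.
pose a := l'.1.1 - l.1.1; pose b := l'.1.2 - l.1.2.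
have Ep : ev l' p = ev l p.
  have /eqP-> : ev l' p == w 0 p by rewrite (Hl' p pV).
  by apply/esym/eqP; rewrite (Hl p pV) in_setU1 eqxx.
have Eq k : (k <= m.+1)%N -> ev l' (q k) - ev l (q k) = qb k * line a b k.
  by move=> km; rewrite !ev_q // Ep /line /a /b; ring.
have le0 k : (k <= m.+1)%N -> q k \in star t -> line a b k <= 0.
  move=> km kZ; rewrite -(pmulr_rle0 _ (qb_gt0 km)) -Eq // subr_le0.
  have /eqP-> : ev l (q k) == w 0 (q k) by rewrite (Hl _ (qV _ km)).
  by rewrite (Hl' _ (qV _ km)).1.
have ge0 : 0 <= line a b j.
  rewrite -(pmulr_rge0 _ (qb_gt0 jm)) -Eq // subr_ge0.
  have /eqP-> : ev l' (q j) == w 0 (q j) by rewrite (Hl' _ (qV _ jm)).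
  by rewrite (Hl _ (qV _ jm)).1.
have l1 : line a b t.1 <= 0.
  by apply: le0; rewrite // in_setU1 mem_gset // leqnn (ltnW st) brkS_onstar // orbT.
have l2 : line a b t.2 <= 0.
  by apply: le0; rewrite // in_setU1 mem_gset // leqnn (ltnW st) brkS_onstar // orbT.
have x1 := qx_incr sj jm; have x2 := qx_incr js' tm.
have [a0 b0] : a = 0 /\ b = 0.
  clear Eq le0; move: l1 l2 ge0 x1 x2; rewrite /line.
  move: (qx t.1) (qx j) (qx t.2) a b => y1 y y2 a b l1 l2 ge0 x1 x2.
  have h1 : a * (y - y1) >= 0 by rewrite mulrBr; lra.
  have h2 : a * (y2 - y) <= 0 by rewrite mulrBr; lra.
  rewrite pmulr_lge0 ?subr_gt0 // in h1; rewrite pmulr_lle0 ?subr_gt0 // in h2.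
  have a0 : a = 0 by lra.
  by split=> //; move: l1 ge0; rewrite a0 !mul0r !add0r; lra.
have El i : i \in Vp -> ev l' i = ev l i.
  rewrite in_setU1 => /predU1P[->//|/gsetP[k km [_ ->]]].
  by apply/eqP; rewrite -subr_eq0 Eq // a0 b0 /line mul0r addr0 mulr0.
apply/setP => i; have [iV|iV] := boolP (i \in Vp).
  by rewrite -(Hl' i iV) -(Hl i iV) El.
by rewrite (negbTE (contraNN (subsetP CV i) iV)) (negbTE (contraNN (subsetP ZV i) iV)).
Qed.

Lemma decode_onstar w i : star_set \subset cells Vp w -> (i < m)%N ->
  v i || Phi i = [exists C in cells Vp w, (p \in C) && (q i.+1 \in C)].
Proof.
move=> sT im; have im1 : (i.+1 <= m.+1)%N := ltnW im.
have := sT => /subsetP sT'; have star_cell' t : t \in intervals brkS 0 1 m -> star t \in cells Vp w.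
  by move=> tS; apply: sT'; rewrite inE star_in.
rewrite -onstar_int //; apply/idP/existsP => [o|[C /andP[CT /andP[pC qC]]]].
  have [t tS ht] : exists2 t, t \in intervals brkS 0 1 m & (t.1 <= i.+1 <= t.2)%N.
    have [bi|bi] := boolP (brkS i.+1).
      have [t tS E] := interval_from brkS0 brkSm (im : i.+1 < m.+1)%N bi; exists t => //.
      by have [/andP[st _] _ _ _] := interval_full brkS0 brkSm tS; rewrite -E leqnn ltnW.
    have [t tS /andP[h1 h2]] := interval_around brkS0 brkSm (im : 0 < i.+1 < m.+1)%N bi.
    by exists t; rewrite // ltnW //= ltnW.
  by exists (star t); rewrite star_cell' // !in_setU1 eqxx mem_gset // ht o orbT.
apply: contraT => no; have nb : ~~ brkS i.+1 by apply: contraNN no; apply: brkS_onstar.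
have [t tS ht] := interval_around brkS0 brkSm (im : 0 < i.+1 < m.+1)%N nb.
move: (qC); rewrite (star_tight sT tS ht CT pC qC) in_setU1 (negbTE (q_neq_p im1)).
by rewrite mem_gset // (negbTE no) andbF.
Qed.

(** By [star_tight] a point strictly inside the angle of a cell at p shares with p no other cell,
    whereas a separator lies in the cells on both of its sides. *)
Lemma decode_flat w i : star_set \subset cells Vp w -> (i < m)%N -> v i || Phi i ->
  Phi i = [forall C in cells Vp w, forall D in cells Vp w,
    [&& p \in C, q i.+1 \in C, p \in D & q i.+1 \in D] ==> (C == D)].
Proof.
move=> sT im vP; have im1 : (i.+1 <= m.+1)%N := ltnW im.
apply/idP/forall_inP => [Pi C CT|H].
  apply/forall_inP => D DT; apply/implyP => /and4P[pC qC pD qD].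
  have nb : ~~ brkS i.+1 by rewrite brkS_int // Pi andbF.
  have [t tS ht] := interval_around brkS0 brkSm (im : 0 < i.+1 < m.+1)%N nb.
  by rewrite (star_tight sT tS ht CT pC qC) (star_tight sT tS ht DT pD qD).
apply: contraT => nP; have bi : brkS i.+1 by rewrite brkS_int // nP andbT; rewrite (negbTE nP) orbF in vP.
have [t tS E] := interval_from brkS0 brkSm (im : i.+1 < m.+1)%N bi.
have [t' tS' E'] := interval_to brkS0 brkSm (im1 : 0 < i.+1 <= m.+1)%N bi.
have [/andP[st tm] b1 b2 _] := interval_full brkS0 brkSm tS.
have [/andP[st' _] b1' b2' _] := interval_full brkS0 brkSm tS'.
have mT z : z \in intervals brkS 0 1 m -> star z \in cells Vp w.
  by move=> zS; apply: (subsetP sT); rewrite inE star_in.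
have := forall_inP (H _ (mT t tS)) _ (mT t' tS').
have pS z : p \in star z by rewrite in_setU1 eqxx.
have i1 : q i.+1 \in star t by rewrite in_setU1 mem_gset // -E leqnn (ltnW st) brkS_onstar // orbT.
have i2 : q i.+1 \in star t' by rewrite in_setU1 mem_gset // -E' leqnn (ltnW st') brkS_onstar // orbT.
rewrite i1 i2 !pS implyTb.
have : q t.2 \notin star t'.
  by rewrite in_setU1 (negbTE (q_neq_p tm)) mem_gset // [(_ <= t'.2)%N]leqNgt E' -E st andbF.
have : q t.2 \in star t by rewrite in_setU1 mem_gset // leqnn (ltnW st) brkS_onstar // orbT.
by move=> h1 h2 /eqP E2; rewrite -E2 h1 in h2.
Qed.

(** The cells inside a block B are cells of B for w. They include a whole regular subdivision of B,
    so by [cells_sub_eq] there are no others. *)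
Lemma decode_family w U : block_family X Y blocks U -> U \subset cells Vp w ->
  U = [set C in cells Vp w | has (fun B : {set 'I_n} => C \subset B) blocks].
Proof.
move=> fU UT; have [h1 h2] := fU; apply/setP => C; rewrite inE; apply/idP/andP.
  by move=> CU; split; [apply: (subsetP UT) | have [B BB CB] := h1 C CU; apply/hasP; exists B].
case=> CT /hasP[B BB CB]; have [u Eu] := h2 B BB.
have BV : B \subset Vp by have [t _ ->] := mapP BB; apply: gset_sub.
have res D : D \subset B -> D \in cells Vp w -> D \in cells B w.
  by move=> DB /cellsP h; apply/cellsP; apply: iscell_restrict h.
have C3 : (2 < #|C|)%N by case/cellsP: CT.
have B3 : (2 < #|B|)%N := leq_trans C3 (subset_leq_card CB).
have E : cells B u = cells B w.
  apply: cells_sub_eq => //; apply/subsetP => D; rewrite Eu inE => /andP[DU DB].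
  by apply: res => //; apply: (subsetP UT).
by have := res C CB CT; rewrite -E Eu inE => /andP[].
Qed.

(** The two ends of an interval are never discarded, and [cnt] ignores them. *)
Lemma card_blockE t : t \in intervals brkJ 0 1 m ->
  #|block t| = (cnt (fun j => ~~ dropK j) t.1 t.2).+2.
Proof.
move=> /(interval_full brkJ0 brkJm)[/andP[st tm] b1 b2 _]; rewrite card_gset.
have -> : iota 0 m.+2 = iota 0 t.1 ++ t.1 :: iota t.1.+1 (t.2 - t.1.+1) ++
    t.2 :: iota t.2.+1 (m.+1 - t.2).
  move: t.1 t.2 st tm => a b ab bm.
  have -> : m.+2 = (a + (b - a.+1 + (m.+1 - b).+1).+1)%N by lia.
  by rewrite iotaD add0n /= iotaD subnKC.
rewrite count_cat /= count_cat /= !leqnn (ltnW st) !brkJ_dropK // /=.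
rewrite (eq_in_count (a2 := pred0)); last first.
  by move=> j; rewrite mem_iota add0n /= => h; rewrite leqNgt h.
rewrite [count _ (iota t.2.+1 _)](eq_in_count (a2 := pred0)); last first.
  by move=> j; rewrite mem_iota => /andP[h _]; rewrite /= [(j <= _)%N]leqNgt h andbF.
rewrite !count_pred0 /cnt add0n addn0 addnA addnC addnA; congr (_ + _)%N.
apply: eq_in_count => j; rewrite mem_iota subnKC // => /andP[h1 h2].
by rewrite (ltnW h1) (ltnW h2).
Qed.

End Decomposition.

(** * Counting the subdivisions built around p *)

Lemma card_Vp : #|Vp| = m.+3.
Proof. by rewrite cardsU1 p_gset card_gset count_predT size_iota. Qed.

Definition interp (v : m.-tuple bool) : nat -> R :=
  projT1 (cid (exists_interp qx_incr (nth false v) qh)).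

Lemma interpP (v : m.-tuple bool) : is_interp qx m (nth false v) qh (interp v).
Proof. exact: projT2 (cid (exists_interp qx_incr (nth false v) qh)). Qed.

Definition outs v : m.-tuple bool :=
  [tuple out_coord qx qh (interp v) (nth false v) i | i < m].

Lemma nth_outs v i : (i < m)%N ->
  nth false (outs v) i = out_coord qx qh (interp v) (nth false v) i.
Proof.
move=> im; exact: (nth_mktuple
  (fun i : 'I_m => out_coord qx qh (interp v) (nth false v) i) false (Ordinal im)).
Qed.

Lemma eq_tuple_nth (v v' : m.-tuple bool) :
  (forall i, (i < m)%N -> nth false v i = nth false v' i) -> v = v'.
Proof.
move=> H; apply/val_inj/(@eq_from_nth _ false) => [|i]; first by rewrite !size_tuple.
by rewrite size_tuple; apply: H.
Qed.

Lemma outs_inj : injective outs.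
Proof.
move=> v v' E; apply: eq_tuple_nth.
apply: (out_coord_inj qx_incr qh_gen (interpP v) (interpP v')) => i im _.
by rewrite -!nth_outs // E.
Qed.

Lemma wgap_outs (v : m.-tuple bool) : coef_le (wgap 0 (outs v))
  ((1 + 'X) ^+ count id (outs v) *
   \prod_(B <- blocks (nth false v) (interp v)) dpoly nat (#|B| - 2)).
Proof.
pose brk := brkJ (nth false v) (interp v); pose act j := ~~ dropK (nth false v) (interp v) j.
(* An element of out(v) separates two blocks if it is in v and is discarded otherwise; these are the
   two kinds of cuts. *)
have E : outs v = map (cut brk act) (iota 1 m) :> seq bool.
  apply: (@eq_from_nth _ false) => [|i]; first by rewrite size_map size_iota size_tuple.
  rewrite size_tuple => im; rewrite nth_outs // (nth_map 0%N) ?size_iota // nth_iota //.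
  rewrite add1n /cut /brk /act negbK brkJ_int // dropK_int //.
  by case: (out_coord _ _ _ _ _); case: (nth _ _ _).
rewrite E count_map /blocks big_map big_seq.
rewrite (eq_bigr (fun t => dpoly nat (cnt act t.1 t.2))) => [|t /card_blockE ->]; last first.
  by rewrite !subSS subn0.
rewrite -big_seq prod_intervals // /cnt /=.
exact: wgap_wblocks.
Qed.

Lemma star_step k :
  (forall V, (1 < #|V| < #|Vp|)%N -> forall k,
    (((dpoly nat (#|V| - 2))`_k)%R <= #|regular_cells X Y V k|)%N) ->
  (((dpoly nat m.+1)`_k)%R <= #|regular_cells X Y Vp k|)%N.
Proof.
move=> IH; pose bl (v : m.-tuple bool) := blocks (nth false v) (interp v).
pose S := [set d : m.-tuple bool * m.-tuple bool * {set {set 'I_n}} |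
  all2 implb d.1.2 (outs d.1.1) && ((count id d.1.2 <= k)%N &&
    (d.2 \in family_set X Y (bl d.1.1) (k - count id d.1.2)%N))].
apply: (@leq_trans #|S|).
  rewrite (card_dep_triple (fun v P => all2 implb (val P) (outs v))
    (fun v P U => (count id (val P) <= k)%N && (U \in family_set X Y (bl v) (k - count id (val P))%N))).
  rewrite -sum_wgap (reindex_inj outs_inj) coef_sum; apply: leq_sum => v _.
  apply: leq_trans (wgap_outs v k) _.
  rewrite -(sum_subtuples (size_tuple (outs v))) mulr_suml coef_sum; apply: leq_sum => P _.
  rewrite coefXnM; have [//|le] := ltnP k (count id P).
  apply: (@leq_trans #|family_set X Y (bl v) (k - count id P)%N|); last first.
    by apply/subset_leq_card/subsetP => U fU; rewrite inE.
  apply: card_family_set => [//||B /mapP[t tJ ->]].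
    exact: block_family_chain.
  move=> k'; apply: IH; rewrite card_blockE // card_Vp /=.
  have [/andP[st tm] _ _ _] := interval_full (brkJ0 _ _) (brkJm _ _) tJ.
  rewrite /cnt !ltnS; apply: leq_trans (count_size _ _) _; rewrite size_iota.
  by move: t.1 t.2 st tm => a b; lia.
have exw d : exists w, d \in S ->
    [/\ star_set (nth false d.1.1) (nth false d.1.2) \subset cells Vp w, d.2 \subset cells Vp w,
       block_family X Y (bl d.1.1) d.2, all2 implb d.1.2 (outs d.1.1) &
       codim_span (cells Vp w) = k].
  have [dS|nS] := boolP (d \in S); last by exists 0.
  move: dS; rewrite inE => /and3P[h1 h2]; rewrite inE => /andP[/asboolP fU /eqP E].
  have out i : (i < m)%N -> nth false d.1.2 i -> out_coord qx qh (interp d.1.1) (nth false d.1.1) i.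
    by move=> im Pi; rewrite -nth_outs //; apply: (all2_implb h1) Pi; rewrite !size_tuple.
  have [w [w1 w2 w3]] := realize (interpP d.1.1) out fU; exists w => _; split=> //.
  by rewrite w3 E /flats card_ord_pred count_nth_iota subnK.
pose W d := projT1 (cid (exw d)).
have WP d : d \in S -> [/\ star_set (nth false d.1.1) (nth false d.1.2) \subset cells Vp (W d),
    d.2 \subset cells Vp (W d), block_family X Y (bl d.1.1) d.2, all2 implb d.1.2 (outs d.1.1) &
    codim_span (cells Vp (W d)) = k] by apply: projT2 (cid (exw d)).
rewrite -(card_in_imset (f := fun d => cells Vp (W d)) (D := S)).
  apply/subset_leq_card/subsetP => T /imsetP[d /WP[_ _ _ _ E] ->]; rewrite inE E eqxx andbT.
  by apply/asboolP; exists (W d).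
move=> [[v P] U] [[v' P'] U'] /WP[/= s1 u1 f1 a1 _] /WP[/= s2 u2 f2 a2 _] E.
rewrite -E in s2 u2.
have {}a1 : all2 implb P (outs v) by [].
have {}a2 : all2 implb P' (outs v') by [].
have on i : (i < m)%N -> nth false v i || nth false P i = nth false v' i || nth false P' i.
  by move=> im; rewrite (decode_onstar s1) // (decode_onstar s2).
have PP' : P = P'.
  apply: eq_tuple_nth => i im; have o := on i im; have [h|h] := boolP (nth false v i || nth false P i).
    rewrite (decode_flat s1 im h); rewrite o in h.
    by rewrite (decode_flat s2 im h).
  have := h; rewrite o in h; move: h; rewrite !negb_or => /andP[_ /negbTE->].
  by case/andP => _ /negbTE->.
(* Knowing v together with Phi, and Phi itself, v and v' can differ only inside Phi, where both
   out-coordinates are true. This is why [out_coord_inj] compares only the coordinates where v and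
   v' differ. *)
have vv' : v = v'.
  apply: eq_tuple_nth; apply: (out_coord_inj qx_incr qh_gen (interpP v) (interpP v')) => i im ne.
  have Pi : nth false P i.
    by have := on i im; rewrite -PP'; case: (nth false P i) => //; rewrite !orbF => e; rewrite e eqxx in ne.
  rewrite -!nth_outs //.
  have /(_ _ Pi)-> := all2_implb a1 (i := i); last by rewrite !size_tuple.
  by rewrite PP' in Pi; have /(_ _ Pi)-> := all2_implb a2 (i := i); rewrite ?size_tuple.
subst v' P'; congr (_, _).
by rewrite (decode_family f1 u1) (decode_family f2 u2).
Qed.

End Star.

(** * Induction on the number of points *)

Section Count.
Variables (R : realFieldType) (n : nat) (X Y : 'I_n -> R).
Hypotheses (gp : gen_pos X Y) (Y_inj : injective Y).

Lemma card_regular_cells (V : {set 'I_n}) k : (1 < #|V|)%N ->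
  (((dpoly nat (#|V| - 2))`_k)%R <= #|regular_cells X Y V k|)%N.
Proof.
have [N] := ubnP #|V|; elim: N V k => // N IH V k ltN V1.
(* Blocks may have only two points, so the induction starts with digons and their empty
   subdivision. *)
have [V2|V3] := leqP #|V| 2.
  have -> : #|V| = 2 by apply/eqP; rewrite eqn_leq V2.
  rewrite dpoly0 coef1; case: eqP => // ->; apply/card_gt0P; exists set0.
  rewrite inE codim_span0 eqxx andbT; apply/asboolP; exists 0.
  apply/setP => C; rewrite in_set0; apply/negP => /cellsP[CV C3 _].
  by have := leq_trans C3 (leq_trans (subset_leq_card CV) V2); rewrite ltnn.
have [i0 i0V] : exists i, i \in V by apply/card_gt0P/(leq_trans _ V1).
case: (@arg_minP _ _ _ i0 [in V] Y i0V) => p pV pmin.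
pose x i := (X i - X p) / (Y i - Y p).
pose s := sort (fun i j => x i <= x j) (enum (V :\ p)).
have [m Vm] : exists m, #|V| = m.+3 by exists (#|V| - 3)%N; lia.
have ss : size s = m.+2.
  by rewrite size_sort -cardE; have := cardsD1 p V; rewrite pV Vm add1n => -[].
have su : uniq s by rewrite sort_uniq enum_uniq.
have sE i : (i \in s) = (i != p) && (i \in V) by rewrite mem_sort mem_enum in_setD1.
pose q := nth p s.
have qs j : (j <= m.+1)%N -> q j \in s by move=> jm; rewrite mem_nth ?ss.
have q_inj i j : (i <= m.+1)%N -> (j <= m.+1)%N -> q i = q j -> i = j.
  by move=> im jm /eqP; rewrite nth_uniq ?ss // => /eqP.
have q_above j : (j <= m.+1)%N -> Y p < Y (q j).
  move=> /qs; rewrite sE => /andP[ne qV]; rewrite lt_neqAle pmin // andbT.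
  by rewrite (inj_eq Y_inj) eq_sym.
have qx_incr i j : (i < j)%N -> (j <= m.+1)%N -> qx X Y p q i < qx X Y p q j.
  move=> ij jm; have im : (i <= m.+1)%N := leq_trans (ltnW ij) jm.
  rewrite lt_neqAle; apply/andP; split; last first.
    apply: (@sorted_ltn_nth _ (fun i j => x i <= x j)); rewrite ?inE ?ss //.
      by move=> a b c; apply: le_trans.
    by apply: sort_sorted => a b; apply: le_total.
  have nij : q i != q j by apply/eqP => /(q_inj _ _ im jm) E; rewrite E ltnn in ij.
  have := qs i im; rewrite sE => /andP[ip _]; have := qs j jm; rewrite sE => /andP[jp _].
  have hi : Y (q i) - Y p != 0 by rewrite gt_eqF // subr_gt0 q_above.
  have hj : Y (q j) - Y p != 0 by rewrite gt_eqF // subr_gt0 q_above.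
  rewrite eq_sym in ip; rewrite eq_sym in jp.
  (* Two points in the same direction from p would be collinear with it. *)
  apply: contraNneq (gp ip jp nij) => /eqP; rewrite /qx /qb eqr_div // => /eqP E.
  by rewrite /det3 E subrr.
have VE : Vp p m q = V.
  apply/setP => i; rewrite in_setU1; have [->|ne] /= := eqVneq i p; first by rewrite pV.
  apply/idP/idP => [/gsetP[j jm [_ ->]]|iV]; first by have := qs j jm; rewrite sE => /andP[].
  have : i \in s by rewrite sE ne.
  by move/(nthP p) => [j]; rewrite ss => jm <-; rewrite -/(q j) mem_gset.
rewrite -{2}VE Vm !subSS subn0.
apply: (star_step gp q_inj q_above qx_incr) => B; rewrite VE => /andP[B1 BV] k'.
by apply: IH => //; apply: leq_trans BV _.
Qed.

End Count.

(** Distinct ordinates put the lowest point strictly below the others at every stage of the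
    induction, so the heights 1 / (Y q_j - Y p) make sense. *)
Lemma generic_shear (R : realType) n (P : 'I_n -> 'rV[R]_2) :
  injective P -> exists s, injective (py P s).
Proof.
move=> Pinj; have [|s _ Hs] := @ev_small_ex R
  (fun s => forall i j, i != j -> P i 0 1 - P j 0 1 + s * (P i 0 0 - P j 0 0) != 0).
  apply: ev_small_forall => i; apply: ev_small_forall => j; have [->|ij] := eqVneq i j.
    by exists 1.
  apply: ev_small_imp (_ : ev_small (fun e => P i 0 1 - P j 0 1 + e * (P i 0 0 - P j 0 0) != 0)).
    by move=> e _ h _.
  apply: ev_small_neq0; apply: contraT; rewrite negb_or !negbK !subr_eq0 => /andP[/eqP h1 /eqP h0].
  case/eqP: ij; apply: Pinj; apply/rowP => c.
  by have := ord2P c; case=> ->.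
exists s => i j E; apply/eqP; apply: contraT => /Hs/negP[]; apply/eqP.
by move: E; rewrite /py => E; lra.
Qed.

Theorem mainTheorem1 (R : realType) (n : nat) (hn : (3 <= n)%N)
    (P : 'I_n -> 'rV[R]_2) (hP : general_position P)
    (k : nat) (hk : (k <= n - 3)%N) :
  (num_polygon_subdivisions n k <= num_regular_subdivisions P k)%N /\
  (num_polygon_subdivisions n k)%:R =
    (n - 1)%N%:R^-1 * 'C(n - 3, k)%:R * 'C(2 * n - 4 - k, n - 2)%:R :> rat.
Proof.
have [Pinj _] := hP; rewrite num_polygon_subdivisionsE //; split.
  have [s s_inj] := generic_shear Pinj; have gp := gen_pos_config s hP.
  rewrite (num_regular_cells gp) //.
  by have := @card_regular_cells _ _ _ _ gp s_inj [set: 'I_n]%SET k; rewrite cardsT card_ord; apply; lia.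
rewrite dpoly_coef; [|lia|lia].
have -> : (n - 2).+1 = (n - 1)%N by lia.
have -> : (n - 2).-1 = (n - 3)%N by lia.
by have -> : (2 * (n - 2) - k = 2 * n - 4 - k)%N by lia.
Qed.
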